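(* Let $V$ be a complex vector space of dimension $6$ and let $A\in\mathbb{LG}(\bigwedge^3V)$ be a semistable Lagrangian subspace. Then $Y_A\ne\mathbb{P}(V)$ and $Y_{\delta_V(A)}\ne\mathbb{P}(V^\vee)$.
   Context: Fix a volume form $\mathrm{vol}$ on $V$; $\bigwedge^3V$ has the symplectic form $(\alpha,\beta)_V=\mathrm{vol}(\alpha\wedge\beta)$; $\mathbb{LG}(\bigwedge^3V)$ is the variety of Lagrangian subspaces, and semistability is GIT semistability for the $\mathrm{PGL}(V)$-action with its (unique up to multiples) linearized ample line bundle (equivalently $\mathrm{SL}(V)$ with the Plücker linearization). For $0\ne v\in V$ let $F_v=\{\alpha\in\bigwedge^3V\mid v\wedge\alpha=0\}$, the fiber at $[v]$ of a rank-$10$ subbundle $F\subset\bigwedge^3V\otimes\mathcal{O}_{\mathbb{P}(V)}$. $Y_A\subset\mathbb{P}(V)$ is the zero scheme of the determinant of the natural map $F\to(\bigwedge^3V/A)\otimes\mathcal{O}_{\mathbb{P}(V)}$; set-theoretically $Y_A=\{[v]\mid F_v\cap A\ne\{0\}\}$. It is a sextic hypersurface or all of $\mathbb{P}(V)$. $\delta_V\colon\bigwedge^3V\to\bigwedge^3V^\vee$ is the isomorphism sending $\alpha$ to the functional $\beta\mapsto\mathrm{vol}(\alpha\wedge\beta)$. It sends Lagrangian subspaces of $\bigwedge^3V$ to Lagrangian subspaces of $\bigwedge^3V^\vee$ (with respect to the symplectic form given by wedge product followed by a volume form on $V^\vee$). For $0\ne f\in V^\vee$ let $F'_f=\{\varphi\in\bigwedge^3V^\vee\mid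 f\wedge\varphi=0\}$, the fiber at $[f]$ of a rank-$10$ subbundle $F'\subset\bigwedge^3V^\vee\otimes\mathcal{O}_{\mathbb{P}(V^\vee)}$. $Y_{\delta_V(A)}\subset\mathbb{P}(V^\vee)$ is the zero scheme of the determinant of the natural map $F'\to(\bigwedge^3V^\vee/\delta_V(A))\otimes\mathcal{O}_{\mathbb{P}(V^\vee)}$; set-theoretically $Y_{\delta_V(A)}=\{[f]\mid F'_f\cap\delta_V(A)\ne\{0\}\}$. *)

(* Defs.v *)
From HB Require Import structures.
From mathcomp Require Import all_boot all_order all_algebra.
From mathcomp Require Import mpoly.
From mathcomp Require Import classical_sets reals complex.
Set Implicit Arguments. Unset Strict Implicit. Unset Printing Implicit Defensive.
Import GRing.Theory.
Local Open Scope ring_scope.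

(** * Exterior powers

    The exterior power [Lambda k V] of a finite-dimensional space [V] is
    realized on the basis [e_S = e_(s_1) /\ ... /\ e_(s_k)], indexed by the
    [k]-subsets [S = {s_1 < ... < s_k}], where [e] is the basis
    [vbasis {:V}] of [V]. *)

Notation ksub n k := {S : {set 'I_n} | #|S| == k}.

(* The [j]-th smallest element of [S]. *)
Definition ksub_nth n k (S : ksub n k) (j : 'I_k) : 'I_n :=
  enum_val (cast_ord (esym (eqP (valP S))) j).

Section ExteriorPower.
Variable K : fieldType.

Definition Lambda (k : nat) (V : vectType K) : Type :=
  {ffun ksub (\dim {:V}) k -> K^o}.

HB.instance Definition _ k V := Vector.on (Lambda k V).

Definition bvec (V : vectType K) (i : 'I_(\dim {:V})) : V := (vbasis {:V})`_i.

Definition Lbasis k (V : vectType K) (S : ksub (\dim {:V}) k) : Lambda k V :=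
  [ffun T => (T == S)%:R].

(* The decomposable element [v_1 /\ ... /\ v_k]: its coordinates are the
   maximal minors of the matrix of coordinates of the [v_i]. *)
Definition wedgev k (V : vectType K) (v : 'I_k -> V) : Lambda k V :=
  [ffun S => \det (\matrix_(i < k, j < k)
                     coord (vbasis {:V}) (ksub_nth S j) (v i))].

Definition ninv n k l (T : ksub n k) (U : ksub n l) : nat :=
  #|[pred p : 'I_n * 'I_n |
       [&& p.1 \in val T, p.2 \in val U & (p.2 < p.1)%N]]|.

(* [e_T /\ e_U] is [(-1) ^ ninv T U] times [e_(T :|: U)] when [T] and [U] are
   disjoint and [0] otherwise. Disjointness is implied below by the condition
   [T :|: U = S], since [S] has [k + l] elements. *)
Definition wedge k l (V : vectType K) (x : Lambda k V) (y : Lambda l V) :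
    Lambda (k + l) V :=
  [ffun S : ksub (\dim {:V}) (k + l) =>
     \sum_(T : ksub (\dim {:V}) k)
       \sum_(U : ksub (\dim {:V}) l | val T :|: val U == val S)
         (-1) ^+ ninv T U * x T * y U].

Fact wedge_is_linear k l (V : vectType K) (x : Lambda k V) :
  linear (@wedge k l V x).
Proof.
move=> a y z; apply/ffunP=> S; rewrite !ffunE.
rewrite scaler_sumr -big_split; apply: eq_bigr => T _ /=.
rewrite scaler_sumr -big_split; apply: eq_bigr => U _ /=.
by rewrite !ffunE /= mulrDr /GRing.scale /= mulrCA.
Qed.

HB.instance Definition _ k l (V : vectType K) (x : Lambda k V) :=
  GRing.isLinear.Build K (Lambda l V) (Lambda (k + l) V) *:%R
    (@wedge k l V x) (@wedge_is_linear k l V x).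

Fact wedgePl k l (V : vectType K) (a : K) (x x' : Lambda k V) (y : Lambda l V) :
  wedge (a *: x + x') y = a *: wedge x y + wedge x' y.
Proof.
apply/ffunP=> S; rewrite !ffunE.
rewrite scaler_sumr -big_split; apply: eq_bigr => T _ /=.
rewrite scaler_sumr -big_split; apply: eq_bigr => U _ /=.
by rewrite !ffunE /= mulrDr mulrDl /GRing.scale /= !mulrA [_ * a]mulrC.
Qed.

(* The endomorphism of [Lambda k V] induced by [g], i.e.
   [v_1 /\ ... /\ v_k |-> g v_1 /\ ... /\ g v_k]. *)
Definition Lmap k (V : vectType K) (g : 'End(V)) (x : Lambda k V) :
    Lambda k V :=
  \sum_(S : ksub (\dim {:V}) k)
     x S *: wedgev (fun j => g (bvec (ksub_nth S j))).

Definition is_SL (V : vectType K) (g : 'End(V)) : Prop :=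
  \det (passmx.mxof (vbasis {:V}) (vbasis {:V}) g) = 1.

Definition dual (V : vectType K) : vectType K := 'Hom(V, K^o).

(* The dual basis of [vbasis {:V}]. *)
Definition dvec (V : vectType K) (i : 'I_(\dim {:V})) : dual V :=
  linfun (coord (vbasis {:V}) i : V -> K^o).

(* The inverse of the isomorphism [Lambda k (dual V) -> dual (Lambda k V)]
   given by [(f_1 /\ ... /\ f_k) (v_1 /\ ... /\ v_k) = \det (f_i v_j)]: it
   sends the functional [phi] to [\sum_S phi(e_S) e*_S], where [e*_S] is the
   wedge product of the dual basis vectors with indices in [S]. *)
Definition Ldual k (V : vectType K) (phi : dual (Lambda k V)) :
    Lambda k (dual V) :=
  \sum_(S : ksub (\dim {:V}) k)
     phi (Lbasis S) *: wedgev (fun j => dvec (ksub_nth S j)).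

(** * Lagrangian subspaces of [Lambda 3 V] for [V] of dimension 6

    A volume form on [V] is a nonzero linear functional on [Lambda 6 V]. *)

Definition symp (V : vectType K) (vol : 'Hom(Lambda 6 V, K^o))
    (x y : Lambda 3 V) : K := vol (wedge x y).

Definition lagrangian (V : vectType K) (vol : 'Hom(Lambda 6 V, K^o))
    (A : {vspace Lambda 3 V}) : Prop :=
  \dim A = 10%N /\ {in A &, forall x y, symp vol x y = 0}.

Definition delta (V : vectType K) (vol : 'Hom(Lambda 6 V, K^o)) :
    'Hom(Lambda 3 V, Lambda 3 (dual V)) :=
  linfun (fun x : Lambda 3 V => Ldual (linfun (symp vol x : _ -> K^o))).

Fact deltaE (V : vectType K) (vol : 'Hom(Lambda 6 V, K^o)) (x : Lambda 3 V) :
  delta vol x = \sum_(S : ksub (\dim {:V}) 3)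
    symp vol x (Lbasis S) *: wedgev (fun j => dvec (ksub_nth S j)).
Proof.
have LdualE (z : Lambda 3 V) : Ldual (linfun (symp vol z : _ -> K^o)) =
    \sum_(S : ksub (\dim {:V}) 3)
      symp vol z (Lbasis S) *: wedgev (fun j => dvec (ksub_nth S j)).
  apply: eq_bigr => S _; congr (_ *: _).
  have slin : linear (symp vol z : _ -> K^o).
    by move=> a y y'; rewrite /symp linearP linearP.
  pose sl := GRing.isLinear.Build _ _ _ _ _ slin.
  pose f : {linear Lambda 3 V -> K^o} := HB.pack (symp vol z : _ -> K^o) sl.
  by rewrite -[symp vol z]/(f : _ -> _) lfunE.
have dlin : linear (fun z : Lambda 3 V => Ldual (linfun (symp vol z : _ -> K^o))).
  move=> a y y'; rewrite !LdualE scaler_sumr -big_split; apply: eq_bigr => S _ /=.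
  by rewrite /symp wedgePl linearP scalerDl scalerA.
pose dl := GRing.isLinear.Build _ _ _ _ _ dlin.
pose f : {linear Lambda 3 V -> Lambda 3 (dual V)} :=
  HB.pack (fun z : Lambda 3 V => Ldual (linfun (symp vol z : _ -> K^o))) dl.
by rewrite /delta -LdualE -[fun z => _]/(f : _ -> _) lfunE.
Qed.

(** * Semistability *)

(* The Pluecker vector [b_1 /\ ... /\ b_10]. When [b] runs over the bases of
   the Lagrangian subspaces, it runs over the nonzero points of the affine
   cone over the Lagrangian Grassmannian in its Pluecker embedding. *)
Definition plucker (V : vectType K) (b : 10.-tuple (Lambda 3 V)) :
    Lambda 10 (Lambda 3 V) := wedgev (tnth b).

Definition Lpoly k (W : vectType K) : Type :=
  {mpoly K[#|{: ksub (\dim {:W}) k}|]}.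

Definition Leval k (W : vectType K) (P : Lpoly k W) (x : Lambda k W) : K :=
  P.@[fun i => x (enum_val i)].

(* The restriction of the homogeneous form [P] of degree [d] to the cone over
   the Lagrangian Grassmannian is a section of the [d]-th power of the
   Pluecker line bundle; this says that this section is [SL(V)]-invariant.
   Every section is obtained in this way, the Pluecker embedding being
   projectively normal. *)
Definition SL_invariant_section (V : vectType K)
    (vol : 'Hom(Lambda 6 V, K^o)) (P : Lpoly 10 (Lambda 3 V)) : Prop :=
  forall (B : {vspace Lambda 3 V}) (b : 10.-tuple (Lambda 3 V)) (g : 'End(V)),
    lagrangian vol B -> basis_of B b -> is_SL g ->
    Leval P (plucker [tuple of map (Lmap g) b]) = Leval P (plucker b).

Definition semistable (V : vectType K) (vol : 'Hom(Lambda 6 V, K^o))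
    (A : {vspace Lambda 3 V}) : Prop :=
  exists d (P : Lpoly 10 (Lambda 3 V)),
    [/\ (0 < d)%N, P \is d.-homog, SL_invariant_section vol P
      & exists2 b : 10.-tuple (Lambda 3 V),
          basis_of A b & Leval P (plucker b) != 0].

(** * EPW sextics *)

Definition Fiber (V : vectType K) (v : V) : {vspace Lambda 3 V} :=
  lker (linfun (@wedge 1 3 V (wedgev (fun=> v)))).

(* A point [[v]] of the projective space of [V] is the line [<[v]>]. *)
Definition PSpace (V : vectType K) : set {vspace V} :=
  [set L | exists2 v : V, v != 0 & L = <[v]>%VS]%classic.

(* The set of points of the zero scheme of the determinant of the natural map
   [F -> (Lambda 3 V / A) (x) O] of bundles of rank 10: at [[v]], this map has
   kernel [Fiber v :&: A]. Over an algebraically closed field this scheme is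
   the whole projective space, which is reduced, iff its set of points is. *)
Definition Y (V : vectType K) (A : {vspace Lambda 3 V}) : set {vspace V} :=
  [set L | exists v : V,
     [/\ v != 0, L = <[v]>%VS & (Fiber v :&: A != 0)%VS]]%classic.

End ExteriorPower.

Arguments PSpace {K} V _.

(* Main.v *)
Require Import Defs.
From HB Require Import structures.
From mathcomp Require Import all_boot all_order all_algebra.
From mathcomp Require Import fingroup perm mpoly.
From mathcomp Require Import boolp reals complex.
From mathcomp Require Import ring zify.
Set Implicit Arguments. Unset Strict Implicit. Unset Printing Implicit Defensive.
Import Order.TTheory GRing.Theory Num.Theory.
Local Open Scope ring_scope.

(** The proof is by contraposition: if [A] meets [Fiber v] for every [v <> 0],
    a one-parameter subgroup of [SL(V)] destabilizes [A].

    Through the volume form a trivector [x] becomes an alternating 3-form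
    [tau vol x], and membership in [Fiber v] makes the contraction of this form
    with [v] vanish. Choose [v] such that the rank of this contraction, as a
    linear map on [A], is maximal. A vector [x0] of [A] in the fibre at [v]
    then extends, along every line through [v] and to every order, to a formal
    family of vectors of [A] in the fibres ([jet_sub], [kernel_jets]).

    All the terms of these families are orthogonal, since [A] is isotropic.
    Orthogonality of [x0] with the first-order terms makes [x0] decomposable,
    with a kernel [W] of dimension 3 that contains [v] ([x0_12]).
    Orthogonality of the first-order terms with each other, and of [x0] with
    the second-order terms, makes the first-order terms tangent to the
    Grassmannian at [x0] ([hess0], [x1_12]): modulo [x0], they are linear maps
    from [W] to [V / W], indexed by [y] in [V / W]. The next order gives a
    cubic equation: such a map sends the basis of [W] to [- y], [y P], [y Q],
    and these three vectors are dependent for each [y] ([phi_dependent]). An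
    elementary argument on 3x3 matrices ([dependent3_dichotomy]) deduces that
    either all these maps kill a common vector of [W], or all of them send a
    common plane of [W] into a common line.

    In each case the vector, or the plane and the line, defines a flag in [V]
    and weights for which [x0] and the tangent vectors have large weight. The
    rest of the weight filtration of [A] is then large too: each vector of [A]
    of large weight gives a linear relation on the coordinates of small weight
    of the vectors of [A], by isotropy ([dim_vanish]). So [A] has a basis whose
    weights have a positive sum, and invariant forms vanish at its Pluecker
    vector by the argument of Hilbert and Mumford ([destabilized]).

    For the dual hypersurface, the form on the dual space of [delta vol x] is
    up to a constant [x] itself, seen as a function of three functionals
    ([symp_delta]). The local study and the construction of the flag are about
    an abstract family of alternating forms with an isotropic pairing; they
    apply to these forms on the dual space, and dual bases transfer the
    resulting flag back to [V] with the opposite weights. *)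

(** * Alternating maps and decomposable multivectors *)

Section Alternating.
Variables (K : fieldType) (k : nat).

Definition upd (X : Type) (v : 'I_k -> X) (i : 'I_k) (x : X) : 'I_k -> X :=
  fun j => if j == i then x else v j.

Lemma upd_id X (v : 'I_k -> X) i : upd v i (v i) = v.
Proof. by apply: funext => j; rewrite /upd; case: eqP => // ->. Qed.

Lemma updC X (v : 'I_k -> X) i j x y :
  i != j -> upd (upd v i x) j y = upd (upd v j y) i x.
Proof.
move=> /negPf ij; apply: funext => l; rewrite /upd.
by case: (eqVneq l j) => // ->; rewrite eq_sym ij.
Qed.

Variables (V U : lmodType K).

Definition multilinear (F : ('I_k -> V) -> U) : Prop :=
  forall v i a x y,
    F (upd v i (a *: x + y)) = a *: F (upd v i x) + F (upd v i y).

Definition alternating (F : ('I_k -> V) -> U) : Prop :=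
  forall v i j, i != j -> v i = v j -> F v = 0.

Variable F : ('I_k -> V) -> U.
Hypotheses (Fml : multilinear F) (Falt : alternating F).

Lemma multilinear0 v i : F (upd v i 0) = 0.
Proof. by have := Fml v i (-1) 0 0; rewrite scaler0 addr0 scaleN1r addNr. Qed.

Lemma multilinear_sum v i (I : finType) (c : I -> K) (x : I -> V) :
  F (upd v i (\sum_j c j *: x j)) = \sum_j c j *: F (upd v i (x j)).
Proof.
elim/big_rec2: _ => [|j y1 y2 _ <-]; first exact: multilinear0.
by rewrite Fml.
Qed.

Lemma alternating_tperm v i j : i != j -> F (v \o tperm i j) = - F v.
Proof.
move=> ij; have ji : j != i by rewrite eq_sym.
pose G x y := F (upd (upd v i x) j y).
have Gxx x : G x x = 0.
  by apply: (Falt ij); rewrite /upd (negPf ij) !eqxx.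
have GD x1 x2 y : G (x1 + x2) y = G x1 y + G x2 y.
  by rewrite /G !(updC _ _ _ ij) -[x1]scale1r Fml !scale1r.
have GDr x y1 y2 : G x (y1 + y2) = G x y1 + G x y2.
  by rewrite /G -[y1]scale1r Fml !scale1r.
have /eqP := Gxx (v i + v j); rewrite GD !GDr !Gxx add0r addr0 addr_eq0.
have -> : G (v i) (v j) = F v by rewrite /G upd_id upd_id.
move/eqP=> ->; rewrite opprK; congr F; apply: funext => l /=.
rewrite /upd; case: (eqVneq l j) => [->|lj]; first by rewrite tpermR.
by case: (eqVneq l i) => [->|li]; rewrite ?tpermL // tpermD // eq_sym.
Qed.

Lemma alternating_perm0 v (s : {perm 'I_k}) : F v = 0 -> F (v \o s) = 0.
Proof.
have [ts -> _] := prod_tpermP s.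
elim: ts v => [|[i j] ts IH] v Fv0.
  by rewrite big_nil; rewrite -[RHS]Fv0; congr F; apply: funext => l /=; rewrite perm1.
rewrite big_cons /=; have [->|ij] := eqVneq i j.
  by rewrite tperm1 mul1g; exact: IH.
have -> : v \o (tperm i j * \prod_(t <- ts) tperm t.1 t.2)%g =
  (v \o (\prod_(t <- ts) tperm t.1 t.2)%g) \o tperm i j.
  by apply: funext => l /=; rewrite permM.
by rewrite alternating_tperm // IH ?oppr0.
Qed.

End Alternating.

Section ExtUniv.
Variables (K : fieldType) (k : nat) (V : vectType K).
Local Notation n := (\dim {:V}).
Implicit Types (v : 'I_k -> V) (S : ksub n k).

Lemma ksub_nth_inj n' (S : ksub n' k) : injective (ksub_nth S).
Proof. by move=> i j /enum_val_inj/cast_ord_inj. Qed.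

Lemma ksub_nth_in n' (S : ksub n' k) i : ksub_nth S i \in val S.
Proof. exact: enum_valP. Qed.

Lemma ksub_nthP n' (S : ksub n' k) x : x \in val S -> exists i, x = ksub_nth S i.
Proof.
move=> xS; exists (cast_ord (eqP (valP S)) (enum_rank_in xS x)).
by rewrite /ksub_nth cast_ordK enum_rankK_in.
Qed.

(** Expanding every argument on the spanning family leaves the sequences of
    vectors [b_(f 0), b_(f 1), ...]: such a sequence repeats a vector, or is a
    rearrangement of an increasing one. *)
Lemma alternating_span0 (n' : nat) (b : 'I_n' -> V) (U : lmodType K)
    (F : ('I_k -> V) -> U) :
    (forall x, exists c : 'I_n' -> K, x = \sum_i c i *: b i) ->
    multilinear F -> alternating F ->
    (forall S : ksub n' k, F (fun j => b (ksub_nth S j)) = 0) ->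
  forall v, F v = 0.
Proof.
move=> bspan Fml Falt FS.
have Fb (f : 'I_k -> 'I_n') : F (fun j => b (f j)) = 0.
  case: (boolP (injectiveb f)) => [/injectiveP finj|/injectivePn[i [j ij fij]]]; last first.
    by apply: (Falt _ i j ij); rewrite fij.
  have cS : #|[set f j | j in 'I_k]| == k by rewrite card_imset // card_ord.
  pose S : ksub n' k := exist (fun A : {set 'I_n'} => #|A| == k) _ cS.
  have fS j : exists i, f j == ksub_nth S i.
    by have [|i ->] := @ksub_nthP _ S (f j); [exact: imset_f|exists i].
  pose g j := xchoose (fS j).
  have fg j : f j = ksub_nth S (g j) by apply/eqP; exact: (xchooseP (fS j)).
  have ginj : injective g by move=> i j gij; apply: finj; rewrite !fg gij.
  rewrite -[RHS](alternating_perm0 Fml Falt (perm ginj) (FS S)).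
  by congr F; apply: funext => j /=; rewrite permE -fg.
(* The first [m] arguments remain to be expanded. *)
suff main m v : (forall j : 'I_k, (m <= j)%N -> exists i, v j = b i) -> F v = 0.
  by move=> v; apply: (main k) => j; rewrite leqNgt ltn_ord.
elim: m v => [|m IH] v vb.
  have /boolp.choice[f fP] : forall j : 'I_k, exists i, v j = b i.
    by move=> j; exact: vb.
  by rewrite (_ : v = fun j => b (f j)) ?Fb //; exact: funext.
case: (ltnP m k) => [mk|km]; last first.
  by apply: IH => j mj; move: (ltn_ord j); rewrite ltnNge (leq_trans km mj).
pose j0 := Ordinal mk; have [c vc] := bspan (v j0).
rewrite -[v](upd_id _ j0) vc (multilinear_sum Fml) big1 // => i _.
rewrite IH ?scaler0 // => j mj.
rewrite /upd; case: (eqVneq j j0) => [_|jj0]; first by exists i.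
by apply: vb; rewrite ltn_neqAle mj andbT; apply: contra jj0 => /eqP mj'; apply/eqP/val_inj.
Qed.

Lemma alternating_eq0 (U : lmodType K) (F : ('I_k -> V) -> U) :
    multilinear F -> alternating F ->
    (forall S : ksub n k, F (fun j => bvec (ksub_nth S j)) = 0) ->
  forall v, F v = 0.
Proof.
apply: alternating_span0 => x; exists (fun i => coord (vbasis {:V}) i x).
exact: coord_vbasis (memvf x).
Qed.

Definition coordmx v : 'M[K]_(k, n) := \matrix_(i, j) coord (vbasis {:V}) j (v i).

Lemma wedgevE v S : wedgev v S = \det (colsub (ksub_nth S) (coordmx v)).
Proof. by rewrite ffunE; congr (\det _); apply/matrixP=> i j; rewrite !mxE. Qed.

Lemma wedgev_mul (M : 'M[K]_k) v :
  wedgev (fun i => \sum_j M i j *: v j) = \det M *: wedgev v.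
Proof.
apply/ffunP=> S; rewrite [RHS]ffunE /= !wedgevE /GRing.scale /= -det_mulmx.
congr (\det _); apply/matrixP=> i j; rewrite !mxE linear_sum.
by apply: eq_bigr => l _; rewrite !mxE linearZ.
Qed.

Lemma wedgev_multilinear : multilinear (@wedgev K k V).
Proof.
move=> v i a x y; apply/ffunP=> S; rewrite !ffunE /GRing.scale /= -[X in _ = _ + X]mul1r.
apply: (@determinant_multilinear _ _ _ _ _ i); apply/matrixP => l j; rewrite !mxE /upd.
- by rewrite eqxx linearP mul1r.
- by rewrite eq_sym (negPf (neq_lift _ _)).
- by rewrite eq_sym (negPf (neq_lift _ _)).
Qed.

Lemma wedgev_alternating : alternating (@wedgev K k V).
Proof.
move=> v i j ij vij; apply/ffunP=> S; rewrite !ffunE.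
by apply: (determinant_alternate ij) => l; rewrite !mxE vij.
Qed.

Lemma coord_bvec i j : coord (vbasis {:V}) i (bvec j) = (j == i)%:R.
Proof. by rewrite /bvec coord_free ?(basis_free (vbasisP _)). Qed.

Lemma wedgev_bvec S T : wedgev (fun j => bvec (ksub_nth S j)) T = (T == S)%:R.
Proof.
rewrite wedgevE; have [->|TS] := eqVneq T S.
  rewrite (_ : colsub _ _ = 1%:M) ?det1 //; apply/matrixP=> i j.
  by rewrite !mxE coord_bvec (inj_eq (@ksub_nth_inj _ S)).
have [i iT] : exists i, ksub_nth S i \notin val T.
  apply/existsP; apply: contraR TS; rewrite negb_exists => /forallP ST.
  rewrite -val_eqE eq_sym eqEcard (eqP (valP S)) (eqP (valP T)) leqnn andbT.
  by apply/subsetP=> x /ksub_nthP[i ->]; have := ST i; rewrite negbK.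
rewrite (expand_det_row _ i) big1 // => j _; rewrite !mxE coord_bvec.
case: eqP => [ij|]; last by rewrite mul0r.
by move: iT; rewrite ij ksub_nth_in.
Qed.

Lemma wedgev_basis S : wedgev (fun j => bvec (ksub_nth S j)) = Lbasis S.
Proof. by apply/ffunP=> T; rewrite wedgev_bvec ffunE. Qed.

Lemma Lambda_expand (x : Lambda k V) : x = \sum_S x S *: Lbasis S.
Proof.
have E S T : (x S *: Lbasis S : Lambda k V) T = x S * (T == S)%:R by rewrite !ffunE.
apply/ffunP=> T; rewrite (sum_ffunE (index_enum _) xpredT (fun S => x S *: Lbasis S)).
transitivity (\sum_S x S * (T == S)%:R); last by apply: eq_bigr => S _; rewrite E.
rewrite (bigD1 T) //= eqxx mulr1 big1 ?addr0 // => S ST.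
by rewrite eq_sym (negPf ST) mulr0.
Qed.

(** The universal property of the exterior power: both sides are alternating
    in [v] and they agree on increasing sequences of basis vectors. *)
Lemma alternating_expand (U : lmodType K) (F : ('I_k -> V) -> U) :
    multilinear F -> alternating F ->
  forall v, F v = \sum_S wedgev v S *: F (fun j => bvec (ksub_nth S j)).
Proof.
move=> Fml Falt v; apply/eqP; rewrite -subr_eq0; apply/eqP.
pose G v := F v - \sum_S wedgev v S *: F (fun j => bvec (ksub_nth S j)).
rewrite -/(G v); apply: alternating_eq0 => {v}.
- move=> v i a x y; rewrite /G Fml wedgev_multilinear.
  rewrite scalerBr addrACA -opprD; congr (_ - _).
  rewrite scaler_sumr -big_split; apply: eq_bigr => S _ /=.
  by rewrite !ffunE /= scalerDl scalerA.
- move=> v i j ij vij; rewrite /G (Falt _ _ _ ij vij) (wedgev_alternating ij vij).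
  by rewrite big1 ?subr0 // => S _; rewrite ffunE scale0r.
- move=> S; rewrite /G (bigD1 S) //= wedgev_bvec eqxx scale1r big1 ?addr0 ?subrr //.
  by move=> T TS; rewrite wedgev_bvec (negPf TS) scale0r.
Qed.

End ExtUniv.

(** * Products of decomposable multivectors *)

Section Sorted.
Variables (n k : nat).

Lemma ksub_nth_lt (S : ksub n k) (i j : 'I_k) :
  (ksub_nth S i < ksub_nth S j)%N = (i < j)%N.
Proof.
have mono (a b : 'I_k) : (a < b)%N -> (ksub_nth S a < ksub_nth S b)%N.
  move=> ab; have x0 := ksub_nth S a.
  pose s := [seq val x | x <- enum (val S)].
  have szS : size (enum (val S)) = k by rewrite -cardE (eqP (valP S)).
  have ss : sorted ltn s.
    rewrite /s -[enum _](@eq_filter _ (mem (val S))) // sorted_map.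
    apply: sorted_filter => [x y z /= xy|]; first exact: ltn_trans xy.
    by rewrite -enumT -sorted_map val_enum_ord iota_ltn_sorted.
  have nthE (c : 'I_k) : val (ksub_nth S c) = nth 0%N s c.
    rewrite /ksub_nth (enum_val_nth x0) /= /s (nth_map x0) //.
    by rewrite szS.
  rewrite !nthE; apply: (sorted_ltn_nth ltn_trans) => //; rewrite inE /s size_map szS; exact: ltn_ord.
apply/idP/idP => [|/mono //]; case: (ltngtP i j) => // [/mono ji ij|/val_inj->].
  by have := ltn_trans ji ij; rewrite ltnn.
by rewrite ltnn.
Qed.

(** [g] is [ksub_nth S] precomposed with a strictly increasing map from
    [{0, ..., k - 1}] to itself, and the identity is the only such map. *)
Lemma ksub_nth_uniq (S : ksub n k) (g : 'I_k -> 'I_n) :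
  (forall i, g i \in val S) -> (forall i j : 'I_k, (i < j)%N -> (g i < g j)%N) ->
  forall i, ksub_nth S i = g i.
Proof.
move=> gS gm.
have /boolp.choice[h hP] : forall i, exists j, g i = ksub_nth S j.
  by move=> i; exact: ksub_nthP.
have hm (i j : 'I_k) : (i < j)%N -> (h i < h j)%N by move=> /gm; rewrite !hP ksub_nth_lt.
suff hid : forall i, h i = i by move=> i; rewrite hP hid.
have hle m (i : 'I_k) : (i < m)%N -> (i <= h i)%N.
  elim: m i => // m IH i; rewrite ltnS leq_eqVlt => /orP[/eqP|]; last exact: IH.
  case: m IH => [|m] IH im; first by rewrite im.
  have mk : (m < k)%N by rewrite (leq_trans _ (ltn_ord i)) // im.
  have := IH (Ordinal mk) (ltnSn m) => /= mh.
  by rewrite im (leq_ltn_trans mh) // hm /= ?im.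
have hge m (i : 'I_k) : (k <= i + m)%N -> (h i <= i)%N.
  elim: m i => [|m IH] i; first by rewrite addn0 leqNgt ltn_ord.
  move=> kim; case: (ltnP i.+1 k) => ik; last by rewrite -ltnS (leq_trans (ltn_ord (h i))).
  have := IH (Ordinal ik); rewrite /= addSnnS => /(_ kim) hi.
  by rewrite -ltnS (leq_trans _ hi) // hm.
move=> i; apply/val_inj/eqP; rewrite eqn_leq (hge (k - i)%N) ?(hle i.+1) //.
by rewrite subnKC // ltnW.
Qed.

End Sorted.

Section WedgeList.
Variables (K : fieldType) (V : vectType K).
Local Notation n := (\dim {:V}).

(** With lists, the number of factors can grow without casts between ordinal
    types; an entry missing from [s] counts as [0]. *)
Definition wl k (s : seq V) : Lambda k V := wedgev (fun i : 'I_k => s`_i).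

Lemma upd_nth k (s : seq V) (i : 'I_k) x :
  upd (fun j : 'I_k => s`_j) i x = (fun j => (set_nth 0 s i x)`_j).
Proof. by apply: boolp.funext => j; rewrite /upd nth_set_nth. Qed.

Lemma wl_linear k (s : seq V) (i : 'I_k) a x y :
  wl k (set_nth 0 s i (a *: x + y)) =
  a *: wl k (set_nth 0 s i x) + wl k (set_nth 0 s i y).
Proof. by rewrite /wl -!upd_nth wedgev_multilinear. Qed.

Lemma wl_alt k (s : seq V) i j :
  (i < k)%N -> (j < k)%N -> i != j -> s`_i = s`_j -> wl k s = 0.
Proof. by move=> ik jk ij; exact: (@wedgev_alternating _ _ _ _ (Ordinal ik) (Ordinal jk)). Qed.

Lemma wl1E (v : V) : wedgev (fun=> v) = wl 1 [:: v].
Proof. by congr wedgev; apply: boolp.funext => i; rewrite ord1. Qed.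

End WedgeList.

Section WedgeCons.
Variables (K : fieldType) (V : vectType K).
Local Notation n := (\dim {:V}).

Lemma wedge_coord k l (x : Lambda k V) (y : Lambda l V) (S : ksub n (k + l)) :
  wedge x y S = \sum_(p : ksub n k * ksub n l | val p.1 :|: val p.2 == val S)
                   (-1) ^+ ninv p.1 p.2 * x p.1 * y p.2.
Proof. by rewrite ffunE pair_big_dep. Qed.

(** On the coordinate of index [S = {s_0 < ... < s_k}] this is the expansion
    of a determinant along its first row: only the singletons [{s_j}]
    contribute to the wedge product, and [ninv] counts the [j] elements of [S]
    below [s_j], which gives the sign of the cofactor. *)
Lemma wedge_cons k (v : V) (s : seq V) :
  wedge (wl 1 [:: v]) (wl k s) = wl (1 + k) (v :: s).
Proof.
apply/ffunP=> S; rewrite wedge_coord.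
have cT (j : 'I_(1 + k)) : #|[set ksub_nth S j]| == 1%N by rewrite cards1.
have cU (j : 'I_(1 + k)) : #|val S :\ ksub_nth S j| == k.
  have := cardsD1 (ksub_nth S j) (val S).
  by rewrite ksub_nth_in (eqP (valP S)) => /eqP; rewrite eqn_add2l eq_sym.
pose h (j : 'I_(1 + k)) : ksub n 1 * ksub n k :=
  (exist (fun A : {set 'I_n} => #|A| == 1%N) _ (cT j),
   exist (fun A : {set 'I_n} => #|A| == k) _ (cU j)).
pose h' p := odflt (@ord0 k) [pick j | h j == p].
have hinj : injective h.
  by move=> i j [] /set1_inj/ksub_nth_inj.
have hK j : h' (h j) = j.
  rewrite /h'; case: pickP => [i /eqP/hinj //|/(_ j)]; by rewrite eqxx.
rewrite (reindex_onto h h'); last first.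
  move=> [T U] TU; have {}TU : val T :|: val U == val S := TU.
  have /cards1P[x xT] : #|val T| == 1%N := valP T.
  have xS : x \in val S by rewrite -(eqP TU) inE xT set11.
  have [j xj] := ksub_nthP xS.
  have xU : x \notin val U.
    have := cardsUI (val T) (val U); rewrite (eqP TU) (eqP (valP S)) (eqP (valP T)) (eqP (valP U)).
    rewrite add1n => /eqP; rewrite -[X in _ == X]addn0 eqn_add2l cards_eq0 => /eqP TU0.
    apply/negP => xU; have : x \in val T :&: val U by rewrite inE xU xT set11.
    by rewrite TU0 inE.
  have hj : h j = (T, U).
    congr pair; apply/val_inj; rewrite /= -xj; first by rewrite xT.
    by rewrite -(eqP TU) xT setU1K.
  by rewrite -hj hK.
rewrite wedgevE (expand_det_row _ ord0); apply: eq_big => [j|j _].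
  by rewrite hK eqxx andbT; apply/eqP; exact: setD1K (ksub_nth_in _ _).
rewrite -mulrA mulrCA; congr (_ * _).
  rewrite /wl wedgevE det_mx11 !mxE /=; congr (coord (vbasis {:V}) _ v).
  by have := ksub_nth_in (h j).1 ord0; rewrite inE => /eqP.
rewrite /cofactor /wl wedgevE; congr (_ * _).
  congr (_ ^+ _); rewrite /ninv -[RHS](card_ord j).
  pose f (i : 'I_j) := (ksub_nth S j, ksub_nth S (widen_ord (ltnW (ltn_ord j)) i)).
  have finj : injective f.
    by move=> i1 i2 [] /ksub_nth_inj/(congr1 val) /= ?; apply/val_inj.
  rewrite -(card_codom finj); apply: eq_card => -[p q]; rewrite !inE /=.
  apply/idP/codomP => [/and3P[/eqP-> /andP[qj /ksub_nthP[i qi]] lt]|[i [-> ->]]].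
    have ij : (i < j)%N by rewrite -(ksub_nth_lt S) -qi.
    by exists (Ordinal ij); rewrite /f qi; congr (_, ksub_nth S _); apply/val_inj.
  have lt : (ksub_nth S (widen_ord (ltnW (ltn_ord j)) i) < ksub_nth S j)%N.
    by rewrite ksub_nth_lt /=.
  rewrite eqxx lt ksub_nth_in !andbT /=; apply/eqP => eq; move: lt.
  by rewrite eq ltnn.
congr (\det _); apply/matrixP=> i l; rewrite !mxE /=; congr (coord (vbasis {:V}) _ _).
apply: (@ksub_nth_uniq _ _ (h j).2 (fun l => ksub_nth S (lift j l))) => [i'|i' j' lt].
  by rewrite /= !inE ksub_nth_in andbT (inj_eq (@ksub_nth_inj _ _ S)) eq_sym neq_lift.
by rewrite ksub_nth_lt /= ltnNge leq_bump2 -ltnNge.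
Qed.

(** [ninv] without the constraint on cardinals, so that it splits along
    disjoint unions. *)
Definition ninvs n' (A B : {set 'I_n'}) : nat :=
  #|[pred p : 'I_n' * 'I_n' | [&& p.1 \in A, p.2 \in B & (p.2 < p.1)%N]]|.

Lemma ninvsUl n' (A B C : {set 'I_n'}) :
  [disjoint A & B] -> ninvs (A :|: B) C = (ninvs A C + ninvs B C)%N.
Proof.
move=> AB; rewrite /ninvs -cardUI [X in _ = (_ + X)%N]eq_card0 ?addn0 => [|[p q]].
  by apply: eq_card => -[p q]; rewrite !inE /= -andb_orl.
rewrite !inE /=; apply/negP => /andP[/and3P[pA _ _] /and3P[pB _ _]].
by move: (disjointFr AB pA); rewrite pB.
Qed.

Lemma ninvsUr n' (A B C : {set 'I_n'}) :
  [disjoint B & C] -> ninvs A (B :|: C) = (ninvs A B + ninvs A C)%N.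
Proof.
move=> BC; rewrite /ninvs -cardUI [X in _ = (_ + X)%N]eq_card0 ?addn0 => [|[p q]].
  by apply: eq_card => -[p q]; rewrite !inE /= -andb_orr -andb_orl.
rewrite !inE /=; apply/negP => /andP[/and3P[_ pA _] /and3P[_ pB _]].
by move: (disjointFr BC pA); rewrite pB.
Qed.

Lemma sign_regroupl (p q r : nat) (a b c : K) :
  (-1) ^+ (p + q) * ((-1) ^+ r * a * b) * c = (-1) ^+ (r + p + q) * a * b * c.
Proof. by rewrite !exprD; ring. Qed.

Lemma sign_regroupr (p q r : nat) (a b c : K) :
  (-1) ^+ (p + q) * a * ((-1) ^+ r * b * c) = (-1) ^+ (p + q + r) * a * b * c.
Proof. by rewrite !exprD; ring. Qed.

Section Assoc.
Variables (m k l : nat) (x : Lambda m V) (y : Lambda k V) (z : Lambda l V).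

Definition triple_term (I : ksub n m) (U : ksub n k) (W : ksub n l) : K :=
  (-1) ^+ (ninv I U + ninv I W + ninv U W) * x I * y U * z W.

Lemma cardU_disjoint n' (A B : {set 'I_n'}) :
  (#|A| + #|B| <= #|A :|: B|)%N -> [disjoint A & B].
Proof.
by rewrite -cardsUI -[X in (_ <= X)%N]addn0 leq_add2l leqn0 cards_eq0 setI_eq0.
Qed.

Lemma cardU3 (I : ksub n m) (U : ksub n k) (W : ksub n l) :
    #|val I :|: val U :|: val W| = (m + k + l)%N ->
  [/\ [disjoint val I & val U], [disjoint val I :|: val U & val W],
      [disjoint val I & val W] & [disjoint val U & val W]].
Proof.
move=> c; have cI := eqP (valP I); have cU := eqP (valP U); have cW := eqP (valP W).
have IUle := (leq_subr #|val I :&: val U| (#|val I| + #|val U|)); rewrite -cardsU in IUle.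
have le := (leq_subr #|(val I :|: val U) :&: val W| (#|val I :|: val U| + #|val W|)).
rewrite -cardsU c cW leq_add2r in le.
have d1 : [disjoint val I & val U] by apply: cardU_disjoint; rewrite cI cU.
have d2 : [disjoint val I :|: val U & val W].
  by apply: cardU_disjoint; rewrite c cW leq_add2r (leq_trans IUle) // cI cU.
split=> //; apply: disjointWl d2; [exact: subsetUl|exact: subsetUr].
Qed.

(** Inversions are additive along disjoint unions, so for either bracketing
    the sign is given by the inversions between the three pairs of index
    sets: this is [triple_term]. *)
Lemma wedge_wedgel (S : ksub n (m + k + l)) :
  wedge (wedge x y) z S =
  \sum_I \sum_U \sum_(W | val I :|: val U :|: val W == val S) triple_term I U W.
Proof.
pose G I U W (T : ksub n (m + k)) : K :=
  if (val T :|: val W == val S) && (val I :|: val U == val T)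
  then (-1) ^+ ninv T W * ((-1) ^+ ninv I U * x I * y U) * z W else 0.
transitivity (\sum_I \sum_U \sum_W \sum_T G I U W T); last first.
  apply: eq_bigr => I _; apply: eq_bigr => U _; rewrite [RHS]big_mkcond /=.
  apply: eq_bigr => W _; case: ifPn => [/eqP IUW|IUW]; last first.
    rewrite big1 // => T _; rewrite /G; case: ifP => // /andP[/eqP TW /eqP IU].
    by rewrite IU TW eqxx in IUW.
  have [] := @cardU3 I U W; first by rewrite IUW (eqP (valP S)).
  move=> d1 d2 d3 d4.
  have cT : #|val I :|: val U| == (m + k)%N.
    by rewrite cardsU (eqP (valP I)) (eqP (valP U)) (disjoint_setI0 d1) cards0 subn0.
  rewrite (bigD1 (exist (fun A : {set 'I_n} => #|A| == (m + k)%N) _ cT)) //=.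
  rewrite big1 ?addr0 => [|T TT]; last first.
    rewrite /G; case: ifP => // /andP[_ IU]; case/eqP: TT; apply/val_inj.
    by rewrite /= (eqP IU).
  rewrite /G /= IUW !eqxx /triple_term.
  rewrite -[ninv _ W]/(ninvs (val I :|: val U) (val W)) ninvsUl //.
  exact: sign_regroupl.
transitivity (\sum_T \sum_W \sum_I \sum_U G I U W T).
  rewrite ffunE; apply: eq_bigr => T _; rewrite big_mkcond /=; apply: eq_bigr => W _.
  case: ifPn => TW; last first.
    by rewrite big1 // => I _; rewrite big1 // => U _; rewrite /G (negPf TW).
  rewrite ffunE mulr_sumr mulr_suml; apply: eq_bigr => I _.
  rewrite mulr_sumr mulr_suml big_mkcond; apply: eq_bigr => U _.
  by rewrite /G TW.
rewrite exchange_big; under eq_bigr do rewrite exchange_big.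
rewrite exchange_big; under eq_bigr do under eq_bigr do rewrite exchange_big.
by under eq_bigr do rewrite exchange_big.
Qed.

Lemma wedge_wedger (S : ksub n (m + (k + l))) :
  wedge x (wedge y z) S =
  \sum_I \sum_U \sum_(W | val I :|: val U :|: val W == val S) triple_term I U W.
Proof.
pose G I U W (T : ksub n (k + l)) : K :=
  if (val I :|: val T == val S) && (val U :|: val W == val T)
  then (-1) ^+ ninv I T * x I * ((-1) ^+ ninv U W * y U * z W) else 0.
transitivity (\sum_I \sum_U \sum_W \sum_T G I U W T); last first.
  apply: eq_bigr => I _; apply: eq_bigr => U _; rewrite [RHS]big_mkcond /=.
  apply: eq_bigr => W _; case: ifPn => [/eqP IUW|IUW]; last first.
    rewrite big1 // => T _; rewrite /G; case: ifP => // /andP[/eqP TW /eqP IU].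
    by rewrite -setUA IU TW eqxx in IUW.
  have [] := @cardU3 I U W; first by rewrite IUW; exact: etrans (eqP (valP S)) (addnA _ _ _).
  move=> d1 d2 d3 d4.
  have cT : #|val U :|: val W| == (k + l)%N.
    by rewrite cardsU (eqP (valP U)) (eqP (valP W)) (disjoint_setI0 d4) cards0 subn0.
  rewrite (bigD1 (exist (fun A : {set 'I_n} => #|A| == (k + l)%N) _ cT)) //=.
  rewrite big1 ?addr0 => [|T TT]; last first.
    rewrite /G; case: ifP => // /andP[_ IU]; case/eqP: TT; apply/val_inj.
    by rewrite /= (eqP IU).
  rewrite /G /= setUA IUW !eqxx /triple_term.
  rewrite -[ninv I (exist _ _ _)]/(ninvs (val I) (val U :|: val W)) ninvsUr //.
  exact: sign_regroupr.
transitivity (\sum_I \sum_T \sum_U \sum_W G I U W T).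
  rewrite ffunE; apply: eq_bigr => I _; rewrite big_mkcond /=; apply: eq_bigr => T _.
  case: ifPn => TW; last first.
    by rewrite big1 // => U _; rewrite big1 // => W _; rewrite /G (negPf TW).
  rewrite ffunE mulr_sumr; apply: eq_bigr => U _.
  rewrite mulr_sumr big_mkcond; apply: eq_bigr => W _.
  by rewrite /G TW.
apply: eq_bigr => I _; rewrite exchange_big; apply: eq_bigr => U _.
by rewrite exchange_big.
Qed.

End Assoc.

(** The two sides have types [Lambda (1 + k + l) V] and
    [Lambda (1 + (k + l)) V], which are convertible because the first degree
    is a numeral. *)
Lemma wedgeA1 k l (x : Lambda 1 V) (y : Lambda k V) (z : Lambda l V) :
  wedge (wedge x y) z = (wedge x (wedge y z) : Lambda (1 + k + l) V).
Proof. by apply/ffunP=> S; rewrite wedge_wedgel; exact/esym/wedge_wedger. Qed.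

Lemma wedge_wl3 (a b c : V) l (s : seq V) :
  wedge (wl 3 [:: a; b; c]) (wl l s) = wl (3 + l) [:: a, b, c & s].
Proof.
have -> : wl 3 [:: a; b; c] = wedge (wl 1 [:: a]) (wl 2 [:: b; c]) by rewrite wedge_cons.
rewrite wedgeA1.
have -> : wl 2 [:: b; c] = wedge (wl 1 [:: b]) (wl 1 [:: c]) by rewrite wedge_cons.
by rewrite wedgeA1 !wedge_cons.
Qed.

End WedgeCons.

(** * Linear maps on exterior powers *)

Section Lmap.
Variables (K : fieldType) (V : vectType K).
Local Notation n := (\dim {:V}).

Lemma multilinear_comp k (W U : lmodType K) (g : {linear V -> W}) (F : ('I_k -> W) -> U) :
  multilinear F -> multilinear (fun v => F (g \o v)).
Proof.
move=> Fml v i a x y.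
have E z : g \o upd v i z = upd (g \o v) i (g z).
  by apply: boolp.funext => j; rewrite /upd /=; case: eqP.
by rewrite !E linearP Fml.
Qed.

Lemma alternating_comp k (W U : lmodType K) (g : {linear V -> W}) (F : ('I_k -> W) -> U) :
  alternating F -> alternating (fun v => F (g \o v)).
Proof. by move=> Falt v i j ij vij; apply: (Falt _ i j ij); rewrite /= vij. Qed.

Lemma Lmap_wedgev k (g : 'End(V)) (v : 'I_k -> V) :
  Lmap g (wedgev v) = wedgev (g \o v).
Proof.
rewrite /Lmap; symmetry.
apply: (alternating_expand (multilinear_comp _ (@wedgev_multilinear _ _ _))
                           (alternating_comp _ (@wedgev_alternating _ _ _))).
Qed.

Fact Lmap_is_linear k (g : 'End(V)) : linear (@Lmap K k V g).
Proof.
move=> a x y; rewrite /Lmap scaler_sumr -big_split; apply: eq_bigr => S _ /=.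
by rewrite !ffunE /= scalerDl scalerA.
Qed.

HB.instance Definition _ k (g : 'End(V)) :=
  GRing.isLinear.Build K (Lambda k V) (Lambda k V) *:%R (@Lmap K k V g) (@Lmap_is_linear k g).

Lemma Lambda_ext k (U : lmodType K) (f g : {linear Lambda k V -> U}) :
  (forall v, f (wedgev v) = g (wedgev v)) -> forall x, f x = g x.
Proof.
move=> fg x; rewrite [x]Lambda_expand !linear_sum; apply: eq_bigr => S _.
by rewrite !linearZ /= -wedgev_basis fg.
Qed.

Definition lift_alt k (U : lmodType K) (F : ('I_k -> V) -> U) (x : Lambda k V) : U :=
  \sum_S x S *: F (fun j => bvec (ksub_nth S j)).

Fact lift_alt_is_linear k (U : lmodType K) (F : ('I_k -> V) -> U) : linear (lift_alt F).
Proof.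
move=> a x y; rewrite /lift_alt scaler_sumr -big_split; apply: eq_bigr => S _ /=.
by rewrite !ffunE /= scalerDl scalerA.
Qed.

HB.instance Definition _ k (U : lmodType K) (F : ('I_k -> V) -> U) :=
  GRing.isLinear.Build K (Lambda k V) U *:%R (lift_alt F) (lift_alt_is_linear F).

Lemma lift_altE k (U : lmodType K) (F : ('I_k -> V) -> U) :
  multilinear F -> alternating F -> forall v, lift_alt F (wedgev v) = F v.
Proof. by move=> Fml Falt v; rewrite [RHS](alternating_expand Fml Falt). Qed.

(** Stated as an induction principle, so that a linear statement about
    multivectors can be checked on the products of vectors of any basis, and
    not only of the one that defines the coordinates. *)
Lemma wedgev_span k m (b : m.-tuple V) (P : Lambda k V -> Prop) :
    basis_of {:V} b ->
    (forall S : ksub m k, P (wedgev (fun j => b`_(ksub_nth S j)))) ->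
    (forall a x y, P x -> P y -> P (a *: x + y)) -> P 0 ->
  forall x, P x.
Proof.
move=> bb Pb PD P0.
have Psum (I : finType) (c : I -> K) (x : I -> Lambda k V) :
    (forall i, P (x i)) -> P (\sum_i c i *: x i).
  by move=> Px; elim/big_rec: _ => // i y _ Py; exact: PD.
have Pw (v : 'I_k -> V) : P (wedgev v).
  pose bS := [seq (wedgev (fun j => b`_(ksub_nth T j)) : Lambda k V) | T : ksub m k].
  pose W : {vspace Lambda k V} := <<bS>>%VS.
  have PW x : x \in W -> P x.
    move=> xW; rewrite (coord_span (X := in_tuple bS) xW); apply: Psum => i.
    have /mapP[T _ ->] : (in_tuple bS)`_i \in bS by exact: mem_nth.
    exact: Pb.
  apply: PW.
  (* Modulo [W], the alternating map [wedgev] vanishes on increasing products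
     of vectors of [b], hence everywhere. *)
  pose g : {linear Lambda k V -> Lambda k V} := (\1 - projv W)%VF.
  have gE x : g x = x - projv W x by rewrite /g /= add_lfunE opp_lfunE id_lfunE.
  suff /eqP : g (wedgev v) = 0 by rewrite gE subr_eq0 => /eqP ->; exact: memv_proj.
  apply: (@alternating_span0 _ _ _ m (fun i => b`_i) _ (fun v => g (wedgev v))).
  - move=> x; exists (fun i => coord b i x).
    exact: coord_basis bb (memvf x).
  - by move=> w i a x y; rewrite wedgev_multilinear linearP.
  - by move=> w i j ij wij; rewrite (wedgev_alternating ij wij) linear0.
  - move=> T; rewrite gE projv_id ?subrr // memv_span //.
    by apply/mapP; exists T; rewrite ?mem_enum.
move=> x; rewrite [x]Lambda_expand; apply: Psum => T.
by rewrite -wedgev_basis.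
Qed.

End Lmap.

(** * The symplectic form in coordinates *)

(** Insertion sort, with the parity of the number of exchanges: identities
    between signs of explicit permutations are then settled by evaluation. *)
Fixpoint insert_sgn (a : nat) (s : seq nat) : bool * seq nat :=
  if s is b :: s' then
    if (a <= b)%N then (false, a :: s)
    else let: (e, t) := insert_sgn a s' in (~~ e, b :: t)
  else (false, [:: a]).

Fixpoint sort_sgn (s : seq nat) : bool * seq nat :=
  if s is a :: s' then
    let: (e, t) := sort_sgn s' in let: (e', t') := insert_sgn a t in (e (+) e', t')
  else (false, [::]).

Definition eps (s : seq nat) : int :=
  if uniq s then if (sort_sgn s).1 then -1 else 1 else 0.

Lemma size_insert_sgn a s : size (insert_sgn a s).2 = (size s).+1.
Proof.
by elim: s => //= b s; case: leqP => // _; case: (insert_sgn a s) => e t /= ->.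
Qed.

Lemma size_sort_sgn s : size (sort_sgn s).2 = size s.
Proof.
elim: s => //= a s; case: (sort_sgn s) => e t /= <-.
by have := size_insert_sgn a t; case: insert_sgn.
Qed.

Section SortSign.
Variables (K : fieldType) (V : vectType K) (k : nat).

Lemma wl_swap (p : seq V) a b s :
  (size p + 1 < k)%N -> wl k (p ++ a :: b :: s) = - wl k (p ++ b :: a :: s).
Proof.
move=> pk; have pk0 : (size p < k)%N by rewrite (leq_trans _ pk) // addn1.
pose i := Ordinal pk0; pose j := Ordinal pk.
have ij : i != j by rewrite -val_eqE /= addn1 neq_ltn ltnSn.
rewrite /wl -(alternating_tperm (@wedgev_multilinear _ _ _) (@wedgev_alternating _ _ _) _ ij).
congr wedgev; apply: boolp.funext => l /=; rewrite !nth_cat.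
have [->|lj] := eqVneq l j.
  by rewrite tpermR /= ltnn subnn ltnNge leq_addr addKn.
have [->|li] := eqVneq l i; first by rewrite tpermL /= ltnn subnn ltnNge leq_addr addKn.
rewrite tpermD 1?eq_sym //; case: ltnP => // pl.
move: li lj; rewrite -!val_eqE /=; rewrite -(subnKC pl) addKn.
by case: (l - size p)%N => [|[|m]] //; rewrite ?addn0 ?eqxx.
Qed.

Variable f : nat -> V.

Lemma wl_insert p a t : (size p + size t < k)%N ->
  wl k (map f (p ++ a :: t)) = (-1) ^+ (insert_sgn a t).1 *: wl k (map f (p ++ (insert_sgn a t).2)).
Proof.
elim: t p => [|b t IH] p /= pk; first by rewrite scale1r.
case: leqP => _; first by rewrite scale1r.
have := IH (rcons p b); rewrite size_rcons addSnnS => /(_ pk).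
case: insert_sgn => e t' /=; rewrite !cat_rcons signrN scaleNr => <-.
rewrite !map_cat /= wl_swap // size_map; apply: leq_trans pk.
by rewrite -addnS -addnS leq_add2l.
Qed.

Lemma wl_sort p s : (size p + size s <= k)%N ->
  wl k (map f (p ++ s)) = (-1) ^+ (sort_sgn s).1 *: wl k (map f (p ++ (sort_sgn s).2)).
Proof.
elim: s p => [|a s IH] p /= pk; first by rewrite scale1r.
have := IH (rcons p a); rewrite size_rcons addSnnS => /(_ pk).
have := size_sort_sgn s; case: (sort_sgn s) => e t /= st; rewrite !cat_rcons => ->.
rewrite wl_insert ?st -?addnS //; case: insert_sgn => e' t' /=.
by rewrite scalerA signr_addb.
Qed.

(** The premise on [sort_sgn] says that [s] is a permutation of [iota 0 k] if
    it has no repetition; as a boolean it can be evaluated on each of the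
    sequences used below. *)
Lemma wl_eps s : size s = k -> uniq s ==> ((sort_sgn s).2 == iota 0 k) ->
  wl k (map f s) = (eps s)%:~R *: wl k (map f (iota 0 k)).
Proof.
rewrite /eps => sk; case: (boolP (uniq s)) => /= [_ /eqP <-|].
  have /= -> := @wl_sort [::] s; last by rewrite add0n sk.
  by case: (sort_sgn s).1; rewrite ?expr1 ?expr0.
move=> /(uniqPn 0%N)[i [j [ij js sij]]] _; rewrite scale0r.
have jk : (j < k)%N by rewrite -sk.
have ik := ltn_trans ij jk.
apply: (@wl_alt _ _ _ _ i j) => //; first by rewrite neq_ltn ij.
by rewrite !(nth_map 0%N) ?sk // sij.
Qed.

End SortSign.

(** The increasing triples of indices, which number the coordinates on the
    third exterior power of a space of dimension 6; an explicit list can be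
    enumerated by evaluation, unlike a type of subsets. *)
Definition triples : seq (seq nat) :=
  [seq s <- [seq i :: s | i <- iota 0 6, s <- [seq [:: j; l] | j <- iota 0 6, l <- iota 0 6]]
  | sorted ltn s].

Definition co_triple (s : seq nat) : seq nat := [seq i <- iota 0 6 | i \notin s].

(** The symplectic form in coordinates, up to the volume of the frame; the
    exact relation is [triple_pairingE]. *)
Definition triple_pairing (K : fieldType) (t t' : seq nat -> K) : K :=
  \sum_(s <- triples) (eps (s ++ co_triple s))%:~R * t s * t' (co_triple s).

(** A sum that reduces under evaluation, which the locked big operators do
    not. *)
Definition sum_triples (F : seq nat -> int) : int := foldr (fun s z => F s + z) 0 triples.

Lemma sum_triplesE F : sum_triples F = \sum_(s <- triples) F s.
Proof. by rewrite /sum_triples; elim: triples => [|s l IH] /=; rewrite ?big_nil ?big_cons ?IH. Qed.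

(** The instances of [triple_pairingE] for two basis trivectors. *)
Lemma eps_pair_check : all (fun a => all (fun b =>
   sum_triples (fun s => eps (s ++ co_triple s) * eps (a ++ s) * eps (b ++ co_triple s))
     == eps (a ++ b)) triples) triples.
Proof. by vm_compute. Qed.

Lemma eps_ok_check : all (fun a => all (fun b =>
   uniq (a ++ b) ==> ((sort_sgn (a ++ b)).2 == iota 0 6)) triples) triples.
Proof. by vm_compute. Qed.

Lemma co_triple_check : all (fun a => co_triple a \in triples) triples.
Proof. by vm_compute. Qed.

Lemma mem_triples i j l : (i < j)%N -> (j < l)%N -> (l < 6)%N -> [:: i; j; l] \in triples.
Proof.
move=> ij jl l6; have j6 := ltn_trans jl l6; have i6 := ltn_trans ij j6.
rewrite mem_filter; apply/andP; split; first by rewrite /= ij jl.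
apply/allpairsPdep; exists i, [:: j; l].
split=> //; first by rewrite mem_iota.
by apply/allpairsPdep; exists j, l; rewrite !mem_iota.
Qed.

Definition ksub_seq n (S : ksub n 3) : seq nat :=
  [:: nat_of_ord (ksub_nth S ord0); nat_of_ord (ksub_nth S (lift ord0 ord0));
      nat_of_ord (ksub_nth S ord_max)].

Lemma ksub_seqE n (S : ksub n 3) (X : Type) (F : nat -> X) x0 (i : 'I_3) :
  F (ksub_nth S i) = nth x0 (map F (ksub_seq S)) i.
Proof.
by case: i => -[|[|[|]]] // lt; congr (F (ksub_nth S _)); exact/val_inj.
Qed.

Lemma ksub_seq_triples n (S : ksub n 3) : n = 6%N -> ksub_seq S \in triples.
Proof. by move=> n6; apply: mem_triples; rewrite ?ksub_nth_lt // -n6 ltn_ord. Qed.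

Section Symp.
Variables (K : fieldType) (V : vectType K) (vol : 'Hom(Lambda 6 V, K^o)).

Lemma symp_suml (I : Type) (r : seq I) (c : I -> K) (x : I -> Lambda 3 V) y :
  symp vol (\sum_(i <- r) c i *: x i) y = \sum_(i <- r) c i * symp vol (x i) y.
Proof.
have wedge0 : wedge (0 : Lambda 3 V) y = 0.
  apply/ffunP=> S; rewrite !ffunE big1 // => T _; rewrite big1 // => U _.
  by rewrite !ffunE mulr0 mul0r.
have symp0 : symp vol 0 y = 0 by rewrite /symp wedge0 linear0.
elim/big_rec2: _ => [|i z1 z2 _ <-]; first by [].
by rewrite /symp wedgePl linearP.
Qed.

Lemma symp_sumr (I : Type) (r : seq I) (c : I -> K) (x : I -> Lambda 3 V) y :
  symp vol y (\sum_(i <- r) c i *: x i) = \sum_(i <- r) c i * symp vol y (x i).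
Proof.
by rewrite /symp !linear_sum; apply: eq_bigr => i _; rewrite !linearZ.
Qed.

Lemma symp_wl3 (x y z : V) (s : seq V) :
  symp vol (wl 3 [:: x; y; z]) (wl 3 s) = vol (wl 6 [:: x, y, z & s]).
Proof. by rewrite /symp wedge_wl3. Qed.

Variable f : 6.-tuple V.
Hypothesis fb : basis_of {:V} f.
Local Notation fN := (nth 0 f).

Lemma Lambda3_triples (x : Lambda 3 V) :
  exists c : seq nat -> K, x = \sum_(a <- triples) c a *: wl 3 (map fN a).
Proof.
apply: (wedgev_span (P := fun x => exists c : seq nat -> K,
    x = \sum_(a <- triples) c a *: wl 3 (map fN a)) fb) => {x} [S|a x y [c ->] [d ->]|].
- set a := ksub_seq S; have aT : a \in triples by exact: ksub_seq_triples.
  exists (fun b => (b == a)%:R).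
  rewrite (bigD1_seq a) //= eqxx scale1r big1 ?addr0 => [|b /negPf->]; last by rewrite scale0r.
  by congr wedgev; apply: boolp.funext => i; exact: ksub_seqE.
- exists (fun b => a * c b + d b); rewrite scaler_sumr -big_split.
  by apply: eq_bigr => b _ /=; rewrite scalerA -scalerDl.
- by exists (fun _ => 0); rewrite big1 // => a _; rewrite scale0r.
Qed.

(** The alternating 3-form on [V] that corresponds to the trivector [x] under
    the volume form. Conditions of contraction or of position with respect to
    a flag become the vanishing of some of its values. *)
Definition tau (x : Lambda 3 V) (s : seq V) : K := symp vol x (wl 3 s).

Lemma symp_triples a b : a \in triples -> b \in triples ->
  symp vol (wl 3 (map fN a)) (wl 3 (map fN b)) = (eps (a ++ b))%:~R * vol (wl 6 f).
Proof.
move=> aT bT.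
have sz s : s \in triples -> size s = 3%N.
  by move=> sT; apply/eqP; apply: (allP (_ : all (fun s => size s == 3%N) triples)) sT; vm_compute.
have -> : wl 6 f = wl 6 (map fN (iota 0 6)).
  congr (wl 6 _); rewrite -[X in iota 0 X](size_tuple f).
  by rewrite -/(mkseq fN _) mkseq_nth.
have := @wl_eps _ _ 6 fN (a ++ b); rewrite size_cat !sz // => /(_ erefl).
move/allP: eps_ok_check => /(_ _ aT)/allP/(_ _ bT) ok /(_ ok) E.
rewrite -[RHS]/((eps (a ++ b))%:~R *: vol (wl 6 (map fN (iota 0 6)))) -linearZ -E.
by case: a aT {ok E} (sz _ aT) => [|x [|y [|z []]]] // _ _; rewrite map_cat /= symp_wl3.
Qed.

(** Both sides are bilinear, and for two basis trivectors the equality is an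
    identity between signs of permutations. *)
Lemma triple_pairingE (x y : Lambda 3 V) :
  triple_pairing (fun s => tau x (map fN s)) (fun s => tau y (map fN s)) =
  vol (wl 6 f) * symp vol x y.
Proof.
have [c ->] := Lambda3_triples x; have [d ->] := Lambda3_triples y.
set D := vol (wl 6 f).
have tE (c' : seq nat -> K) s : s \in triples ->
  tau (\sum_(a <- triples) c' a *: wl 3 (map fN a)) (map fN s) =
  \sum_(a <- triples) c' a * ((eps (a ++ s))%:~R * D).
  move=> sT; rewrite /tau symp_suml; apply: eq_big_seq => a aT.
  by rewrite symp_triples.
rewrite symp_suml mulr_sumr /triple_pairing.
transitivity (\sum_(s <- triples) \sum_(a <- triples) \sum_(b <- triples)
   c a * d b * D ^+ 2 * (eps (s ++ co_triple s) * eps (a ++ s) * eps (b ++ co_triple s))%:~R).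
  apply: eq_big_seq => s sT; rewrite !tE //; last by move/allP: co_triple_check => /(_ _ sT).
  rewrite -mulrA mulr_suml mulr_sumr; apply: eq_bigr => a _.
  by rewrite !mulr_sumr; apply: eq_bigr => b _; rewrite !intrM; ring.
rewrite exchange_big; apply: eq_big_seq => a aT.
rewrite exchange_big symp_sumr !mulr_sumr; apply: eq_big_seq => b bT.
rewrite -mulr_sumr -rmorph_sum symp_triples //= -/D.
move/allP: eps_pair_check => /(_ _ aT)/allP/(_ _ bT)/eqP; rewrite sum_triplesE => ->.
by ring.
Qed.

End Symp.

(** * The Hilbert-Mumford criterion *)

Lemma poly_nonroot (K : numFieldType) (p : {poly K}) :
  p != 0 -> exists2 t, t != 0 & p.[t] != 0.
Proof.
move=> p0; have q0 : p * 'X != 0 by rewrite mulf_neq0 ?polyX_eq0.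
pose rs : seq K := [seq i%:R | i <- iota 0 (size (p * 'X))].
have urs : uniq rs.
  by rewrite map_inj_uniq ?iota_uniq //; apply: (mulrIn (oner_neq0 K)).
have : ~~ all (root (p * 'X)) rs.
  by apply/negP => /max_poly_roots-/(_ q0 urs); rewrite size_map size_iota ltnn.
case/allPn => t _; rewrite rootM rootX negb_or => /andP[pt t0].
by exists t.
Qed.

Lemma meval_homogZ (K : comNzRingType) n d (P : {mpoly K[n]}) (c : K) v :
  P \is d.-homog -> P.@[fun i => c * v i] = c ^+ d * P.@[v].
Proof.
move=> /dhomogP Pd; rewrite !mevalE mulr_sumr; apply: eq_big_seq => m /Pd /= md.
rewrite mulrCA; congr (_ * _); under eq_bigr do rewrite exprMn.
rewrite big_split /= -expr_sum; congr (_ ^+ _ * _).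
by rewrite -md mdegE.
Qed.

Lemma meval_horner (K : comNzRingType) n (P : {mpoly K[n]}) (H : 'I_n -> {poly K}) :
  exists Q : {poly K}, forall t, P.@[fun i => (H i).[t]] = Q.[t].
Proof.
exists (\sum_(m <- msupp P) P@_m *: \prod_i H i ^+ m i) => t.
rewrite mevalE horner_sum; apply: eq_bigr => m _; rewrite hornerZ horner_prod.
by congr (_ * _); apply: eq_bigr => i _; rewrite horner_exp.
Qed.

Section DiagEnd.
Variables (K : numFieldType) (V : vectType K).
Local Notation n := (\dim {:V}).

Lemma det_mxof_diag (b : n.-tuple V) (d : 'I_n -> K) (g : 'End(V)) :
  basis_of {:V} b -> (forall i : 'I_n, g b`_i = d i *: b`_i) ->
  \det (passmx.mxof (vbasis {:V}) (vbasis {:V}) g) = \prod_i d i.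
Proof.
move=> bb gb; set e := vbasis {:V}; have eb : basis_of {:V} e := vbasisP _.
pose C := @passmx.mxof_comp K V V V.
have -> : g = ((\1 \o g) \o \1)%VF by apply/lfunP => x; rewrite !comp_lfunE !id_lfunE.
rewrite (C e b e bb) (C b b e bb) !det_mulmx mulrA mulrAC -det_mulmx -(C e b e bb).
have -> : (\1 \o \1 = \1 :> 'End(V))%VF by apply/lfunP => x; rewrite comp_lfunE !id_lfunE.
rewrite passmx.mxof1 ?(basis_free eb) // det1 mul1r.
rewrite (_ : passmx.mxof b b g = diag_mx (\row_i d i)) ?det_diag.
  by apply: eq_bigr => i _; rewrite mxE.
apply/row_matrixP => i; rewrite rowE passmx.mul_mxof passmx.vecof_delta gb.
apply/rowP => j; rewrite !mxE linearZ /= coord_free ?(basis_free bb) //.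
by case: eqP => [->|_]; rewrite ?mulr1 ?mulr1n ?mulr0 ?mulr0n.
Qed.

End DiagEnd.

Section HilbertMumford.
Variables (K : numFieldType) (V : vectType K) (dimV : \dim {:V} = 6%N).
Variables (f : 6.-tuple V) (fb : basis_of {:V} f) (w : nat -> int).
Local Notation fN := (nth 0 f).

Definition wt (a : seq nat) : int := foldr (fun i z => w i + z) 0 a.

Lemma prod_expr_wt (t : K) a : t != 0 -> \prod_(i <- a) t ^ w i = t ^ wt a.
Proof.
by move=> t0; elim: a => [|i a IH]; rewrite ?big_nil ?big_cons ?IH /= ?expfzDr.
Qed.

Hypothesis w0 : wt (iota 0 6) = 0.

(** The weights have sum [0], so the diagonal map [f_i |-> t ^ w i *: f_i] has
    determinant [1]. *)
Lemma one_ps (t : K) : t != 0 -> exists2 g : 'End(V), is_SL g &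
  forall a, a \in triples -> Lmap g (wl 3 (map fN a)) = t ^ wt a *: wl 3 (map fN a).
Proof.
move=> t0.
pose b : (\dim {:V}).-tuple V := tcast (esym dimV) f.
have bf i : b`_i = f`_i by rewrite val_tcast.
have bb : basis_of {:V} b by rewrite /b; case: _ / (esym dimV).
pose g := passmx.hommx b b (diag_mx (\row_i t ^ w i)).
have gb (i : 'I_(\dim {:V})) : g b`_i = t ^ w i *: b`_i.
  rewrite passmx.hommxE // passmx.rVofE // -rowE row_diag_mx /passmx.vecof.
  rewrite (bigD1 i) //= big1 ?addr0 => [|j ji]; first by rewrite !mxE !eqxx mulr1.
  by rewrite !mxE (negPf ji) andbF mulr0 scale0r.
have gf i : (i < 6)%N -> g (fN i) = t ^ w i *: fN i.
  rewrite -{1}dimV => i6; rewrite -bf; exact: (gb (Ordinal i6)).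
exists g; rewrite /is_SL.
  rewrite (det_mxof_diag (d := fun i => t ^ w i) bb) //.
  rewrite -(big_mkord xpredT (fun i => t ^ w i)) dimV.
  by rewrite /index_iota subn0 prod_expr_wt // w0 expr0z.
move=> a aT; rewrite /wl Lmap_wedgev.
have sa : size a = 3%N.
  by apply/eqP; apply: (allP (_ : all (fun s => size s == 3%N) triples)) aT; vm_compute.
have a6 i : i \in a -> (i < 6)%N.
  by apply: (allP (allP (_ : all (fun s => all (fun i => i < 6)%N s) triples) _ aT)); vm_compute.
pose M : 'M[K]_3 := diag_mx (\row_i t ^ w (nth 0%N a i)).
transitivity (wedgev (fun i : 'I_3 => \sum_j M i j *: (map fN a)`_j)).
  congr wedgev; apply: boolp.funext => i /=; rewrite (bigD1 i) //= big1 ?addr0.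
    rewrite mxE eqxx mulr1n mxE !(nth_map 0%N) ?sa // gf // a6 // mem_nth // sa //.
  by move=> j ij; rewrite mxE eq_sym (negPf ij) mulr0n scale0r.
rewrite wedgev_mul det_diag; congr (_ *: _).
under eq_bigr do rewrite mxE.
rewrite -(big_mkord xpredT (fun i => t ^ w (nth 0%N a i))) /wt -[in LHS]sa.
by rewrite -(big_nth 0%N xpredT (fun i => t ^ w i)) prod_expr_wt.
Qed.

Variables (vol : 'Hom(Lambda 6 V, K^o)) (A : {vspace Lambda 3 V}).
Hypothesis lagA : lagrangian vol A.
Variables (b : 10.-tuple (Lambda 3 V)) (bA : basis_of A b).
Variables (mu : 'I_10 -> int) (c : 'I_10 -> seq nat -> K).
Hypothesis bE : forall j : 'I_10, b`_j = \sum_(a <- triples) c j a *: wl 3 (map fN a).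
Hypothesis cw : forall j a, a \in triples -> c j a != 0 -> mu j <= wt a.
Hypothesis mu_gt0 : 0 < \sum_j mu j.

(** Only weights at least [mu j] occur in [b_j], so the row of coordinates of
    its transform is [t ^ mu j] times a row of polynomials in [t]; the maximal
    minors therefore have the factor [t] to the power [\sum_j mu j]. *)
Lemma plucker_limit : exists H : ksub (\dim {: Lambda 3 V}) 10 -> {poly K},
  forall t (g : 'End(V)), t != 0 ->
    (forall a, a \in triples -> Lmap g (wl 3 (map fN a)) = t ^ wt a *: wl 3 (map fN a)) ->
    forall S, plucker [tuple of map (Lmap g) b] S = t ^ (\sum_j mu j) * (H S).[t].
Proof.
pose e := vbasis {: Lambda 3 V}.
pose M := \matrix_(j < 10, l < \dim {: Lambda 3 V})
  (\sum_(a <- triples) (c j a * coord e l (wl 3 (map fN a))) *: 'X^(absz (wt a - mu j))).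
exists (fun S => \det (colsub (ksub_nth S) M)) => t g t0 gt S.
rewrite /plucker wedgevE -horner_evalE -det_map_mx.
have -> : t ^ (\sum_j mu j) = \det (diag_mx (\row_(j < 10) t ^ mu j)).
  rewrite det_diag; under [RHS]eq_bigr do rewrite mxE.
  by elim/big_rec2: _ => [|j x y _ <-]; rewrite ?expr0z ?expfzDr.
rewrite -det_mulmx mul_diag_mx; congr (\det _); apply/matrixP => j l; rewrite !mxE.
rewrite tnth_map (tnth_nth 0) bE /=.
pose Lg : {linear Lambda 3 V -> Lambda 3 V} := @Lmap K 3 V g.
have -> : Lmap g (\sum_(a <- triples) c j a *: wl 3 (map fN a)) =
    \sum_(a <- triples) (c j a * t ^ wt a) *: wl 3 (map fN a).
  rewrite -[Lmap g]/(Lg : _ -> _) linear_sum; apply: eq_big_seq => a aT.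
  by rewrite linearZ /= gt // scalerA.
rewrite linear_sum /horner_eval horner_sum mulr_sumr.
apply: eq_big_seq => a aT; rewrite linearZ /= hornerZ hornerXn.
have [->|ca] := eqVneq (c j a) 0; first by rewrite /GRing.scale /= !mul0r mulr0.
have -> : t ^ wt a = t ^ mu j * t ^+ absz (wt a - mu j).
  rewrite -[_ ^+ _]/(t ^ (Posz (absz _))) gez0_abs ?subr_ge0 ?cw //.
  by rewrite -expfzDr // [mu j + _]addrC subrK.
by rewrite /GRing.scale /=; ring.
Qed.

(** On the transforms of [b] by the one-parameter group, an invariant form of
    degree [d > 0] is both constant and a polynomial in [t] divisible by [t]
    to the power [d * \sum_j mu j]. As this exponent is positive, the constant
    is [0]; another basis of [A] only changes the value by a scalar. *)
Lemma destabilized : ~ semistable vol A.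
Proof.
case=> d [P [d0 Ph Pinv [b0 b0A]]]; rewrite /Leval => Pb0.
have [H HP] := plucker_limit.
have [Q QP] := meval_horner P (fun i => H (enum_val i)).
have s_gt0 := mu_gt0; set s := \sum_j mu j in HP s_gt0.
have Pt t : t != 0 -> P.@[fun i => plucker b (enum_val i)] = t ^+ (absz s * d) * Q.[t].
  move=> t0; have [g gSL gt] := one_ps t0.
  have := Pinv A b g lagA bA gSL; rewrite /Leval => <-.
  have E : (fun i => plucker [tuple of map (Lmap g) b] (enum_val i)) =
      (fun i => t ^ s * (H (enum_val i)).[t]).
    by move=> p; apply: boolp.funext => i; exact: HP.
  transitivity (P.@[fun i => t ^ s * (H (enum_val i)).[t]]); first by rewrite E.
  rewrite (meval_homogZ _ _ Ph) QP exprM; congr (_ ^+ _ * _).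
  by rewrite -[_ ^+ _]/(t ^ (Posz (absz s))) gtz0_abs.
have m0 : (0 < absz s * d)%N by rewrite muln_gt0 d0 andbT absz_gt0 gt_eqF //.
have Pb : P.@[fun i => plucker b (enum_val i)] = 0.
  pose p := 'X^(absz s * d) * Q - (P.@[fun i => plucker b (enum_val i)])%:P.
  have [p0|/poly_nonroot[t t0]] := eqVneq p 0; last first.
    by rewrite hornerD hornerN hornerM hornerC hornerXn -Pt // subrr eqxx.
  have := congr1 (horner^~ 0) p0; rewrite hornerD hornerN hornerM !hornerC hornerXn expr0n.
  by rewrite (gtn_eqF m0) mul0r add0r => /eqP; rewrite oppr_eq0 => /eqP.
move/eqP: Pb0; apply.
pose M := \matrix_(i < 10, j < 10) coord b j b0`_i.
have -> : plucker b0 = \det M *: plucker b.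
  rewrite /plucker -wedgev_mul; congr wedgev; apply: boolp.funext => i.
  rewrite (tnth_nth 0) {1}(coord_basis bA (_ : b0`_i \in A)).
    by apply: eq_bigr => j _; rewrite mxE (tnth_nth 0).
  by apply: (basis_mem b0A); rewrite mem_nth // size_tuple.
have E : (fun i => (\det M *: plucker b) (enum_val i)) =
    (fun i => \det M * plucker b (enum_val i)).
  by move=> p; apply: boolp.funext => i; rewrite ffunE.
by rewrite E (meval_homogZ _ _ Ph) Pb mulr0.
Qed.

End HilbertMumford.

(** * Bases adapted to the weight filtration *)

(** The basis is built greedily: [X j] is too large to lie in the span of the
    [j] vectors already chosen. *)
Lemma adapted_basis (K : fieldType) (E : vectType K) m (A : {vspace E}) (X : nat -> {vspace E}) :
  \dim A = m -> (forall j, (j < m)%N -> (X j <= A)%VS /\ (j < \dim (X j))%N) ->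
  exists2 b : m.-tuple E, basis_of A b & forall j : 'I_m, b`_j \in X j.
Proof.
move=> dA XA.
have [l [sl fl lX]] : exists l : seq E, [/\ size l = m, free l & forall j, (j < m)%N -> l`_j \in X j].
  have : forall k, (k <= m)%N -> exists l : seq E,
      [/\ size l = k, free l & forall j, (j < k)%N -> l`_j \in X j].
    elim=> [_|k IH km]; first by exists [::]; rewrite nil_free.
    have [l [sl fl lX]] := IH (ltnW km).
    have /subvPn[x xX xl] : ~~ (X k <= <<l>>)%VS.
      apply/negP => /dimvS; rewrite leqNgt (leq_ltn_trans (dim_span l)) // sl.
      by have [] := XA k km.
    exists (rcons l x); rewrite size_rcons sl; split=> //.
      by rewrite (perm_free (_ : perm_eq _ (x :: l))) ?perm_rcons // free_cons xl.
    move=> j; rewrite ltnS leq_eqVlt nth_rcons sl => /orP[/eqP->|jk].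
      by rewrite ltnn eqxx.
    by rewrite jk lX.
  by apply.
have sl' : size l == m by apply/eqP.
exists (Tuple sl') => [|j]; last by rewrite /= lX.
rewrite basisEfree fl /= sl dA leqnn andbT; apply/span_subvP => x /(nthP 0)[j jl <-].
rewrite sl in jl; apply: (subvP (proj1 (XA j jl))); exact: lX.
Qed.

Lemma uniq_triples : uniq triples.
Proof. by vm_compute. Qed.

Lemma co_tripleK a : a \in triples -> co_triple (co_triple a) = a.
Proof.
move=> aT; apply/eqP; move: aT.
by apply: (allP (_ : all (fun a => co_triple (co_triple a) == a) triples)); vm_compute.
Qed.

Lemma mem_co_triple a : a \in triples -> co_triple a \in triples.
Proof. exact: (allP co_triple_check). Qed.

Lemma eps_co_triple_neq0 (K : numDomainType) a : a \in triples -> (eps (co_triple a ++ a))%:~R != 0 :> K.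
Proof.
move=> aT; rewrite intr_eq0.
by apply: (allP (_ : all (fun a => eps (co_triple a ++ a) != 0) triples)) aT; vm_compute.
Qed.

Lemma sum_co_triple (K : zmodType) (F : seq nat -> K) :
  \sum_(a <- triples) F a = \sum_(a <- triples) F (co_triple a).
Proof.
rewrite -(big_map co_triple xpredT F); apply: perm_big.
by vm_compute.
Qed.

(** [t x] stands for the values at basis vectors of the alternating form of
    [x]. The data are linearity, injectivity and the shape of the symplectic
    form, so that the same argument serves a trivector and its dual. *)
Section Destabilize.
Variables (K : numFieldType) (E : vectType K) (t : E -> seq nat -> K).
Hypothesis t_linear : forall a, linear (t^~ a : E -> K^o).
Hypothesis t_inj : forall x, (forall a, a \in triples -> t x a = 0) -> x = 0.
Variables (A : {vspace E}) (dA : \dim A = 10%N).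
Hypothesis isoA : {in A &, forall x y, triple_pairing (t x) (t y) = 0}.

Definition coord_row (Z : seq (seq nat)) (x : E) : 'rV[K]_(size Z) :=
  \row_i t x (nth [::] Z i).

Fact coord_row_is_linear Z : linear (coord_row Z).
Proof. by move=> a x y; apply/rowP => i; rewrite !mxE t_linear. Qed.

HB.instance Definition _ Z :=
  GRing.isLinear.Build K E 'rV[K]_(size Z) *:%R (coord_row Z) (coord_row_is_linear Z).

Definition vanish (Z : seq (seq nat)) : {vspace E} := (A :&: lker (linfun (coord_row Z)))%VS.

Lemma vanishP Z x : reflect (x \in A /\ forall a, a \in Z -> t x a = 0) (x \in vanish Z).
Proof.
rewrite memv_cap memv_ker lfunE /=; apply: (iffP andP) => -[xA].
  move=> /eqP/rowP h; split=> // a /(nthP [::])[i iZ <-].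
  by have := h (Ordinal iZ); rewrite !mxE.
by move=> h; split=> //; apply/eqP/rowP => i; rewrite !mxE h // mem_nth.
Qed.

(** Isotropy makes the conditions imposed on [A] by the vanishing of the
    coordinates in [Z] dependent: a vector of [A] whose coordinates vanish
    outside the complements of elements of [Z] pairs with [A] through the
    coordinates in [Z] only, which is one linear relation between them. *)
Lemma dim_vanish Z n (x : n.-tuple E) :
    uniq Z -> {subset Z <= triples} -> free x -> all (mem A) x ->
    (forall y b, y \in (x : seq E) -> b \in triples -> co_triple b \notin Z -> t y b = 0) ->
  (10 + n <= size Z + \dim (vanish Z))%N.
Proof.
move=> uZ ZT fx xA xZ; set z := size Z.
pose R : 'M[K]_(n, z) := \matrix_(i, j)
  ((eps (co_triple (nth [::] Z j) ++ nth [::] Z j))%:~R * t x`_i (co_triple (nth [::] Z j))).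
have Zin (j : 'I_z) : nth [::] Z j \in triples by apply/ZT/mem_nth.
have Rfree : row_free R.
  rewrite -kermx_eq0; apply/eqP/row_matrixP => k.
  rewrite row0; set u := row k _.
  have uR : u *m R = 0 by rewrite /u -row_mul mulmx_ker row0.
  have : \sum_i u 0 i *: x`_i = 0.
    apply: t_inj => b bT.
    have tsum : t (\sum_i u 0 i *: x`_i) b = \sum_i u 0 i * t x`_i b.
      pose tl : {linear E -> K^o} := HB.pack (t^~ b : E -> K^o)
        (GRing.isLinear.Build _ _ _ _ _ (t_linear b)).
      by rewrite -[t _ b]/(tl _) linear_sum; apply: eq_bigr => i _; rewrite linearZ.
    rewrite tsum; have [bZ|bZ] := boolP (co_triple b \in Z); last first.
      by rewrite big1 // => i _; rewrite (xZ _ _ _ bT bZ) ?mulr0 // mem_nth // size_tuple.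
    have jz : (index (co_triple b) Z < z)%N by rewrite index_mem.
    have RE i : R i (Ordinal jz) = (eps (b ++ co_triple b))%:~R * t x`_i b.
      by rewrite mxE /= nth_index // co_tripleK.
    have /rowP/(_ (Ordinal jz)) := uR; rewrite !mxE.
    under eq_bigr do rewrite RE mulrCA.
    rewrite -mulr_sumr => /eqP; rewrite mulf_eq0 => /orP[|/eqP //].
    have := eps_co_triple_neq0 K (mem_co_triple bT); rewrite co_tripleK // => /negPf-> //.
  move/freeP: fx => /[apply] u0; apply/rowP => i; by rewrite u0 mxE.
pose phi := linfun (coord_row Z); pose rel := linfun (mulmxr R^T : 'rV[K]_z -> 'rV[K]_n).
have sub : (phi @: A <= lker rel)%VS.
  apply/subvP => _ /memv_imgP[y yA ->]; rewrite memv_ker !lfunE /=.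
  apply/eqP/rowP => i; rewrite !mxE.
  have xiA : x`_i \in A by apply: (allP xA); rewrite mem_nth // size_tuple.
  transitivity (triple_pairing (t x`_i) (t y)); last exact: isoA.
  rewrite /triple_pairing [RHS]sum_co_triple (bigID (mem Z)) /=.
  rewrite [X in _ = _ + X]big1_seq ?addr0 => [|a /andP[aZ aT]]; last first.
    by rewrite (xZ x`_i) ?mulr0 ?mul0r ?mem_co_triple ?co_tripleK ?mem_nth ?size_tuple.
  rewrite -[RHS]big_filter (perm_big Z); last first.
    apply: uniq_perm; [exact: filter_uniq uniq_triples|exact: uZ|].
    by move=> a; rewrite mem_filter andb_idr //; exact: ZT.
  rewrite (big_nth [::]) big_mkord; apply: eq_bigr => j _; rewrite !mxE co_tripleK //.
  by rewrite mulrC.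
have relT : (rel @: fullv)%VS = fullv.
  apply/vspaceP => v; rewrite memvf; have [B RB] := row_freeP Rfree.
  have -> : v = rel (v *m B^T) by rewrite lfunE /= -mulmxA -trmx_mul RB trmx1 mulmx1.
  exact: memv_img (memvf _).
have drel := limg_ker_dim rel fullv; rewrite capfv relT !dimvf /dim /= !mul1n in drel.
have dphi := limg_ker_dim phi A; rewrite -/(vanish Z) dA in dphi.
have := dimvS sub; move: drel dphi.
move: (\dim (lker rel)) (\dim (phi @: A)) => k r; rewrite -/z.
lia.
Qed.

(** The coordinate of a trivector on [a] is, up to a nonzero factor, the value
    of its form on [co_triple a], which has the opposite weight when the weights have sum
    [0]. So a trivector has only weights at least [m] when its form vanishes
    on these triples. *)
Definition level (w : nat -> int) (m : int) : seq (seq nat) :=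
  [seq a <- triples | - m < wt w a].

(** A vector with only weights at least [m] satisfies the support condition of
    [dim_vanish] for [Z := level w m']. *)
Definition opposed w (m m' : int) : bool :=
  all (fun b => (- m < wt w b) || (co_triple b \in level w m')) triples.

(** A certificate that the part of [A] of weights at least [mu_j] has dimension
    more than [j], for each [j], given four independent vectors of [A] with
    weights at least [m1], the first of which has weights at least [m0]. In
    order: this part contains the first vector; it contains the four vectors;
    it is cut out by conditions that [dim_vanish] makes dependent, with 4, 1
    or 0 relations. *)
Definition admissible (w : nat -> int) (m0 m1 : int) (mu : seq int) : bool :=
  all (fun j => let m := nth 0 mu j in
    [|| (j == 0)%N && (m == m0), (j < 4)%N && (m == m1),
        opposed w m1 m && (size (level w m) + j + 1 <= 14)%N
      | opposed w m0 m && (size (level w m) + j + 1 <= 11)%N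
        || (size (level w m) + j + 1 <= 10)%N]) (iota 0 10).

Lemma destabilizing_basis w m0 m1 mu (x : 4.-tuple E) :
    free x -> all (mem A) x ->
    (forall a, a \in triples -> - m0 < wt w a -> t x`_0 a = 0) ->
    (forall y a, y \in (x : seq E) -> a \in triples -> - m1 < wt w a -> t y a = 0) ->
    admissible w m0 m1 mu ->
  exists2 b : 10.-tuple E, basis_of A b &
    forall (j : 'I_10) a, a \in triples -> - mu`_j < wt w a -> t b`_j a = 0.
Proof.
move=> fx xA x0 x1 adm.
have lT m : {subset level w m <= triples} by exact: mem_subseq (filter_subseq _ _).
have ul m : uniq (level w m) by exact: filter_uniq uniq_triples.
have mem0 : x`_0 \in (x : seq E) by rewrite mem_nth // size_tuple.
have opp (m m' : int) y b : opposed w m m' -> b \in triples -> co_triple b \notin level w m' ->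
    (forall a, a \in triples -> - m < wt w a -> t y a = 0) -> t y b = 0.
  by move=> /allP/(_ b) op bT /negPf bl; apply=> //; move: (op bT); rewrite bl orbF.
have [j jlt|b bA bX] := @adapted_basis K E 10%N A (fun j => vanish (level w mu`_j)) dA.
  split; first exact: capvSl.
  have /(allP adm)/or4P[] : j \in iota 0 10 by rewrite mem_iota.
  - move=> /andP[/eqP-> /eqP->]; rewrite lt0n dimv_eq0; apply/eqP => v0.
    have : x`_0 \in vanish (level w m0).
      apply/vanishP; split; first exact: (allP xA).
      by move=> a; rewrite mem_filter => /andP[? ?]; exact: x0.
    rewrite v0 memv0 => /eqP x00; move: fx.
    by move: mem0; rewrite x00 => m0x /free_not0-/(_ _ m0x); rewrite eqxx.
  - move=> /andP[j4 /eqP->]; apply: (leq_trans j4).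
    rewrite -[X in (X <= _)%N](size_tuple x) -(eqP fx); apply/dimvS/span_subvP => y yx.
    apply/vanishP; split; first exact: (allP xA).
    by move=> a; rewrite mem_filter => /andP[? ?]; exact: x1.
  - move=> /andP[op le]; rewrite -(ltn_add2l (size (level w mu`_j))) -addn1.
    apply: leq_trans le (dim_vanish (x := x) _ _ _ _ _) => // y b yx bT bl.
    by apply: opp op bT bl _ => a; exact: x1.
  - move=> /orP[/andP[op le]|le]; rewrite -(ltn_add2l (size (level w mu`_j))) -addn1; last first.
      apply: leq_trans le _; rewrite -[10%N]addn0.
      by apply: (dim_vanish (x := [tuple] : 0.-tuple E)) => //; exact: nil_free.
    apply: leq_trans le (dim_vanish (x := [tuple x`_0]) _ _ _ _ _) => //.
    + rewrite seq1_free; apply: contraTneq mem0 => ->.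
      by apply/negP => /(free_not0 fx); rewrite eqxx.
    + by rewrite /= andbT; exact: (allP xA).
    + by move=> y b; rewrite inE => /eqP-> bT bl; apply: opp op bT bl x0.
exists b => // j a aT aw; have /vanishP[_] := bX j; apply.
by rewrite mem_filter aw.
Qed.

End Destabilize.

(** * Kernel vectors of pencils of matrices *)

Section Jets.
Variables (K : numFieldType) (m n : nat) (M0 M1 : 'M[K]_(m, n)).
Hypothesis max_rank : forall t, (\rank (M0 + t *: M1)%R <= \rank M0)%N.

(** The pseudo-inverse solves [x_(i+1) *m M0 = - (x_i *m M1)] whenever this
    equation has a solution, linearly in [M1]. *)
Definition jet_step : 'M[K]_m := - (M1 *m pinvmx M0).
Definition jet (x0 : 'rV[K]_m) (i : nat) : 'rV[K]_m := iter i (mulmxr jet_step) x0.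

(** With [G] a right inverse of [Z0], the polynomial [\det (1 + t Z1 G)] has
    value [1] at [0]. *)
Lemma row_free_perturb r (Z0 Z1 : 'M[K]_(r, n)) :
  row_free Z0 -> exists2 t, t != 0 & row_free (Z0 + t *: Z1).
Proof.
case/row_freeP => G Z0G.
pose N := map_mx polyC 1%:M + 'X *: map_mx polyC (Z1 *m G).
have NE t : (\det N).[t] = \det (1%:M + t *: (Z1 *m G)).
  rewrite -horner_evalE -det_map_mx; congr (\det _); apply/matrixP => i j.
  by rewrite !mxE /= /horner_eval !hornerE.
have [|t t0 Nt] := @poly_nonroot K (\det N).
  apply: contraTneq isT => N0; have := NE 0; rewrite N0 horner0 scale0r addr0 det1.
  by move/esym/eqP; rewrite oner_eq0.
exists t => //; apply/row_freeP; rewrite NE -unitfE in Nt.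
exists (G *m invmx (1%:M + t *: (Z1 *m G))).
by rewrite mulmxA mulmxDl Z0G -scalemxAl mulmxV.
Qed.

Lemma pencil_telescope (x : nat -> 'rV[K]_m) k t :
    x 0%N *m M0 = 0 -> (forall i, (i < k)%N -> x i.+1 *m M0 = - (x i *m M1)) ->
  forall j, (j <= k)%N ->
    (\sum_(i < j.+1) t ^+ i *: x i) *m (M0 + t *: M1) = t ^+ j.+1 *: (x j *m M1).
Proof.
move=> x0 step; elim=> [_|j IHj jk].
  by rewrite big_ord1 expr0 scale1r mulmxDr x0 add0r -scalemxAr.
rewrite big_ord_recr mulmxDl IHj; last exact: ltnW.
rewrite -[X in _ + X]scalemxAl mulmxDr step // -scalemxAr.
by rewrite scalerDr scalerN scalerA -exprSr addNKr.
Qed.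

(** A kernel vector at a matrix of maximal rank extends to a kernel vector of
    the pencil to any order. At the first obstruction [y = x_k *m M1], which
    lies outside the row space of [M0], the telescoping sum shows that [y] is
    in the row space of [M0 + t *: M1] for all [t <> 0]; perturbing a basis of
    the row space of [M0] as well, the rank at some [t] exceeds [\rank M0]. *)
Lemma jet_sub x0 : x0 *m M0 = 0 -> forall k, (jet x0 k *m M1 <= M0)%MS.
Proof.
move=> x00; pose x := jet x0; elim/ltn_ind => k IH.
have step i : (i < k)%N -> x i.+1 *m M0 = - (x i *m M1).
  move=> /IH h; rewrite /x /jet iterS -/(jet x0 i) /= /jet_step mulmxN mulNmx.
  by rewrite mulmxA mulmxKpV.
set y := _ *m M1; apply: contraT => yM0.
have [C MC] : exists C, row_base M0 = C *m M0.
  by apply/submxP; rewrite eq_row_base.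
have fZ : row_free (col_mx (row_base M0) y).
  rewrite /row_free eqn_leq rank_leq_row andTb.
  suff : (\rank M0 < \rank (row_base M0 + y)%MS)%N by rewrite -addn1 addsmxE.
  have : (row_base M0 < row_base M0 + y)%MS.
    by rewrite ltmxE addsmxSl addsmx_sub submx_refl /= eq_row_base.
  by rewrite ltmxErank => /andP[_]; rewrite eq_row_base.
have [t t0 ft] := row_free_perturb (col_mx (C *m M1) (0 : 'M_(1, n))) fZ.
have : ((col_mx (row_base M0) y + t *: col_mx (C *m M1) (0 : 'M_(1, n)))%R <= (M0 + t *: M1)%R)%MS.
  rewrite scale_col_mx add_col_mx scaler0 addr0 -addsmxE addsmx_sub; apply/andP; split.
    by rewrite MC scalemxAr -mulmxDr submxMl.
  have tk : t ^+ k.+1 != 0 by rewrite expf_neq0.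
  have -> : y = (t ^- k.+1 *: (\sum_(i < k.+1) t ^+ i *: x i)) *m (M0 + t *: M1).
    rewrite -scalemxAl (@pencil_telescope x k t x00 step k (leqnn k)).
    by rewrite scalerA mulVf // scale1r.
  exact: submxMl.
move/mxrankS; move/eqP: ft => ->.
by rewrite addn1 leqNgt ltnS max_rank.
Qed.

Lemma jet_eq x0 : x0 *m M0 = 0 -> forall i, jet x0 i.+1 *m M0 = - (jet x0 i *m M1).
Proof.
move=> x00 i; rewrite /jet iterS -/(jet x0 i) /= /jet_step mulmxN mulNmx.
by rewrite mulmxA mulmxKpV // jet_sub.
Qed.

End Jets.

(** * Three by three matrices *)

Definition i0 : 'I_3 := @Ordinal 3 0 isT.
Definition i1 : 'I_3 := @Ordinal 3 1 isT.
Definition i2 : 'I_3 := @Ordinal 3 2 isT.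

Lemma ord3_ind (Q : 'I_3 -> Prop) : Q i0 -> Q i1 -> Q i2 -> forall i, Q i.
Proof.
move=> q0 q1 q2 [[|[|[|i]]] lt] //.
- by rewrite (_ : Ordinal lt = i0) //; exact/val_inj.
- by rewrite (_ : Ordinal lt = i1) //; exact/val_inj.
- by rewrite (_ : Ordinal lt = i2) //; exact/val_inj.
Qed.

Lemma sum3 (K : nmodType) (F : 'I_3 -> K) : \sum_i F i = F i0 + F i1 + F i2.
Proof.
by rewrite !big_ord_recl big_ord0 addr0 !addrA; congr (F _ + F _ + F _); exact/val_inj.
Qed.

Lemma complete_rows (K : fieldType) r s (A : 'M[K]_(r, r + s)) :
  row_free A -> exists2 B, B \in unitmx & usubmx B = A.
Proof.
move=> fA; have rA : \rank A = r := eqP fA.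
exists (block_mx (col_ebase A) 0 0 1%:M *m row_ebase A).
  rewrite unitmx_mul row_ebase_unit andbT unitmxE det_ublock det1 mulr1 -unitmxE.
  exact: col_ebase_unit.
rewrite -[RHS]mulmx_ebase rA /block_mx mul_col_mx col_mxKu; congr (_ *m _).
by rewrite pid_mx_row mul_mx_row mulmx1 mulmx0.
Qed.

Section ThreeByThree.
Variable K : numClosedFieldType.
Implicit Types (P Q B : 'M[K]_3) (u v w y : 'rV[K]_3).

Definition det3 u v w : K :=
  u 0 i0 * (v 0 i1 * w 0 i2 - v 0 i2 * w 0 i1)
  - u 0 i1 * (v 0 i0 * w 0 i2 - v 0 i2 * w 0 i0)
  + u 0 i2 * (v 0 i0 * w 0 i1 - v 0 i1 * w 0 i0).

Lemma det3_mul B u v w :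
  det3 (u *m B) (v *m B) (w *m B) = det3 (row i0 B) (row i1 B) (row i2 B) * det3 u v w.
Proof. by rewrite /det3 !mxE !sum3; ring. Qed.

Definition row3 (a b c : K) : 'rV[K]_3 :=
  \row_i (if i == i0 then a else if i == i1 then b else c).

Lemma row3E a b c :
  (row3 a b c 0 i0 = a) * (row3 a b c 0 i1 = b) * (row3 a b c 0 i2 = c).
Proof. by rewrite !mxE. Qed.

Lemma rank_le1 P (u v : 'I_3 -> K) : (forall i j, P i j = u i * v j) -> (\rank P <= 1)%N.
Proof.
move=> Puv; rewrite (_ : P = (\col_i u i) *m (\row_j v j)) ?mulmx_max_rank //.
by apply/matrixP => i j; rewrite !mxE big_ord1 !mxE Puv.
Qed.

Lemma quadratic0 (a b c : K) : (forall x, a + b * x + c * x ^+ 2 = 0) -> [/\ a = 0, b = 0 & c = 0].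
Proof.
move=> h; have a0 : a = 0 by have := h 0; rewrite expr0n mulr0 mulr0 !addr0.
have h1 := h 1; have h2 := h (-1).
have /eqP : 2 * b = 0.
  transitivity ((a + b * 1 + c * 1 ^+ 2) - (a + b * -1 + c * (-1) ^+ 2)); first by ring.
  by rewrite h1 h2 subr0.
rewrite mulf_eq0 pnatr_eq0 /= => /eqP b0; split=> //.
by move: h1; rewrite a0 b0 expr1n mul0r mulr1 !add0r.
Qed.

Definition dependent3 P Q : Prop := forall y, det3 y (y *m P) (y *m Q) = 0.

Definition small_comb P Q : Prop :=
  exists a b c : K, [|| a != 0, b != 0 | c != 0] /\ (\rank (a%:M + b *: P + c *: Q)%R <= 1)%N.

(** Premise and conclusion only involve the span of [1], [P], [Q], up to
    conjugation: this allows the normalizations used below. *)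
Lemma dependent3_shift P Q p q r :
  dependent3 P Q -> dependent3 (P - p%:M) (Q - q%:M - r *: P).
Proof.
move=> h y; rewrite -[RHS](h y) !mulmxBr !mul_mx_scalar -!scalemxAr.
by move: (y *m P) (y *m Q) => u v; rewrite /det3 !mxE; ring.
Qed.

Lemma small_shift P Q p q r :
  small_comb (P - p%:M) (Q - q%:M - r *: P) -> small_comb P Q.
Proof.
move=> [a [b [c [abc rk]]]]; exists (a - b * p - c * q), (b - c * r), c; split.
  have [c0|] := eqVneq c 0; last by rewrite !orbT.
  have [b0|] := eqVneq b 0; first by move: abc; rewrite b0 c0 !mul0r !subr0 eqxx orbF.
  by rewrite c0 !mul0r !subr0 => ->; rewrite orbT.
rewrite (_ : _ + _ = a%:M + b *: (P - p%:M) + c *: (Q - q%:M - r *: P)) //.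
by apply/matrixP => i j; rewrite !mxE; case: (i == j); rewrite ?mulr1n ?mulr0n; ring.
Qed.

Lemma dependent3_conj B P Q : B \in unitmx ->
  dependent3 P Q -> dependent3 (B *m P *m invmx B) (B *m Q *m invmx B).
Proof.
by move=> Bu h y; rewrite -{1}(mulmxK Bu y) !mulmxA det3_mul h mulr0.
Qed.

Lemma small_conj B P Q : B \in unitmx ->
  small_comb (B *m P *m invmx B) (B *m Q *m invmx B) -> small_comb P Q.
Proof.
move=> Bu [a [b [c [abc rk]]]]; exists a, b, c; split=> //.
have -> : a%:M + b *: P + c *: Q =
    invmx B *m (a%:M + b *: (B *m P *m invmx B) + c *: (B *m Q *m invmx B)) *m B.
  rewrite !mulmxDr !mulmxDl -!scalemxAr -!scalemxAl !mulmxA mulVmx // !mul1mx.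
  by rewrite !mulmxKV // mul_mx_scalar -scalemxAl mulVmx // scalemx1.
by apply: leq_trans rk; apply: leq_trans (mxrankM_maxl _ _) _; exact: mxrankM_maxr.
Qed.

Lemma cubic0 (a b c d : K) : (forall x, a + b * x + c * x ^+ 2 + d * x ^+ 3 = 0) ->
  [/\ a = 0, b = 0, c = 0 & d = 0].
Proof.
move=> h; have h0 := h 0; have h1 := h 1; have h2 := h (-1); have h3 := h 2.
have a0 : a = 0 by rewrite -h0; ring.
have /eqP : 2 * c = 0.
  transitivity ((a + b * 1 + c * 1 ^+ 2 + d * 1 ^+ 3) +
     (a + b * -1 + c * (-1) ^+ 2 + d * (-1) ^+ 3)); last by rewrite h1 h2 addr0.
  by rewrite a0; ring.
rewrite mulf_eq0 pnatr_eq0 /= => /eqP c0.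
have /eqP : 6 * d = 0.
  transitivity ((a + b * 2 + c * 2 ^+ 2 + d * 2 ^+ 3) -
     2 * (a + b * 1 + c * 1 ^+ 2 + d * 1 ^+ 3)); last by rewrite h1 h3 mulr0 subr0.
  by rewrite a0 c0; ring.
rewrite mulf_eq0 pnatr_eq0 /= => /eqP d0; split=> //.
by move: h1; rewrite a0 c0 d0 => <-; ring.
Qed.

Lemma row3_mul P u j : (u *m P) 0 j = u 0 i0 * P i0 j + u 0 i1 * P i1 j + u 0 i2 * P i2 j.
Proof. by rewrite mxE sum3. Qed.

Lemma small_P P Q : (\rank P <= 1)%N -> small_comb P Q.
Proof.
move=> rP; exists 0, 1, 0; rewrite oner_neq0 orbT; split=> //.
by rewrite scale1r scale0r addr0 (_ : 0%:M = 0) ?add0r //; apply/matrixP => i j; rewrite !mxE mul0rn.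
Qed.

Lemma small_Q P Q k : (\rank (Q - k *: P)%R <= 1)%N -> small_comb P Q.
Proof.
move=> rQ; exists 0, (- k), 1; rewrite oner_neq0 !orbT; split=> //.
rewrite scale1r (_ : 0%:M = 0) ?add0r ?scaleNr 1?addrC //.
by apply/matrixP => i j; rewrite !mxE mul0rn.
Qed.

Definition vec3 (a b c : K) (i : 'I_3) : K := if i == i0 then a else if i == i1 then b else c.

(** When a kernel vector of [P] is not an eigenvector of [Q], the pair is
    normalized by [e_0 P = 0] and [e_0 Q = e_1]. Comparing coefficients in the
    cubic form [det3 y (y P) (y Q)] then shows that [P] itself has rank at most
    [1]. *)
Lemma small_case1 P Q : dependent3 P Q -> (forall j, P i0 j = 0) ->
  Q i0 i0 = 0 -> Q i0 i1 = 1 -> Q i0 i2 = 0 -> small_comb P Q.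
Proof.
move=> h P0 Q00 Q01 Q02.
pose a := P i1 i0; pose b := P i1 i1; pose c := P i1 i2.
pose d := P i2 i0; pose g := P i2 i1; pose e := P i2 i2.
pose q10 := Q i1 i0; pose q11 := Q i1 i1; pose q12 := Q i1 i2.
pose q20 := Q i2 i0; pose q21 := Q i2 i1; pose q22 := Q i2 i2.
have hx s t : [/\ - s * ((s * a + t * d) * (s * q12 + t * q22) - (s * c + t * e) * (s * q10 + t * q20))
      + t * ((s * a + t * d) * (s * q11 + t * q21) - (s * b + t * g) * (s * q10 + t * q20)) = 0,
    (s * b + t * g) * (s * q12 + t * q22) - (s * c + t * e) * (s * q11 + t * q21)
      + t * (s * a + t * d) = 0
  & - (s * c + t * e) = 0].
  apply: quadratic0 => x; rewrite -[RHS](h (row3 x s t)) /det3 !row3_mul !row3E !P0 Q00 Q01 Q02.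
  by rewrite /a /b /c /d /g /e /q10 /q11 /q12 /q20 /q21 /q22; ring.
have c0 : c = 0 by have [_ _] := hx 1 0; rewrite !mul1r mul0r addr0 => /eqP; rewrite oppr_eq0 => /eqP.
have e0 : e = 0 by have [_ _] := hx 0 1; rewrite !mul1r mul0r add0r => /eqP; rewrite oppr_eq0 => /eqP.
have [h1 h2 h3] : [/\ b * q12 = 0, b * q22 + g * q12 + a = 0 & g * q22 + d = 0].
  apply: quadratic0 => t; have [_ E _] := hx 1 t; rewrite -[RHS]E c0 e0; ring.
have h4 : a * q12 = 0.
  have [E _ _] := hx 1 0; apply/eqP; rewrite -oppr_eq0; apply/eqP.
  by rewrite -[RHS]E c0 e0; ring.
apply: small_P.
have [b0|b0] := eqVneq b 0.
  have a0 : a = 0.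
    have [q0|q0] := eqVneq q12 0; last by move/eqP: h4; rewrite mulf_eq0 (negPf q0) orbF => /eqP.
    by move: h2; rewrite b0 q0 mul0r mulr0 !add0r.
  apply: (rank_le1 (u := vec3 0 0 1) (v := P i2)) => i j.
  move: i; apply: ord3_ind; rewrite /vec3 /= ?mul0r ?mul1r //.
  by move: j; apply: ord3_ind; rewrite -?/a -?/b -?/c ?a0 ?b0 ?c0.
have q0 : q12 = 0 by move/eqP: h1; rewrite mulf_eq0 (negPf b0) => /eqP.
have aE : a = - b * q22 by apply/eqP; rewrite mulNr -addr_eq0 addrC -h2 q0 mulr0 addr0.
have dE : d = - g * q22 by apply/eqP; rewrite mulNr -addr_eq0 addrC h3.
apply: (rank_le1 (u := vec3 0 b g) (v := vec3 (- q22) 1 0)) => i j.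
move: i j; apply: ord3_ind; apply: ord3_ind;
  rewrite /vec3 /= ?P0 ?mul0r ?mulr1 ?mulr0 -?/a -?/b -?/c -?/d -?/g -?/e //.
- by rewrite aE mulNr mulrN.
- by rewrite dE mulNr mulrN.
Qed.

(** Here [P] and [Q] kill [e_0], and [e_1 P] is a multiple of [e_0]. The
    coefficients of the cubic form show that [P], or [Q] minus a multiple of
    [P], has rank at most [1]. *)
Lemma small_case2 P Q : dependent3 P Q -> (forall j, P i0 j = 0) -> (forall j, Q i0 j = 0) ->
  P i1 i1 = 0 -> P i1 i2 = 0 -> small_comb P Q.
Proof.
move=> h P0 Q0 b0 c0.
pose a := P i1 i0; pose d := P i2 i0; pose g := P i2 i1; pose e := P i2 i2.
pose q10 := Q i1 i0; pose q11 := Q i1 i1; pose q12 := Q i1 i2.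
pose q20 := Q i2 i0; pose q21 := Q i2 i1; pose q22 := Q i2 i2.
have hx s t : [/\ - s * ((s * a + t * d) * (s * q12 + t * q22) - (t * e) * (s * q10 + t * q20))
      + t * ((s * a + t * d) * (s * q11 + t * q21) - (t * g) * (s * q10 + t * q20)) = 0,
    (t * g) * (s * q12 + t * q22) - (t * e) * (s * q11 + t * q21) = 0 & (0 : K) = 0].
  apply: quadratic0 => x; rewrite -[RHS](h (row3 x s t)) /det3 !row3_mul !row3E !P0 !Q0 b0 c0.
  by rewrite /a /d /g /e /q10 /q11 /q12 /q20 /q21 /q22; ring.
have [_ h1 h2] : [/\ 0 = 0 :> K, g * q12 - e * q11 = 0 & g * q22 - e * q21 = 0].
  have [//|_ E1 E2] := @quadratic0 (g * q22 - e * q21) (g * q12 - e * q11) 0.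
    by move=> s; have [_ E _] := hx s 1; rewrite -[RHS]E; ring.
  by split=> //; have [_ E _] := hx 0 1; rewrite -[RHS]E; ring.
have [/andP[/eqP g0 /eqP e0]|ge] := boolP ((g == 0) && (e == 0)).
  apply: small_P; apply: (rank_le1 (u := vec3 0 a d) (v := vec3 1 0 0)) => i j.
  by move: i j; apply: ord3_ind; apply: ord3_ind;
    rewrite /vec3 /= ?P0 ?mul0r ?mulr1 ?mulr0 -?/a -?/d -?/g -?/e ?g0 ?e0.
have [bt [dl [q11E q12E q21E q22E]]] : exists bt dl : K,
    [/\ q11 = bt * g, q12 = bt * e, q21 = dl * g & q22 = dl * e].
  have [g0|g0] := eqVneq g 0; last first.
    exists (q11 / g), (q21 / g); split; rewrite ?divfK //; apply: (mulfI g0).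
      by move/eqP: h1; rewrite subr_eq0 => /eqP->; field.
    by move/eqP: h2; rewrite subr_eq0 => /eqP->; field.
  have e0 : e != 0 by move: ge; rewrite g0 eqxx.
  exists (q12 / e), (q22 / e); rewrite ?divfK //; split=> //; apply: (mulfI e0).
    by move: h1; rewrite g0 mul0r sub0r mulr0 mulr0 => /eqP; rewrite oppr_eq0 => /eqP.
  by move: h2; rewrite g0 mul0r sub0r mulr0 mulr0 => /eqP; rewrite oppr_eq0 => /eqP.
pose AA := - (a * bt); pose BB := q10 - a * dl - d * bt; pose CC := q20 - d * dl.
have [z0 z1 z2 z3] : [/\ - g * CC = 0, e * CC - g * BB = 0, e * BB - g * AA = 0 & e * AA = 0].
  apply: cubic0 => s; have [E _ _] := hx s 1; rewrite -[RHS]E q11E q12E q21E q22E.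
  by rewrite /AA /BB /CC; ring.
have [A0 B0 C0] : [/\ AA = 0, BB = 0 & CC = 0].
  have [g0|g0] := eqVneq g 0.
    have e0 : e != 0 by move: ge; rewrite g0 eqxx.
    move: z1 z2; rewrite g0 !mul0r !subr0 => z1 z2.
    by split; apply: (mulfI e0); rewrite mulr0.
  have C0 : CC = 0 by apply/eqP; move/eqP: z0; rewrite mulf_eq0 oppr_eq0 (negPf g0).
  have B0 : BB = 0.
    apply/eqP; move/eqP: z1; rewrite C0 mulr0 sub0r oppr_eq0 mulf_eq0 (negPf g0) //.
  split=> //; apply/eqP; move/eqP: z2; rewrite B0 mulr0 sub0r oppr_eq0 mulf_eq0 (negPf g0) //.
have [a0|a0] := eqVneq a 0.
  apply: small_P; apply: (rank_le1 (u := vec3 0 0 1) (v := P i2)) => i j.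
  move: i; apply: ord3_ind; rewrite /vec3 /= ?mul0r ?mul1r //.
  by move: j; apply: ord3_ind; rewrite -?/a ?a0 ?b0 ?c0.
have bt0 : bt = 0.
  by apply/eqP; move/eqP: A0; rewrite oppr_eq0 mulf_eq0 (negPf a0).
apply: (@small_Q P Q dl); apply: (rank_le1 (u := vec3 0 0 0) (v := vec3 0 0 0)) => i j.
have q10E : q10 = dl * a.
  apply/eqP; rewrite -subr_eq0; apply/eqP; transitivity BB; last exact: B0.
  by rewrite /BB bt0; ring.
have q20E : q20 = dl * d.
  apply/eqP; rewrite -subr_eq0; apply/eqP; transitivity CC; last exact: C0.
  by rewrite /CC; ring.
rewrite !mxE; move: i j; apply: ord3_ind; apply: ord3_ind;
  rewrite /vec3 /= ?P0 ?Q0 ?b0 ?c0 ?mulr0 ?subr0 -?/a -?/d -?/g -?/e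
   -?/q10 -?/q11 -?/q12 -?/q20 -?/q21 -?/q22 ?q10E ?q11E ?q12E ?q20E ?q21E ?q22E ?bt0 ?mul0r ?subrr //.
Qed.

End ThreeByThree.

Section Small.
Variable K : numClosedFieldType.
Implicit Types (P Q B : 'M[K]_3) (u v w y : 'rV[K]_3).

Lemma row3P u v : u 0 i0 = v 0 i0 -> u 0 i1 = v 0 i1 -> u 0 i2 = v 0 i2 -> u = v.
Proof. by move=> *; apply/rowP; apply: ord3_ind. Qed.

Let d0 : 'rV[K]_3 := delta_mx 0 i0.
Let d1 : 'rV[K]_3 := delta_mx 0 i1.

Lemma complete_one u : u != 0 -> exists2 B, B \in unitmx & row i0 B = u.
Proof.
move=> un; have fu : row_free (u : 'M_(1, 1 + 2)) by rewrite /row_free rank_rV un.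
have [B Bu BE] := complete_rows fu; exists B => //.
by rewrite -BE; apply/rowP => j; rewrite !mxE; congr (B _ _); exact/val_inj.
Qed.

Lemma complete_two u v : (forall s t : K, s *: u + t *: v = 0 -> s = 0 /\ t = 0) ->
  exists2 B, B \in unitmx & row i0 B = u /\ row i1 B = v.
Proof.
move=> uv; pose A : 'M[K]_(2, 3) := \matrix_(i, j) (if i == 0 then u 0 j else v 0 j).
have fA : row_free A.
  apply/inj_row_free => x xA; have [|x0 x1] := uv (x 0 0) (x 0 1).
    apply/rowP => j; have /rowP/(_ j) := xA; rewrite !mxE big_ord_recl big_ord1 !mxE /= => <-.
    by congr (_ + x 0 _ * _); exact/val_inj.
  apply/rowP => -[[|[|i]] lt] //; rewrite [RHS]mxE.
    by rewrite -x0; congr (x _ _); exact/val_inj.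
  by rewrite -x1; congr (x _ _); exact/val_inj.
have [B Bu BA] := complete_rows (r := 2) (s := 1) fA; exists B => //.
have E (i : 'I_2) j : B (lshift 1 i) j = if i == 0 then u 0 j else v 0 j.
  by have := congr1 (fun M : 'M[K]_(2, 3) => M i j) BA; rewrite !mxE.
split; apply/rowP => j; rewrite mxE.
  by apply: etrans (E 0 j); congr (B _ _); exact/val_inj.
by apply: etrans (E 1 j); congr (B _ _); exact/val_inj.
Qed.

Lemma basis_d0 v : v 0 i0 = 0 -> v != 0 ->
  exists2 B, B \in unitmx & d0 *m B = d0 /\ d1 *m B = v.
Proof.
move=> v0 vn; have [|B Bu [B0 B1]] := @complete_two d0 v; last first.
  by exists B => //; rewrite -!rowE.
move=> s t /rowP E; have s0 : s = 0.
  by have := E i0; rewrite !mxE v0 mulr0 addr0 mulr1.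
split=> //; apply/eqP; apply: contraR vn => tn; apply/eqP/rowP => j; rewrite [RHS]mxE.
by apply: (mulfI tn); have := E j; rewrite s0 scale0r add0r !mxE mulr0.
Qed.

Lemma row_conj B P v w : B \in unitmx -> v *m B = w -> v *m (B *m P *m invmx B) = w *m P *m invmx B.
Proof. by move=> Bu <-; rewrite !mulmxA. Qed.

Lemma entry_row P i j : P i j = ((delta_mx 0 i : 'rV[K]_3) *m P) 0 j.
Proof. by rewrite -rowE mxE. Qed.

(** A multiple of the identity is subtracted from [Q] to remove the [e_0]
    component of [e_0 Q]. If [e_0 Q] is still nonzero, the first case applies.
    Otherwise [P] and [Q] act on the quotient by [e_0]: if [P] is singular
    there, the second case applies; if not, the cubic form shows that [Q] is a
    multiple of [P] on this quotient, so the difference has its image in the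
    line of [e_0]. *)
Lemma small_of_kernel P Q : dependent3 P Q -> d0 *m P = 0 -> small_comb P Q.
Proof.
move=> h P0; pose q := Q i0 i0.
apply: (small_shift (p := 0) (q := q) (r := 0)).
have := dependent3_shift 0 q 0 h; set P1 := P - _; set Q1 := Q - _ - _ => h1.
have P10 : d0 *m P1 = 0.
  by rewrite /P1 mulmxBr P0 mul_mx_scalar scale0r subr0.
have Q100 : (d0 *m Q1) 0 i0 = 0.
  by rewrite -entry_row !mxE eqxx mul0r subr0 mulr1n subrr.
move: P1 Q1 h1 P10 Q100 => {h P0 q}P {}Q h P0 Q00.
have P0j j : P i0 j = 0 by rewrite entry_row P0 mxE.
have [Q0|Q0] := eqVneq (d0 *m Q) 0; last first.
  have [B Bu [Bd0 Bd1]] := basis_d0 Q00 Q0.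
  apply: (small_conj Bu); have hB := dependent3_conj Bu h.
  have QB : d0 *m (B *m Q *m invmx B) = d1.
    by rewrite (row_conj _ Bu Bd0) -Bd1 mulmxK.
  apply: small_case1 => //.
  - by move=> j; rewrite entry_row (row_conj _ Bu Bd0) P0 mul0mx mxE.
  - by rewrite entry_row QB mxE.
  - by rewrite entry_row QB mxE.
  - by rewrite entry_row QB mxE.
have Q0j j : Q i0 j = 0 by rewrite entry_row Q0 mxE.
pose b := P i1 i1; pose c := P i1 i2; pose g := P i2 i1; pose e := P i2 i2.
pose q11 := Q i1 i1; pose q12 := Q i1 i2; pose q21 := Q i2 i1; pose q22 := Q i2 i2.
have [D0|Dn] := eqVneq (b * e - c * g) 0.
  have [st stn [st1 st2]] : exists2 st : K * K, st != (0, 0) &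
      st.1 * b + st.2 * g = 0 /\ st.1 * c + st.2 * e = 0.
    have [/eqP[-> ->]|ge] := boolP ((g, e) == (0, 0)).
      by exists (0, 1); rewrite ?xpair_eqE ?oner_eq0 ?andbF //= !mul0r !mulr0 addr0.
    have [g0|g0] := eqVneq g 0.
      have e0 : e != 0 by move: ge; rewrite g0 xpair_eqE eqxx.
      exists (e, - c) => /=; first by rewrite xpair_eqE negb_and e0.
      split; last by ring.
      by rewrite g0 mulr0 addr0 -[RHS]D0 g0; ring.
    exists (g, - b) => /=; first by rewrite xpair_eqE negb_and g0.
    split; first by ring.
    by apply/eqP; rewrite -oppr_eq0; apply/eqP; rewrite -[RHS]D0; ring.
  pose v := row3 0 st.1 st.2.
  have v0 : v 0 i0 = 0 by rewrite row3E.
  have vn : v != 0.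
    apply: contraNneq stn => /rowP v00; move: (v00 i1) (v00 i2).
    by rewrite !row3E !mxE [st]surjective_pairing /= => -> ->.
  have [B Bu [Bd0 Bd1]] := basis_d0 v0 vn.
  apply: (small_conj Bu); have hB := dependent3_conj Bu h.
  have vP : v *m P = (st.1 * P i1 i0 + st.2 * P i2 i0) *: d0.
    by apply: row3P; rewrite row3_mul !row3E mul0r add0r ?mxE ?eqxx ?mulr1 ?mulr0.
  have PB : d1 *m (B *m P *m invmx B) = (st.1 * P i1 i0 + st.2 * P i2 i0) *: d0.
    by rewrite (row_conj _ Bu Bd1) vP -scalemxAl -{1}Bd0 mulmxK.
  apply: small_case2 => //.
  - by move=> j; rewrite entry_row (row_conj _ Bu Bd0) P0 mul0mx mxE.
  - by move=> j; rewrite entry_row (row_conj _ Bu Bd0) Q0 mul0mx mxE.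
  - by rewrite entry_row PB !mxE mulr0.
  - by rewrite entry_row PB !mxE mulr0.
have hx s t : [/\ (row3 0 s t *m P) 0 i2 * 0 = 0,
    (s * b + t * g) * (s * q12 + t * q22) - (s * c + t * e) * (s * q11 + t * q21) = 0
   & (0 : K) = 0].
  split=> //; first by rewrite mulr0.
  have [] := @quadratic0 K (det3 (row3 0 s t) (row3 0 s t *m P) (row3 0 s t *m Q))
   ((s * b + t * g) * (s * q12 + t * q22) - (s * c + t * e) * (s * q11 + t * q21)) 0 => // x.
  rewrite -[RHS](h (row3 x s t)) /det3 !row3_mul !row3E !P0j !Q0j.
  by rewrite /b /c /g /e /q11 /q12 /q21 /q22; ring.
have [h1 h2 h3] : [/\ b * q12 - c * q11 = 0,
    b * q22 + g * q12 - c * q21 - e * q11 = 0 & g * q22 - e * q21 = 0].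
  by apply: quadratic0 => t; have [_ E _] := hx 1 t; rewrite -[RHS]E; ring.
pose k := (q11 * e - q12 * g) / (b * e - c * g).
have kE : k * (b * e - c * g) = q11 * e - q12 * g by rewrite /k divfK.
have z1 : q11 - k * b = 0.
  apply: (mulfI Dn); rewrite mulr0.
  transitivity (g * (b * q12 - c * q11)); last by rewrite h1 mulr0.
  transitivity ((b * e - c * g) * q11 - b * (k * (b * e - c * g))); first by ring.
  by rewrite kE; ring.
have z2 : q12 - k * c = 0.
  apply: (mulfI Dn); rewrite mulr0.
  transitivity (e * (b * q12 - c * q11)); last by rewrite h1 mulr0.
  transitivity ((b * e - c * g) * q12 - c * (k * (b * e - c * g))); first by ring.
  by rewrite kE; ring.
have z3 : q21 - k * g = 0.
  apply: (mulfI Dn); rewrite mulr0.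
  transitivity (g * (b * q22 + g * q12 - c * q21 - e * q11) - b * (g * q22 - e * q21)); last first.
    by rewrite h2 h3 !mulr0 subr0.
  transitivity ((b * e - c * g) * q21 - g * (k * (b * e - c * g))); first by ring.
  by rewrite kE; ring.
have z4 : q22 - k * e = 0.
  apply: (mulfI Dn); rewrite mulr0.
  transitivity (e * (b * q22 + g * q12 - c * q21 - e * q11) - c * (g * q22 - e * q21)); last first.
    by rewrite h2 h3 !mulr0 subr0.
  transitivity ((b * e - c * g) * q22 - e * (k * (b * e - c * g))); first by ring.
  by rewrite kE; ring.
apply: (small_Q (k := k)).
apply: (rank_le1 (u := vec3 0 (Q i1 i0 - k * P i1 i0) (Q i2 i0 - k * P i2 i0))
                 (v := vec3 1 0 0)) => i j.
rewrite !mxE; move: i j; apply: ord3_ind; apply: ord3_ind;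
  rewrite /vec3 /= ?P0j ?Q0j ?mulr0 ?mul0r ?mulr1 ?subr0 //;
  first [exact: z1|exact: z2|exact: z3|exact: z4].
Qed.

(** An eigenvector of [P], brought to [e_0], is killed by [P] minus the
    eigenvalue. *)
Theorem dependent3_small P Q : dependent3 P Q -> small_comb P Q.
Proof.
move=> h; have [p rp] : exists p, root (char_poly P) p.
  by apply/closed_rootP; rewrite size_char_poly.
have /eigenvalueP[e eP en] : eigenvalue P p by rewrite eigenvalue_root_char.
apply: (small_shift (p := p) (q := 0) (r := 0)).
have := dependent3_shift p 0 0 h; set P1 := P - _; set Q1 := Q - _ - _ => h1.
have eP1 : e *m P1 = 0 by rewrite /P1 mulmxBr eP mul_mx_scalar subrr.
have [B Bu Be] := complete_one en.
have Bd0 : d0 *m B = e by rewrite -rowE.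
apply: (small_conj (B := B) Bu); apply: small_of_kernel; first exact: dependent3_conj.
by rewrite (row_conj _ Bu Bd0) eP1 mul0mx.
Qed.

End Small.

Section Dichotomy.
Variable K : numClosedFieldType.
Implicit Types (P Q B : 'M[K]_3) (u v w y c : 'rV[K]_3).

(** The sign is chosen to match [x1_UU]. *)
Definition ncomb P Q c : 'M[K]_3 := - (c 0 i0)%:M + c 0 i1 *: P + c 0 i2 *: Q.

(** On the quotient by the line of [m], every vector is an eigenvector of [P],
    so [P] is scalar there. *)
Lemma scalar_mod P m : m != 0 -> (forall y, det3 y m (y *m P) = 0) ->
  exists q, forall y, (y *m (P - q%:M) <= m)%MS.
Proof.
move=> mn h; pose d0 : 'rV[K]_3 := delta_mx 0 i0.
have [B Bu Bm] := complete_one mn; have Bd0 : d0 *m B = m by rewrite -rowE.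
have [N NE] : exists N : 'M[K]_3, N = B *m P *m invmx B by exists (B *m P *m invmx B).
have det3d0 y w : det3 y d0 w = y 0 i2 * w 0 i1 - y 0 i1 * w 0 i2.
  by rewrite /det3 3![d0 0 _]mxE /=; ring.
have hN y : y 0 i1 * (y *m N) 0 i2 = y 0 i2 * (y *m N) 0 i1.
  apply/eqP; rewrite eq_sym -subr_eq0 -det3d0; apply/eqP.
  have -> : d0 = m *m invmx B by rewrite -Bd0 mulmxK.
  rewrite -{1}[y](mulmxK Bu) NE !mulmxA det3_mul.
  by rewrite h mulr0.
have entry i j : ((delta_mx 0 i : 'rV[K]_3) *m N) 0 j = N i j by rewrite -entry_row.
have rowE3 y j := @row3_mul _ N y j.
have n12 : N i1 i2 = 0.
  by have := hN (row3 0 1 0); rewrite !rowE3 !row3E !mul0r !mul1r !addr0 add0r.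
have n21 : N i2 i1 = 0.
  by have := hN (row3 0 0 1); rewrite !rowE3 !row3E !mul0r !mul1r !add0r => <-.
have n02 : N i0 i2 = 0.
  by have := hN (row3 1 1 0); rewrite !rowE3 !row3E n12 !mul0r !mul1r !addr0.
have n01 : N i0 i1 = 0.
  by have := hN (row3 1 0 1); rewrite !rowE3 !row3E n21 !mul0r !mul1r !addr0 => <-.
have n22 : N i2 i2 = N i1 i1.
  by have := hN (row3 0 1 1); rewrite !rowE3 !row3E n12 n21 !mul0r !mul1r !addr0 !add0r.
pose q := N i1 i1; exists q => y.
pose z := y *m invmx B.
have zE : z *m (N - q%:M) = (z *m (N - q%:M)) 0 i0 *: d0.
  apply: row3P; rewrite [RHS]mxE [d0 0 _]mxE /= ?mulr1 // mulr0 row3_mul !mxE.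
    by rewrite /= ?mulr0n ?mulr1n ?subr0 n01 n21 subrr !mulr0 !addr0.
  by rewrite /= ?mulr0n ?mulr1n ?subr0 n02 n12 n22 subrr !mulr0 !addr0.
have -> : y *m (P - q%:M) = z *m (N - q%:M) *m B.
  rewrite !mulmxBr !mulmxBl !mul_mx_scalar NE /z !mulmxA !mulmxKV //.
  by rewrite -scalemxAl mulmxKV.
by rewrite zE -scalemxAl Bd0 scalemx_sub.
Qed.

(** Let [N] be a nontrivial combination of [1], [P], [Q] of rank at most [1].
    If [N <> 0], let [m] span its image. For another combination [N'], the
    dependence of [y], [y P], [y Q] gives that of [y], [m], [y N'], first when
    [y N <> 0]. Then [N'] is scalar modulo [m], and subtracting the scalar
    gives a second combination with image in the line of [m]. *)
Theorem dependent3_dichotomy P Q : dependent3 P Q ->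
  (exists2 c, c != 0 & ncomb P Q c = 0) \/
  (exists c c' m : 'rV[K]_3, [/\ forall s t : K, s *: c + t *: c' = 0 -> s = 0 /\ t = 0, m != 0
     & forall y, (y *m ncomb P Q c <= m)%MS /\ (y *m ncomb P Q c' <= m)%MS]).
Proof.
move=> h; have [a [b [c [abc rk]]]] := dependent3_small h.
set N := (_ + _)%R in rk.
have NE : N = ncomb P Q (row3 (- a) b c).
  rewrite /N /ncomb !row3E; congr (_ + _ + _).
  by apply/matrixP => i j; rewrite !mxE mulNrn opprK.
have [N0|N0] := eqVneq N 0.
  left; exists (row3 (- a) b c); last by rewrite -NE.
  apply: contraTneq abc => /rowP z; move: (z i0) (z i1) (z i2); rewrite !row3E !mxE.
  by move=> /eqP; rewrite oppr_eq0 => /eqP -> -> ->; rewrite !eqxx.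
right; pose m := nz_row N; have mn : m != 0 by rewrite nz_row_eq0.
have Nm : (N <= m)%MS.
  rewrite -(geq_leqif (mxrank_leqif_sup (nz_row_sub N))).
  by rewrite rank_rV mn.
have [D ND] := submxP Nm.
have yN y : y *m N = (y *m D) 0 0 *: m.
  by rewrite {1}ND mulmxA {1}[y *m D]mx11_scalar mul_scalar_mx.
have bc : (b != 0) || (c != 0).
  apply: contraTT rk; rewrite negb_or !negbK => /andP[/eqP b0 /eqP c0].
  have a0 : a != 0 by move: abc; rewrite b0 c0 eqxx !orbF.
  by rewrite /N b0 c0 !scale0r !addr0 -scalemx1 mxrank_scale_nz // mxrank1.
have [b2 [c2 bc2]] : exists b2 c2 : K, b * c2 - b2 * c != 0.
  have [b0|b0] := eqVneq b 0; last by exists 0, 1; rewrite mulr1 mul0r subr0.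
  by exists 1, 0; rewrite mulr0 mul1r sub0r oppr_eq0; move: bc; rewrite b0 eqxx.
pose N' := b2 *: P + c2 *: Q.
have k1 y : (y *m D) 0 0 != 0 -> det3 y m (y *m N') = 0.
  move=> gy; apply: (mulfI gy); rewrite mulr0.
  transitivity (det3 y (y *m N) (y *m N')); first by rewrite yN /det3 !mxE; ring.
  transitivity ((b * c2 - b2 * c) * det3 y (y *m P) (y *m Q)); last by rewrite h mulr0.
  rewrite /N /N' !mulmxDr mul_mx_scalar -!scalemxAr.
  by move: (y *m P) (y *m Q) => u v; rewrite /det3 !mxE; ring.
have [y1 g1] : exists y1 : 'rV_3, (y1 *m D) 0 0 != 0.
  have [i Di] : exists i, D i 0 != 0.
    apply/existsP; apply: contraR N0; rewrite negb_exists => /forallP D0.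
    rewrite ND (_ : D = 0) ?mul0mx //; apply/matrixP => i j; rewrite (ord1 j) mxE.
    by apply/eqP; have := D0 i; rewrite negbK.
  by exists (delta_mx 0 i); rewrite -rowE mxE.
(* The form is quadratic in [y], so its value where [y N = 0] is determined by
   those at [y + y1], [y - y1] and [y1], where it vanishes. *)
have k2 y : det3 y m (y *m N') = 0.
  have [gy|] := eqVneq ((y *m D) 0 0) 0; last exact: k1.
  have gs s : s != 0 -> det3 (y + s *: y1) m ((y + s *: y1) *m N') = 0.
    by move=> s0; apply: k1; rewrite mulmxDl -scalemxAl mxE gy add0r mxE mulf_neq0.
  have E1 := gs 1 (oner_neq0 _); have E2 : det3 (y + (-1) *: y1) m ((y + (-1) *: y1) *m N') = 0.
    by apply: gs; rewrite oppr_eq0 oner_neq0.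
  have E3 := k1 _ g1.
  have /eqP : 2 * det3 y m (y *m N') = 0.
    transitivity (det3 (y + 1 *: y1) m ((y + 1 *: y1) *m N') +
      det3 (y + (-1) *: y1) m ((y + (-1) *: y1) *m N') - 2 * det3 y1 m (y1 *m N')).
      rewrite !mulmxDl -!scalemxAl.
      by move: (y *m N') (y1 *m N') => u v; rewrite /det3 !mxE; ring.
    by rewrite E1 E2 E3 mulr0 subr0 addr0.
  by rewrite mulf_eq0 pnatr_eq0 /= => /eqP.
have [q qP] := scalar_mod mn k2.
exists (row3 (- a) b c), (row3 q b2 c2), m; split=> // [s t /rowP E|y].
  have E1 := E i1; have E2 := E i2; rewrite !mxE in E1 E2.
  have s0 : s = 0.
    apply: (mulfI bc2); rewrite mulr0.
    transitivity (c2 * (s * b + t * b2) - b2 * (s * c + t * c2)); first by ring.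
    by rewrite E1 E2 !mulr0 subr0.
  split=> //; apply: (mulfI bc2); rewrite mulr0.
  transitivity (b * (s * c + t * c2) - c * (s * b + t * b2)); first by ring.
  by rewrite E1 E2 !mulr0 subr0.
split; first by rewrite -NE yN scalemx_sub.
have -> : ncomb P Q (row3 q b2 c2) = N' - q%:M by rewrite /ncomb !row3E -addrA addrC.
exact: qP.
Qed.

End Dichotomy.

(** * Jets of kernel vectors *)

Record alt3 (K : fieldType) (V : lmodType K) (g : seq V -> K) : Prop := Alt3 {
  alt3_lin : forall a u v p q,
    g [:: a *: u + v; p; q] = a * g [:: u; p; q] + g [:: v; p; q];
  alt3_12 : forall u v w, g [:: u; v; w] = - g [:: v; u; w];
  alt3_23 : forall u v w, g [:: u; v; w] = - g [:: u; w; v] }.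

Section Alt3.
Variables (K : numFieldType) (V : lmodType K) (g : seq V -> K) (ga : alt3 g).

Lemma alt3_lin2 a u v p q :
  g [:: p; a *: u + v; q] = a * g [:: p; u; q] + g [:: p; v; q].
Proof. by rewrite !(alt3_12 ga p) (alt3_lin ga) mulrN opprD. Qed.

Lemma alt3_lin3 a u v p q :
  g [:: p; q; a *: u + v] = a * g [:: p; q; u] + g [:: p; q; v].
Proof. by rewrite !(alt3_23 ga p q) alt3_lin2 mulrN opprD. Qed.

Lemma opp_eq0 (z : K) : z = - z -> z = 0.
Proof.
move=> zz; have /eqP : z *+ 2 = 0 by rewrite mulr2n {1}zz addNr.
by rewrite mulrn_eq0 => /eqP.
Qed.

Lemma alt3_eq12 u w : g [:: u; u; w] = 0.
Proof. exact/opp_eq0/(alt3_12 ga). Qed.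

Lemma alt3_eq23 u w : g [:: w; u; u] = 0.
Proof. exact/opp_eq0/(alt3_23 ga). Qed.

Lemma alt3_eq13 u w : g [:: u; w; u] = 0.
Proof. by rewrite (alt3_12 ga) alt3_eq23 oppr0. Qed.

Lemma alt3_0 p q : g [:: 0; p; q] = 0.
Proof. by have := alt3_lin ga (-1) 0 0 p q; rewrite scaler0 addr0 mulN1r addNr. Qed.

Lemma alt3_sum (I : finType) (c : I -> K) (x : I -> V) p q :
  g [:: \sum_i c i *: x i; p; q] = \sum_i c i * g [:: x i; p; q].
Proof.
elim/big_rec2: _ => [|i y1 y2 _ <-]; first exact: alt3_0.
by rewrite (alt3_lin ga).
Qed.

Lemma alt3_sum2 (I : finType) (c : I -> K) (x : I -> V) p q :
  g [:: p; \sum_i c i *: x i; q] = \sum_i c i * g [:: p; x i; q].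
Proof.
rewrite (alt3_12 ga) alt3_sum -sumrN; apply: eq_bigr => i _.
by rewrite -mulrN -(alt3_12 ga).
Qed.

Lemma alt3_sum3 (I : finType) (c : I -> K) (x : I -> V) p q :
  g [:: p; q; \sum_i c i *: x i] = \sum_i c i * g [:: p; q; x i].
Proof.
rewrite (alt3_23 ga) alt3_sum2 -sumrN; apply: eq_bigr => i _.
by rewrite -mulrN -(alt3_23 ga).
Qed.

Lemma alt3_rot p q r : g [:: p; q; r] = g [:: q; r; p].
Proof. by rewrite (alt3_12 ga) (alt3_23 ga) opprK. Qed.

End Alt3.

(** Suppose that [A] meets every fibre [{x | t x [:: v; _; _] = 0}]. At a
    generic [v] a vector of the intersection extends to formal families in [A]
    along all lines through [v]; the terms of these families are what isotropy
    is applied to. *)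
Section KernelJets.
Variables (K : numFieldType) (V E : vectType K) (t : E -> seq V -> K).
Hypothesis talt : forall x, alt3 (t x).
Hypothesis tlin : forall s, linear (t^~ s : E -> K^o).
Variable A : {vspace E}.
Hypothesis Akernel : forall v, v != 0 ->
  exists x, [/\ x \in A, x != 0 & forall p q, t x [:: v; p; q] = 0].
Hypothesis V_neq0 : exists v : V, v != 0.

Local Notation a := (\dim A).
Local Notation n := (\dim {:V}).
Local Notation e := (vbasis {:V}).

Definition elem (u : 'rV[K]_a) : E := \sum_r u 0 r *: (vbasis A)`_r.

Fact elem_is_linear : linear elem.
Proof.
move=> c u v; rewrite /elem scaler_sumr -big_split; apply: eq_bigr => r _ /=.
by rewrite !mxE scalerDl scalerA.
Qed.

HB.instance Definition _ := GRing.isLinear.Build K 'rV[K]_a E *:%R elem elem_is_linear.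

Lemma elem_in u : elem u \in A.
Proof. by apply: memv_suml => r _; rewrite memvZ // vbasis_mem // mem_nth // size_tuple. Qed.

Lemma elemP x : x \in A -> x = elem (\row_r coord (vbasis A) r x).
Proof.
by move=> xA; rewrite {1}(coord_vbasis xA); apply: eq_bigr => r _; rewrite mxE.
Qed.

Definition coords (x : E) : 'rV[K]_a := \row_r coord (vbasis A) r x.

Lemma elemK : cancel elem coords.
Proof.
move=> u; apply/rowP => r; rewrite mxE /elem coord_sum_free //.
exact: basis_free (vbasisP A).
Qed.

(** The left kernel of this matrix is the intersection of [A] with the fibre
    at [v], in the coordinates of a basis of [A]. *)
Definition contract_mx (v : V) : 'M[K]_(a, n * n) :=
  \matrix_r mxvec (\matrix_(i < n, j < n) t (vbasis A)`_r [:: v; e`_i; e`_j]).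

Lemma mul_contract u v i j :
  (u *m contract_mx v) 0 (mxvec_index i j) = t (elem u) [:: v; e`_i; e`_j].
Proof.
pose tl : {linear E -> K^o} := HB.pack (t^~ [:: v; e`_i; e`_j] : E -> K^o)
  (GRing.isLinear.Build _ _ _ _ _ (tlin [:: v; e`_i; e`_j])).
rewrite mxE -[t _ _]/(tl _) linear_sum; apply: eq_bigr => r _.
by rewrite linearZ /= mxE mxvecE mxE.
Qed.

Lemma contract_linear c v v' : contract_mx (c *: v + v') = c *: contract_mx v + contract_mx v'.
Proof.
apply/matrixP => r k; case/mxvec_indexP: k => i j.
by rewrite [RHS]mxE [X in _ = X + _]mxE /contract_mx !(mxE, mxvecE) (alt3_lin (talt _)).
Qed.

Lemma contract0P u v : u *m contract_mx v = 0 <-> forall p q, t (elem u) [:: v; p; q] = 0.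
Proof.
split=> [h p q|h].
  rewrite [p](coord_vbasis (memvf p)) [q](coord_vbasis (memvf q)).
  rewrite (alt3_sum2 (talt _)) big1 // => i _; rewrite (alt3_sum3 (talt _)) big1 ?mulr0 // => j _.
  by rewrite -mul_contract h mxE mulr0.
by apply/rowP => k; case/mxvec_indexP: k => i j; rewrite mul_contract h mxE.
Qed.

Lemma max_contract : exists2 v, v != 0 & forall v', (\rank (contract_mx v') <= \rank (contract_mx v))%N.
Proof.
have [v0 v00] := V_neq0.
pose Q r := `[< exists2 v, v != 0 & \rank (contract_mx v) = r >].
have exQ : exists r, Q r by exists (\rank (contract_mx v0)); apply/asboolP; exists v0.
have ubQ r : Q r -> (r <= a)%N by move=> /asboolP[v _ <-]; exact: rank_leq_row.
case: (ex_maxnP exQ ubQ) => r /asboolP[v vn vr] rmax; exists v => // v'.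
have [->|v'n] := eqVneq v' 0; last by rewrite vr; apply: rmax; apply/asboolP; exists v'.
have -> : contract_mx 0 = 0.
  by have := contract_linear (-1) 0 0; rewrite scaler0 addr0 scaleN1r addNr.
by rewrite mxrank0.
Qed.

(** The point [v] makes the rank of [contract_mx v] maximal, so that [jet_sub]
    applies in every direction [u]; [J u] produces each term of the family from
    the preceding one, and is linear in [u] because [jet_step] is linear in the
    second matrix. *)
Theorem kernel_jets : exists v x0 (J : V -> E -> E),
  [/\ v != 0, x0 \in A, x0 != 0 & forall p q, t x0 [:: v; p; q] = 0] /\
  [/\ forall c u u' x, J (c *: u + u') x = c *: J u x + J u' x,
      forall u i, iter i (J u) x0 \in A
    & forall u i p q, t (iter i.+1 (J u) x0) [:: v; p; q] = - t (iter i (J u) x0) [:: u; p; q]].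
Proof.
have [v vn vmax] := max_contract; have [x0 [x0A x0n x0v]] := Akernel vn.
pose J u x := elem (coords x *m jet_step (contract_mx v) (contract_mx u)).
exists v, x0, J; split=> //.
have u0 : coords x0 *m contract_mx v = 0 by apply/contract0P; rewrite -elemP.
have itJ u i : iter i (J u) x0 = elem (jet (contract_mx v) (contract_mx u) (coords x0) i).
  elim: i => [|i IH]; first exact: elemP.
  by rewrite iterS IH /J elemK /jet iterS.
split=> [c u u' x|u i|u i p q].
- rewrite /J -linearP; congr elem; rewrite /jet_step contract_linear.
  by rewrite mulmxDl opprD mulmxDr -scalemxAl -scalerN -scalemxAr.
- by rewrite itJ elem_in.
have mr c : (\rank (contract_mx v + c *: contract_mx u)%R <= \rank (contract_mx v))%N.
  by rewrite addrC -contract_linear.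
have JE := jet_eq mr u0 i; rewrite !itJ.
have h (k l : 'I_n) : t (elem (jet (contract_mx v) (contract_mx u) (coords x0) i.+1)) [:: v; e`_k; e`_l] =
   - t (elem (jet (contract_mx v) (contract_mx u) (coords x0) i)) [:: u; e`_k; e`_l].
  by rewrite -!mul_contract JE mxE.
rewrite [p](coord_vbasis (memvf p)) [q](coord_vbasis (memvf q)).
rewrite !(alt3_sum2 (talt _)) -sumrN; apply: eq_bigr => k _.
rewrite !(alt3_sum3 (talt _)) -mulrN -sumrN; congr (_ * _); apply: eq_bigr => l _.
by rewrite h mulrN.
Qed.

End KernelJets.

(** * Second- and third-order consequences of isotropy *)

Lemma triple_pairing_explicit (K : fieldType) (g h : seq nat -> K) : triple_pairing g h =
    g [:: 0; 1; 2]%N * h [:: 3; 4; 5]%N - g [:: 0; 1; 3]%N * h [:: 2; 4; 5]%N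
  + g [:: 0; 1; 4]%N * h [:: 2; 3; 5]%N - g [:: 0; 1; 5]%N * h [:: 2; 3; 4]%N
  + g [:: 0; 2; 3]%N * h [:: 1; 4; 5]%N - g [:: 0; 2; 4]%N * h [:: 1; 3; 5]%N
  + g [:: 0; 2; 5]%N * h [:: 1; 3; 4]%N + g [:: 0; 3; 4]%N * h [:: 1; 2; 5]%N
  - g [:: 0; 3; 5]%N * h [:: 1; 2; 4]%N + g [:: 0; 4; 5]%N * h [:: 1; 2; 3]%N
  - g [:: 1; 2; 3]%N * h [:: 0; 4; 5]%N + g [:: 1; 2; 4]%N * h [:: 0; 3; 5]%N
  - g [:: 1; 2; 5]%N * h [:: 0; 3; 4]%N - g [:: 1; 3; 4]%N * h [:: 0; 2; 5]%N
  + g [:: 1; 3; 5]%N * h [:: 0; 2; 4]%N - g [:: 1; 4; 5]%N * h [:: 0; 2; 3]%N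
  + g [:: 2; 3; 4]%N * h [:: 0; 1; 5]%N - g [:: 2; 3; 5]%N * h [:: 0; 1; 4]%N
  + g [:: 2; 4; 5]%N * h [:: 0; 1; 3]%N - g [:: 3; 4; 5]%N * h [:: 0; 1; 2]%N.
Proof.
pose F (z : int * (seq nat * seq nat)) : K := z.1%:~R * g z.2.1 * h z.2.2.
transitivity (\sum_(z <- [seq (eps (s ++ co_triple s), (s, co_triple s)) | s <- triples]) F z).
  by rewrite big_map.
set l := map _ _; set l' := (l in RHS).
have -> : l = [seq (z.1, (z.2, co_triple z.2)) | z <- zip
  [:: 1; -1; 1; -1; 1; -1; 1; 1; -1; 1; -1; 1; -1; -1; 1; -1; 1; -1; 1; -1]
  ([:: [:: 0; 1; 2]; [:: 0; 1; 3]; [:: 0; 1; 4]; [:: 0; 1; 5]; [:: 0; 2; 3];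
   [:: 0; 2; 4]; [:: 0; 2; 5]; [:: 0; 3; 4]; [:: 0; 3; 5]; [:: 0; 4; 5];
   [:: 1; 2; 3]; [:: 1; 2; 4]; [:: 1; 2; 5]; [:: 1; 3; 4]; [:: 1; 3; 5];
   [:: 1; 4; 5]; [:: 2; 3; 4]; [:: 2; 3; 5]; [:: 2; 4; 5]; [:: 3; 4; 5]]%N)].
  by rewrite /l; vm_compute.
rewrite /= !big_cons big_nil /F /= !mulrN1z !mulNr ?mulr1z !mul1r addr0 !addrA.
by [].
Qed.

Lemma triples_ind (Q : seq nat -> Prop) :
  Q [:: 0; 1; 2]%N -> Q [:: 0; 1; 3]%N -> Q [:: 0; 1; 4]%N -> Q [:: 0; 1; 5]%N ->
  Q [:: 0; 2; 3]%N -> Q [:: 0; 2; 4]%N -> Q [:: 0; 2; 5]%N -> Q [:: 0; 3; 4]%N ->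
  Q [:: 0; 3; 5]%N -> Q [:: 0; 4; 5]%N -> Q [:: 1; 2; 3]%N -> Q [:: 1; 2; 4]%N ->
  Q [:: 1; 2; 5]%N -> Q [:: 1; 3; 4]%N -> Q [:: 1; 3; 5]%N -> Q [:: 1; 4; 5]%N ->
  Q [:: 2; 3; 4]%N -> Q [:: 2; 3; 5]%N -> Q [:: 2; 4; 5]%N -> Q [:: 3; 4; 5]%N ->
  forall a, a \in triples -> Q a.
Proof.
move=> h0 h1 h2 h3 h4 h5 h6 h7 h8 h9 h10 h11 h12 h13 h14 h15 h16 h17 h18 h19 a.
rewrite (_ : triples = [:: [:: 0; 1; 2]; [:: 0; 1; 3]; [:: 0; 1; 4]; [:: 0; 1; 5]; [:: 0; 2; 3];
   [:: 0; 2; 4]; [:: 0; 2; 5]; [:: 0; 3; 4]; [:: 0; 3; 5]; [:: 0; 4; 5];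
   [:: 1; 2; 3]; [:: 1; 2; 4]; [:: 1; 2; 5]; [:: 1; 3; 4]; [:: 1; 3; 5];
   [:: 1; 4; 5]; [:: 2; 3; 4]; [:: 2; 3; 5]; [:: 2; 4; 5]; [:: 3; 4; 5]]%N); last by vm_compute.
by rewrite !inE; do ![case/predU1P => [-> //|]]; move/eqP => ->.
Qed.

Section Frame.
Variables (K : numClosedFieldType) (V : vectType K) (dimV : \dim {:V} = 6%N).
Variables (g : seq V -> K) (ga : alt3 g).

(** The last three vectors are [x3], [x4], [x5], rescaled. The linear map that
    records the values of [g] with one of them replaced by [z] identifies their
    span with [K^3], so its kernel is a complement of this span;
    it contains [v], and provides the first three vectors. *)
Lemma adapted_frame v x3 x4 x5 : v != 0 -> (forall p q, g [:: v; p; q] = 0) ->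
    g [:: x3; x4; x5] != 0 ->
  exists f : 6.-tuple V, [/\ basis_of {:V} f, f`_0 = v, g [:: f`_3; f`_4; f`_5] = 1 &
    forall i, (i < 3)%N -> [/\ g [:: f`_i; f`_4; f`_5] = 0, g [:: f`_3; f`_i; f`_5] = 0
       & g [:: f`_3; f`_4; f`_i] = 0]].
Proof.
move=> vn gv gx; set k := g _ in gx.
pose y3 := k^-1 *: x3.
have g1 : g [:: y3; x4; x5] = 1.
  by rewrite /y3 -[_ *: x3]addr0 (alt3_lin ga) (alt3_0 ga) addr0 -/k mulVf.
move: y3 g1 => {k gx} y3 g1.
pose L z := row3 (g [:: z; x4; x5]) (g [:: y3; z; x5]) (g [:: y3; x4; z]).
have Llin : linear L.
  move=> c u w; apply: row3P; rewrite !mxE /=.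
  - by rewrite (alt3_lin ga).
  - by rewrite (alt3_lin2 ga).
  - by rewrite (alt3_lin3 ga).
pose Ll : {linear V -> 'rV[K]_3} := HB.pack L (GRing.isLinear.Build _ _ _ _ _ Llin).
pose K3 : {vspace V} := lker (linfun Ll).
have K3P z : reflect [/\ g [:: z; x4; x5] = 0, g [:: y3; z; x5] = 0 & g [:: y3; x4; z] = 0] (z \in K3).
  rewrite memv_ker lfunE /=; apply: (iffP eqP) => [/rowP h|[h1 h2 h3]].
    by have := h i0; have := h i1; have := h i2; rewrite !mxE.
  by apply: row3P; rewrite !mxE.
have dec z : z - (g [:: z; x4; x5] *: y3 + g [:: y3; z; x5] *: x4 + g [:: y3; x4; z] *: x5) \in K3.
  set z1 := g [:: z; _; _]; set z2 := g [:: _; z; _]; set z3 := g [:: _; _; z].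
  have -> : z - (z1 *: y3 + z2 *: x4 + z3 *: x5) =
     - z1 *: y3 + (- z2 *: x4 + (- z3 *: x5 + z)).
    by rewrite !scaleNr !opprD addrC -!addrA.
  apply/K3P; split.
  - by rewrite !(alt3_lin ga) (alt3_eq12 ga) (alt3_eq13 ga) g1 !mulr0 !add0r mulr1 addNr.
  - by rewrite !(alt3_lin2 ga) (alt3_eq12 ga) (alt3_eq23 ga) g1 !mulr0 !add0r mulr1 addNr.
  - by rewrite !(alt3_lin3 ga) (alt3_eq13 ga) (alt3_eq23 ga) g1 !mulr0 !add0r mulr1 addNr.
have vK : v \in K3.
  by apply/K3P; rewrite gv (alt3_12 ga) gv (alt3_23 ga) (alt3_12 ga y3) gv !oppr0.
have dK : \dim K3 = 3.
  have /eqP : (\dim K3 + \dim (linfun Ll @: fullv) = 6)%N.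
    by rewrite -dimV -(limg_ker_dim (linfun Ll) fullv) capfv.
  have -> : (linfun Ll @: fullv)%VS = fullv.
    apply/vspaceP => r; rewrite memvf.
    have -> : r = linfun Ll (r 0 i0 *: y3 + (r 0 i1 *: x4 + (r 0 i2 *: x5 + 0))).
      rewrite lfunE /=; apply: row3P; rewrite !mxE /=.
      - by rewrite !(alt3_lin ga) g1 (alt3_eq12 ga) (alt3_eq13 ga) (alt3_0 ga) !mulr0 !addr0 mulr1.
      - rewrite !(alt3_lin2 ga) g1 (alt3_eq12 ga) (alt3_eq23 ga) (alt3_12 ga) (alt3_0 ga).
        by rewrite oppr0 !mulr0 !addr0 add0r mulr1.
      - rewrite !(alt3_lin3 ga) g1 (alt3_eq13 ga) (alt3_eq23 ga) (alt3_23 ga) (alt3_12 ga) (alt3_0 ga).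
        by rewrite !oppr0 !mulr0 !addr0 !add0r mulr1.
    exact: memv_img (memvf _).
  by rewrite dimvf /dim /= mul1n -[6%N]/(3 + 3)%N eqn_add2r => /eqP.
pose W := (K3 :\: <[v]>)%VS.
have dW : \dim W = 2.
  have := dimv_cap_compl K3 <[v]>; rewrite dK.
  have /capv_idPr -> : (<[v]> <= K3)%VS by [].
  by rewrite dim_vline vn add1n => -[].
pose f1 := (vbasis W)`_0; pose f2 := (vbasis W)`_1.
have f1W : f1 \in W by rewrite vbasis_mem // mem_nth // size_tuple dW.
have f2W : f2 \in W by rewrite vbasis_mem // mem_nth // size_tuple dW.
have WK : (W <= K3)%VS by exact: diffvSl.
exists [tuple v; f1; f2; y3; x4; x5]; split=> //=; last first.
  have K3i z : z \in K3 -> [/\ g [:: z; x4; x5] = 0, g [:: y3; z; x5] = 0 & g [:: y3; x4; z] = 0].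
    by move/K3P.
  by case=> [|[|[|i]]] //= _; apply: K3i => //; apply: (subvP WK).
set X := [:: v; f1; f2; y3; x4; x5].
have XX z : z \in X -> z \in <<X>>%VS by exact: memv_span.
have WX : (W <= <<X>>)%VS.
  rewrite -(span_basis (vbasisP W)); apply/span_subvP => z /(nthP 0)[j].
  have -> : size (vbasis W) = 2%N by rewrite size_tuple.
  by case: j => [|[|j]] // _ <-; apply: XX; rewrite !inE eqxx ?orbT.
have KX : (K3 <= <<X>>)%VS.
  rewrite -(addv_diff_cap K3 <[v]>) subv_add WX /=; apply: (subv_trans (capvSr _ _)).
  by rewrite -memvE XX // inE eqxx.
rewrite basisEdim dimV leqnn andbT; apply/subvP => z _.
rewrite -[z](subrK (g [:: z; x4; x5] *: y3 + g [:: y3; z; x5] *: x4 + g [:: y3; x4; z] *: x5)).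
apply: memvD; first exact: (subvP KX _ (dec z)).
by rewrite !memvD // memvZ // XX // !inE eqxx ?orbT.
Qed.

End Frame.

Lemma k345 k : (2 < k < 6)%N -> [\/ k = 3, k = 4 | k = 5]%N.
Proof.
by case: k => [|[|[|[|[|[|k]]]]]] // _; [constructor 1|constructor 2|constructor 3].
Qed.

(** [f] is a frame given by [adapted_frame] for [x0], at the point [f_0] chosen
    by [kernel_jets], and the [J u] are the operators found there. *)
Section LocalStructure.
Variables (K : numClosedFieldType) (V E : vectType K) (t : E -> seq V -> K).
Hypothesis talt : forall x, alt3 (t x).
Hypothesis tlin : forall s, linear (t^~ s : E -> K^o).
Variables (A : {vspace E}) (f : 6.-tuple V) (x0 : E) (J : V -> E -> E).
Local Notation F i := (f`_i%N).
Local Notation T x := (fun s => t x (map (nth 0 f) s)).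
Hypothesis isoA : {in A &, forall x y, triple_pairing (T x) (T y) = 0}.
Hypothesis x0v : forall p q, t x0 [:: F 0; p; q] = 0.
Hypothesis x0_345 : t x0 [:: F 3; F 4; F 5] = 1.
Hypothesis x0W : forall i, (i < 3)%N ->
  [/\ t x0 [:: F i; F 4; F 5] = 0, t x0 [:: F 3; F i; F 5] = 0 & t x0 [:: F 3; F 4; F i] = 0].
Hypothesis JD : forall c u u' x, J (c *: u + u') x = c *: J u x + J u' x.
Hypothesis JA : forall u i, iter i (J u) x0 \in A.
Hypothesis Jeq : forall u i p q,
  t (iter i.+1 (J u) x0) [:: F 0; p; q] = - t (iter i (J u) x0) [:: u; p; q].

Let z134 : t x0 [:: F 1; F 3; F 4] = 0.
Proof. by have [//|_ _ h] := @x0W 1; rewrite (alt3_rot (talt _)). Qed.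
Let z234 : t x0 [:: F 2; F 3; F 4] = 0.
Proof. by have [//|_ _ h] := @x0W 2; rewrite (alt3_rot (talt _)). Qed.
Let z135 : t x0 [:: F 1; F 3; F 5] = 0.
Proof. by have [//|_ h _] := @x0W 1; rewrite (alt3_12 (talt _)) h oppr0. Qed.
Let z235 : t x0 [:: F 2; F 3; F 5] = 0.
Proof. by have [//|_ h _] := @x0W 2; rewrite (alt3_12 (talt _)) h oppr0. Qed.
Let z145 : t x0 [:: F 1; F 4; F 5] = 0.
Proof. by have [] := @x0W 1. Qed.
Let z245 : t x0 [:: F 2; F 4; F 5] = 0.
Proof. by have [] := @x0W 2. Qed.

(** The pairing of [x0] with its first-order deformation in the direction of
    [f_k] is twice this coefficient, up to sign. As a result [x0] is
    decomposable, with kernel [<f_0, f_1, f_2>]. *)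
Lemma x0_12 k : (2 < k < 6)%N -> t x0 [:: F 1; F 2; F k] = 0.
Proof.
move=> k36; have := isoA (JA 0 0) (JA (F k) 1); rewrite triple_pairing_explicit /=.
rewrite !(Jeq (F k) 0) /= !x0v z134 z234 z135 z235 z145 z245 x0_345.
rewrite !mul0r !subr0 !addr0 !mul1r.
have h12 u w := @alt3_eq12 _ _ _ (talt x0) u w.
have h13 u w := @alt3_eq13 _ _ _ (talt x0) u w.
have rot := alt3_rot (talt x0).
have sw := alt3_12 (talt x0).
suff D : 2 * t x0 [:: F 1; F 2; F k] = 0 ->  t x0 [:: F 1; F 2; F k] = 0.
  have [kE|kE|kE] := k345 k36.
  - rewrite kE in D *; rewrite (rot (F 3) (F 1)) h12 h12 x0_345 => E0; apply: D.
    by rewrite -[RHS]E0; ring.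
  - rewrite kE in D *; rewrite (rot (F 4) (F 1)) (sw (F 4) (F 3) (F 5))
      (h12 (F 4)) (h13 (F 4) (F 3)) x0_345 => E0; apply: D.
    by rewrite -[RHS]E0; ring.
  - rewrite kE in D *; rewrite (rot (F 5) (F 1)) (rot (F 5) (F 3) (F 4))
      (h13 (F 5) (F 3)) (h13 (F 5) (F 4)) x0_345 => E0; apply: D.
    by rewrite -[RHS]E0; ring.
by move/eqP; rewrite mulf_eq0 pnatr_eq0 /= => /eqP.
Qed.

(** [wv] parametrizes [W = <f_0, f_1, f_2>], the kernel of the form of [x0],
    and [uv] the complement [U = <f_3, f_4, f_5>]. *)
Definition wv (c : 'rV[K]_3) : V := \sum_i c 0 i *: f`_i.
Definition uv (c : 'rV[K]_3) : V := \sum_i c 0 i *: f`_(3 + i).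
Definition x1 (y : 'rV[K]_3) : E := J (uv y) x0.

Let b123 := x0_12 (isT : (2 < 3 < 6)%N).
Let b124 := x0_12 (isT : (2 < 4 < 6)%N).
Let b125 := x0_12 (isT : (2 < 5 < 6)%N).

Lemma uv_linear c u v : uv (c *: u + v) = c *: uv u + uv v.
Proof.
rewrite /uv scaler_sumr -big_split; apply: eq_bigr => i _ /=.
by rewrite !mxE scalerDl scalerA.
Qed.

Lemma t_uv x y p q : t x [:: uv y; p; q] =
  y 0 i0 * t x [:: F 3; p; q] + y 0 i1 * t x [:: F 4; p; q] + y 0 i2 * t x [:: F 5; p; q].
Proof. by rewrite /uv (alt3_sum (talt _)) sum3. Qed.

Lemma x1_linear c u v : x1 (c *: u + v) = c *: x1 u + x1 v.
Proof. by rewrite /x1 uv_linear JD. Qed.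

Lemma x1A y : x1 y \in A.
Proof. exact: (JA (uv y) 1). Qed.

Lemma t_x1_0 y p q : t (x1 y) [:: F 0; p; q] = - t x0 [:: uv y; p; q].
Proof. exact: (Jeq (uv y) 0). Qed.

Section Direction.
Variable y : 'rV[K]_3.
Let X := x1 y.
Let a12 u w x : t x [:: u; u; w] = 0. Proof. exact: alt3_eq12 (talt x) _ _. Qed.
Let a13 u w x : t x [:: u; w; u] = 0. Proof. exact: alt3_eq13 (talt x) _ _. Qed.
Let a23 u w x : t x [:: w; u; u] = 0. Proof. exact: alt3_eq23 (talt x) _ _. Qed.

Lemma x1_012 : t X [:: F 0; F 1; F 2] = 0.
Proof.
rewrite t_x1_0 t_uv !(alt3_rot (talt x0) _ (F 1)) b123 b124 b125; ring.
Qed.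

Lemma x1_0jk j k : (0 < j < 3)%N -> (2 < k < 6)%N -> t X [:: F 0; F j; F k] = 0.
Proof.
move=> j3 k36; rewrite t_x1_0 t_uv.
have z u v : (u, v) \in [:: (3, 4); (3, 5); (4, 5)]%N -> t x0 [:: F j; F u; F v] = 0.
  by case: j j3 => [|[|[|j]]] // _; rewrite !inE => /or3P[] /eqP[-> ->].
have h i : (2 < i < 6)%N -> t x0 [:: F i; F j; F k] = 0.
  rewrite (alt3_12 (talt _)) => /k345[] ->; have [] := k345 k36 => ->;
    first [by rewrite a23 oppr0 | by rewrite z ?oppr0 | by rewrite (alt3_23 (talt _)) z ?oppr0].
by rewrite !h // !mulr0 !addr0 oppr0.
Qed.

Lemma x1_034 : t X [:: F 0; F 3; F 4] = - y 0 i2.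
Proof. by rewrite t_x1_0 t_uv a12 a13 (alt3_rot (talt _)) x0_345; ring. Qed.
Lemma x1_035 : t X [:: F 0; F 3; F 5] = y 0 i1.
Proof. by rewrite t_x1_0 t_uv a12 a13 (alt3_12 (talt _)) x0_345; ring. Qed.
Lemma x1_045 : t X [:: F 0; F 4; F 5] = - y 0 i0.
Proof. by rewrite t_x1_0 t_uv a12 a13 x0_345; ring. Qed.

End Direction.
Definition x1_0E y := (x1_012 y, x1_0jk y (isT : 0 < 1 < 3)%N (isT : 2 < 3 < 6)%N,
  x1_0jk y (isT : 0 < 1 < 3)%N (isT : 2 < 4 < 6)%N, x1_0jk y (isT : 0 < 1 < 3)%N (isT : 2 < 5 < 6)%N,
  x1_0jk y (isT : 0 < 2 < 3)%N (isT : 2 < 3 < 6)%N, x1_0jk y (isT : 0 < 2 < 3)%N (isT : 2 < 4 < 6)%N,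
  x1_0jk y (isT : 0 < 2 < 3)%N (isT : 2 < 5 < 6)%N, x1_034 y, x1_035 y, x1_045 y).

(** The value of the form of [x1 y] at [f_1], [f_2] and [uv y'], which is what
    keeps [x1 y] from being tangent at [x0] to the cone of decomposable
    trivectors. *)
Definition hess (y y' : 'rV[K]_3) : K :=
  y' 0 i0 * t (x1 y) [:: F 1; F 2; F 3] + y' 0 i1 * t (x1 y) [:: F 1; F 2; F 4]
  + y' 0 i2 * t (x1 y) [:: F 1; F 2; F 5].

(** Read off from the orthogonality of [x1 y] and [x1 y']. *)
Lemma hess_sym y y' : hess y y' = hess y' y.
Proof.
have := isoA (x1A y) (x1A y'); rewrite triple_pairing_explicit /= !x1_0E => E0.
apply/eqP; rewrite -subr_eq0; apply/eqP; rewrite -[RHS]E0 /hess; ring.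
Qed.

Lemma iso_x0 x : x \in A -> t x [:: F 0; F 1; F 2] = 0.
Proof.
move=> xA; have := isoA (JA 0 0) xA; rewrite triple_pairing_explicit /= !x0v.
rewrite z134 z234 z135 z235 z145 z245 x0_345 b123 b124 b125 => E0.
by apply/eqP; rewrite -oppr_eq0; apply/eqP; rewrite -[RHS]E0; ring.
Qed.

Let x2 y := J (uv y) (x1 y).
Let x2A y : x2 y \in A. Proof. exact: (JA (uv y) 2). Qed.
Let t_x2_0 y p q : t (x2 y) [:: F 0; p; q] = - t (x1 y) [:: uv y; p; q].
Proof. exact: (Jeq (uv y) 1). Qed.

(** Read off from the orthogonality of [x0] and the second-order term in the
    direction [uv y]. *)
Lemma hess_diag y : hess y y = 0.
Proof.
have := iso_x0 (x2A y); rewrite t_x2_0 => /eqP; rewrite oppr_eq0 => /eqP.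
by rewrite t_uv !(alt3_rot (talt _) _ (F 1)).
Qed.

Lemma hess0 y y' : hess y y' = 0.
Proof.
have add a b z : hess (a + b) z = hess a z + hess b z.
  have := x1_linear 1 a b; rewrite !scale1r /hess => ->.
  have td u v s : t (u + v) s = t u s + t v s by have := tlin s 1 u v; rewrite !scale1r.
  by rewrite !td; ring.
have addr a b z : hess z (a + b) = hess z a + hess z b by rewrite /hess !mxE; ring.
have := hess_diag (y + y'); rewrite add !addr !hess_diag add0r addr0 (hess_sym y' y).
by move/eqP; rewrite -mulr2n mulrn_eq0 => /eqP.
Qed.

Lemma x1_12 y k : (2 < k < 6)%N -> t (x1 y) [:: F 1; F 2; F k] = 0.
Proof.
move=> /k345[] ->.
- by have := hess0 y (row3 1 0 0); rewrite /hess !row3E mul1r !mul0r !addr0.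
- by have := hess0 y (row3 0 1 0); rewrite /hess !row3E mul1r !mul0r !addr0 add0r.
- by have := hess0 y (row3 0 0 1); rewrite /hess !row3E mul1r !mul0r !addr0 add0r.
Qed.

Definition x1_12E y := (x1_12 y (isT : 2 < 3 < 6)%N, x1_12 y (isT : 2 < 4 < 6)%N,
  x1_12 y (isT : 2 < 5 < 6)%N).

(** A trivector tangent at [x0] to the cone of decomposable trivectors is, up
    to a multiple of [x0], a linear map from [W] to [U]. The one of [x1 y]
    sends [f_0] to [- y], and [f_j] to [phi j y] for [j] equal to 1 or 2. *)
Definition phi j y : 'rV[K]_3 :=
  row3 (t (x1 y) [:: F j; F 4; F 5]) (- t (x1 y) [:: F j; F 3; F 5]) (t (x1 y) [:: F j; F 3; F 4]).

(** The pairing of the first-order with the second-order term and that of [x0]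
    with the third-order term both vanish. In terms of [x1 y] their sum is,
    up to sign, twice this determinant. *)
Lemma phi_dependent y : det3 y (phi 1 y) (phi 2 y) = 0.
Proof.
have c0 : t (x2 y) [:: uv y; F 1; F 2] = 0.
  have := iso_x0 (JA (uv y) 3); rewrite (Jeq (uv y) 2) => /eqP.
  by rewrite oppr_eq0 => /eqP.
have := isoA (x1A y) (x2A y); rewrite triple_pairing_explicit /= !x1_0E !x1_12E.
rewrite !(t_x2_0 y) !(t_uv (x1 y)).
rewrite !(alt3_rot (talt (x1 y)) _ (F 1) (F 2)) !x1_12E.
move: c0; rewrite t_uv !(alt3_rot (talt (x2 y)) _ (F 1)) => c0.
have n j : [/\ t (x1 y) [:: F 3; F j; F 3] = 0, t (x1 y) [:: F 4; F j; F 4] = 0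
    & t (x1 y) [:: F 5; F j; F 5] = 0].
  by split; exact: alt3_eq13 (talt _) _ _.
have n1 j : [/\ t (x1 y) [:: F 3; F j; F 4] = - t (x1 y) [:: F j; F 3; F 4],
    t (x1 y) [:: F 3; F j; F 5] = - t (x1 y) [:: F j; F 3; F 5]
    & t (x1 y) [:: F 4; F j; F 5] = - t (x1 y) [:: F j; F 4; F 5]].
  by split; exact: alt3_12 (talt _) _ _ _.
have n2 j : [/\ t (x1 y) [:: F 4; F j; F 3] = t (x1 y) [:: F j; F 3; F 4],
    t (x1 y) [:: F 5; F j; F 3] = t (x1 y) [:: F j; F 3; F 5]
    & t (x1 y) [:: F 5; F j; F 4] = t (x1 y) [:: F j; F 4; F 5]].
  by split; exact: alt3_rot (talt _) _ _ _.
have [-> -> ->] := n 2; have [-> -> ->] := n1 2; have [-> -> ->] := n2 2.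
have [-> -> ->] := n 1; have [-> -> ->] := n1 1; have [-> -> ->] := n2 1.
move=> E0.
have /eqP : - (2 * det3 y (phi 1 y) (phi 2 y)) = 0.
  rewrite -[RHS](addr0 0); apply: (etrans _ (f_equal2 +%R E0 c0)).
  by rewrite /det3 /phi !row3E; ring.
by rewrite oppr_eq0 mulf_eq0 pnatr_eq0 /= => /eqP.
Qed.

Lemma t_linear_sum x (c : 'I_3 -> K) (z : 'I_3 -> E) s : x = \sum_i c i *: z i ->
  t x s = \sum_i c i * t (z i) s.
Proof.
move=> ->; pose tl : {linear E -> K^o} := HB.pack (t^~ s : E -> K^o)
  (GRing.isLinear.Build _ _ _ _ _ (tlin s)).
by rewrite -[t _ s]/(tl _) linear_sum; apply: eq_bigr => i _; rewrite linearZ.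
Qed.

Lemma x1_sum y : x1 y = \sum_i y 0 i *: x1 (delta_mx 0 i).
Proof.
pose x1l : {linear 'rV[K]_3 -> E} := HB.pack x1 (GRing.isLinear.Build _ _ _ _ _ x1_linear).
rewrite {1}[y]row_sum_delta -[x1 _]/(x1l _) linear_sum; apply: eq_bigr => i _.
by rewrite linearZ.
Qed.

Definition phi_mx j : 'M[K]_3 := \matrix_i phi j (delta_mx 0 i).

Lemma phi_mxE j y : y *m phi_mx j = phi j y.
Proof.
have tE s : t (x1 y) s = \sum_i y 0 i * t (x1 (delta_mx 0 i)) s.
  exact: t_linear_sum (x1_sum y).
by apply: row3P; rewrite !mxE /= tE -?sumrN; apply: eq_bigr => i _; rewrite !mxE /= ?mulrN.
Qed.

Lemma phi_mx_dependent : dependent3 (phi_mx 1) (phi_mx 2).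
Proof. by move=> y; rewrite !phi_mxE phi_dependent. Qed.

Section TameForm.
Variables (g : seq V -> K) (ga : alt3 g).

(** The form vanishes when two arguments are in [W]: its trivector is tangent
    at [x0] to the cone of decomposable trivectors. *)
Definition tame : Prop := forall k, (k < 6)%N ->
  [/\ g [:: F 0; F 1; F k] = 0, g [:: F 0; F 2; F k] = 0 & g [:: F 1; F 2; F k] = 0].

Lemma form_wv p q c : g [:: wv c; p; q] = \sum_i c 0 i * g [:: F i; p; q].
Proof. by rewrite /wv (alt3_sum ga). Qed.

Lemma form_WW z c d : g [:: F 0; F 1; z] = 0 -> g [:: F 0; F 2; z] = 0 -> g [:: F 1; F 2; z] = 0 ->
  g [:: wv c; wv d; z] = 0.
Proof.
move=> h1 h2 h3; rewrite form_wv big1 // => i _; rewrite (alt3_sum2 ga) big1 ?mulr0 // => j _.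
rewrite (_ : g _ = 0) ?mulr0 //; move: i j; apply: ord3_ind; apply: ord3_ind => //=;
  by rewrite ?(alt3_eq12 ga) // (alt3_12 ga) ?h1 ?h2 ?h3 oppr0.
Qed.

Lemma tame_WW z c d : tame -> (exists k, (k < 6)%N /\ z = F k) -> g [:: wv c; wv d; z] = 0.
Proof. by move=> tg [k [k6 ->]]; have [h1 h2 h3] := tg k k6; exact: form_WW. Qed.

Lemma tame_WWW c d u : tame -> g [:: wv c; wv d; wv u] = 0.
Proof.
move=> tg; rewrite (alt3_sum3 ga) big1 // => k _; rewrite tame_WW ?mulr0 //.
by exists k; split=> //; exact: ltn_trans (ltn_ord k) _.
Qed.

Lemma tame_WWU c d u : tame -> g [:: wv c; wv d; uv u] = 0.
Proof.
move=> tg; rewrite (alt3_sum3 ga) big1 // => k _; rewrite tame_WW ?mulr0 //.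
by exists (3 + k)%N; split=> //; rewrite (ltn_add2l 3 k 3).
Qed.

Lemma form_UU z a b : g [:: z; uv a; uv b] =
  det3 (row3 (g [:: z; F 4; F 5]) (- g [:: z; F 3; F 5]) (g [:: z; F 3; F 4])) a b.
Proof.
rewrite (alt3_sum2 ga) sum3 !(alt3_sum3 ga) !sum3 /= !(alt3_eq23 ga).
rewrite (alt3_23 ga z (F 4) (F 3)) (alt3_23 ga z (F 5) (F 3)) (alt3_23 ga z (F 5) (F 4)).
by rewrite /det3 !row3E; ring.
Qed.

End TameForm.

Lemma tameP (g : seq V -> K) (ga : alt3 g) :
    g [:: F 0; F 1; F 2] = 0 ->
    (forall j k, (0 < j < 3)%N -> (2 < k < 6)%N -> g [:: F 0; F j; F k] = 0) ->
    (forall k, (2 < k < 6)%N -> g [:: F 1; F 2; F k] = 0) -> tame g.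
Proof.
move=> h012 h0 h12; case=> [|[|[|k]]] k6.
- by rewrite !(alt3_eq13 ga) -(alt3_rot ga).
- by rewrite (alt3_eq23 ga) (alt3_23 ga) h012 oppr0 (alt3_eq13 ga).
- by rewrite h012 !(alt3_eq23 ga).
- by rewrite !h0 // h12.
Qed.

Lemma tame_x0 : tame (t x0).
Proof. by apply: tameP => //; exact: x0_12. Qed.

Lemma tame_x1 y : tame (t (x1 y)).
Proof. apply: tameP => //; [exact: x1_012|by move=> j k; exact: x1_0jk|exact: x1_12]. Qed.

Lemma x0_UU c a b : t x0 [:: wv c; uv a; uv b] = 0.
Proof.
rewrite form_wv // sum3 /= !form_UU // !x0v z134 z234 z135 z235 z145 z245.
by rewrite /det3 !row3E; ring.
Qed.

Lemma x1_UU y c a b :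
  t (x1 y) [:: wv c; uv a; uv b] = det3 (y *m ncomb (phi_mx 1) (phi_mx 2) c) a b.
Proof.
rewrite form_wv // sum3 /= !form_UU // x1_034 x1_035 x1_045.
rewrite /ncomb !mulmxDr -!scalemxAr !phi_mxE mulmxN mul_mx_scalar.
rewrite -/(phi 1 y) -/(phi 2 y); move: (phi 1 y) (phi 2 y) => u v.
by rewrite /det3 !mxE /=; ring.
Qed.

(** The dichotomy for [phi 1] and [phi 2], read in [V]. Either a vector of [W]
    is killed by the linear maps of all the [x1 y], or a plane of [W] is sent
    into a fixed line of [U] by all of them. The matrix [B] puts this vector,
    or plane, first in a basis of [W], and [C] this line first in a basis of
    [U]. *)
Theorem frame_dichotomy : exists B C : 'M[K]_3, [/\ B \in unitmx, C \in unitmx &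
   (forall y a b, t (x1 y) [:: wv (row i0 B); uv a; uv b] = 0) \/
   (forall y b, t (x1 y) [:: wv (row i0 B); uv (row i0 C); uv b] = 0 /\
                t (x1 y) [:: wv (row i1 B); uv (row i0 C); uv b] = 0)].
Proof.
have [[c cn c0]|[c [c' [m [cc mn mP]]]]] := dependent3_dichotomy phi_mx_dependent.
  have [B Bu B0] := complete_one cn; exists B, 1%:M; split=> //; first exact: unitmx1.
  left=> y a b; rewrite B0.
  by rewrite x1_UU c0 mulmx0 /det3 !mxE; ring.
have [B Bu [B0 B1]] := complete_two cc; have [C Cu C0] := complete_one mn.
exists B, C; split=> //.
have sm z b : (z <= m)%MS -> det3 z m b = 0.
  by move=> /sub_rVP[k ->]; rewrite /det3 !mxE; ring.
by right=> y b; rewrite C0 B0 B1 !x1_UU; have [h1 h2] := mP y; rewrite !sm.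
Qed.

(** Contraction with [f_0] kills [x0] and sends [x1 y] to a 2-form on [U] that
    determines [y]. *)
Lemma x0x1_free : x0 != 0 ->
  free [tuple x0; x1 (delta_mx 0 i0); x1 (delta_mx 0 i1); x1 (delta_mx 0 i2)].
Proof.
move=> x0n; apply/freeP => k; rewrite !big_ord_recl big_ord0 addr0 /= => E0.
have td a u v s : t (a *: u + v) s = a * t u s + t v s by exact: tlin.
have t0 s : t 0 s = 0 by have := td (-1) 0 0 s; rewrite scaler0 addr0 mulN1r addNr.
have tZ a u s : t (a *: u) s = a * t u s by rewrite -[_ *: u]addr0 td t0 addr0.
have ev p q : t x0 [:: F 0; p; q] = 0 by exact: x0v.
move: E0; set k0 := k _; set k1 := k _; set k2 := k _; set k3 := k _ => E0.
have [z3 z2 z1] : [/\ k3 = 0, k2 = 0 & k1 = 0].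
  split.
  - have := congr1 (t^~ [:: F 0; F 3; F 4]) E0; rewrite t0 !td tZ ev !x1_034 !mxE /=.
    by rewrite !oppr0 !mulr0 !add0r mulrN mulr1 => /eqP; rewrite oppr_eq0 => /eqP.
  - have := congr1 (t^~ [:: F 0; F 3; F 5]) E0; rewrite t0 !td tZ ev !x1_035 !mxE /=.
    by rewrite !mulr0 !add0r addr0 mulr1.
  - have := congr1 (t^~ [:: F 0; F 4; F 5]) E0; rewrite t0 !td tZ ev !x1_045 !mxE /=.
    by rewrite !oppr0 !mulr0 !add0r !addr0 mulrN mulr1 => /eqP; rewrite oppr_eq0 => /eqP.
have z0 : k0 = 0.
  move: E0; rewrite z1 z2 z3 !scale0r !addr0 => /eqP.
  by rewrite scaler_eq0 (negPf x0n) orbF => /eqP.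
case=> [[|[|[|[|i]]]] lt] //; [rewrite -z0|rewrite -z1|rewrite -z2|rewrite -z3]; congr k; exact/val_inj.
Qed.

Lemma wv_mul (B : 'M[K]_3) u : wv (u *m B) = \sum_i u 0 i *: wv (row i B).
Proof.
rewrite /wv; under [RHS]eq_bigr do rewrite scaler_sumr; rewrite exchange_big.
apply: eq_bigr => j _; rewrite mxE scaler_suml; apply: eq_bigr => i _ /=.
by rewrite mxE scalerA.
Qed.

Lemma uv_mul (B : 'M[K]_3) u : uv (u *m B) = \sum_i u 0 i *: uv (row i B).
Proof.
rewrite /uv; under [RHS]eq_bigr do rewrite scaler_sumr; rewrite exchange_big.
apply: eq_bigr => j _; rewrite mxE scaler_suml; apply: eq_bigr => i _ /=.
by rewrite mxE scalerA.
Qed.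

Definition new_frame (B C : 'M[K]_3) : 6.-tuple V :=
  [tuple wv (row i0 B); wv (row i1 B); wv (row i2 B); uv (row i0 C); uv (row i1 C); uv (row i2 C)].

Lemma new_frame_basis B C : B \in unitmx -> C \in unitmx ->
  basis_of {:V} f -> basis_of {:V} (new_frame B C).
Proof.
move=> Bu Cu fb; have df : \dim {:V} = 6%N by case/andP: fb => /eqP <- /eqP ->; rewrite size_tuple.
rewrite basisEdim df leqnn andbT -(span_basis fb); apply/span_subvP => z zf.
have inS z' : z' \in (new_frame B C : seq V) -> z' \in <<new_frame B C>>%VS by exact: memv_span.
have wS u : wv u \in <<new_frame B C>>%VS.
  rewrite -[u](mulmxKV Bu) wv_mul; apply: memv_suml => i _; apply/memvZ/inS.
  by move: i; apply: ord3_ind; rewrite !inE eqxx ?orbT.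
have uS u : uv u \in <<new_frame B C>>%VS.
  rewrite -[u](mulmxKV Cu) uv_mul; apply: memv_suml => i _; apply/memvZ/inS.
  by move: i; apply: ord3_ind; rewrite !inE eqxx ?orbT.
have wE (i : 'I_3) : F i = wv (delta_mx 0 i).
  rewrite /wv (bigD1 i) //= mxE !eqxx scale1r big1 ?addr0 // => j ji.
  by rewrite mxE (negPf ji) scale0r.
have uE (i : 'I_3) : F (3 + i) = uv (delta_mx 0 i).
  rewrite /uv (bigD1 i) //= mxE !eqxx scale1r big1 ?addr0 // => j ji.
  by rewrite mxE (negPf ji) scale0r.
have [i i6 <-] := nthP 0 zf; rewrite size_tuple in i6.
case: (ltnP i 3) => i3; first by have -> : i = val (Ordinal i3) by []; rewrite wE.
have i33 : (i - 3 < 3)%N by rewrite ltn_subLR.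
have -> : i = (3 + val (Ordinal i33))%N by rewrite /= subnKC.
by rewrite uE.
Qed.

End LocalStructure.

(** * Destabilizing flags *)

(** The outcome of the local study, for an abstract family of alternating
    forms: it is used for trivectors, and for their images under [delta]. *)
Section Unstable.
Variables (K : numClosedFieldType) (V E : vectType K) (t : E -> seq V -> K).
Hypothesis dimV : \dim {:V} = 6%N.
Hypothesis talt : forall x, alt3 (t x).
Hypothesis tlin : forall s, linear (t^~ s : E -> K^o).
Variable A : {vspace E}.
Hypothesis dA : \dim A = 10%N.
Local Notation T f x := (fun s => t x (map (nth 0 f) s)).
Hypothesis isoA : forall f : 6.-tuple V, basis_of {:V} f ->
  {in A &, forall x y, triple_pairing (T f x) (T f y) = 0}.
Hypothesis tinj : forall f : 6.-tuple V, basis_of {:V} f ->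
  forall x, (forall a, a \in triples -> T f x a = 0) -> x = 0.
Hypothesis Akernel : forall v, v != 0 ->
  exists x, [/\ x \in A, x != 0 & forall p q, t x [:: v; p; q] = 0].

(** [A] has a basis [b] such that only weights at least [mu_j] occur in [b_j],
    in the sense explained at [level]. *)
Definition unstable_wrt (f : 6.-tuple V) (w : nat -> int) (mu : seq int) : Prop :=
  exists2 b : 10.-tuple E, basis_of A b &
    forall (j : 'I_10) a, a \in triples -> - mu`_j < wt w a -> T f b`_j a = 0.

(** Weights for the flag of a vector of [W] inside [W]. Those of [x0] and of
    the three tangent vectors are at least 12 and 5; the other entries of
    [levels13] come from the dimension count of [admissible]. *)
Definition weights13 : nat -> int := nth 0 [:: 6; 3; 3; -4; -4; -4].
Definition levels13 : seq int := [:: 12; 5; 5; 5; -2; -2; -2; -5; -5; -5].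
(** Weights for the flag formed by a plane [L] of [W], and by the sum of [W]
    and of the line that receives the image of [L]. *)
Definition weights24 : nat -> int := nth 0 [:: 1; 1; 0; 0; -1; -1].
Definition levels24 : seq int := [:: 2; 1; 1; 1; 0; 0; 0; 0; -1; -2].

Lemma admissible13 : admissible weights13 12 5 levels13. Proof. by vm_compute. Qed.
Lemma admissible24 : admissible weights24 2 1 levels24. Proof. by vm_compute. Qed.

(** The four vectors of [A] needed by [destabilizing_basis] are [x0] and a
    basis of the tangent vectors [x1 y]. *)
Theorem unstable_of_kernels : exists f : 6.-tuple V, basis_of {:V} f /\
  (unstable_wrt f weights13 levels13 \/ unstable_wrt f weights24 levels24).
Proof.
have V0 : exists v : V, v != 0.
  have : (vbasis {:V})`_0 \in (vbasis {:V} : seq V) by rewrite mem_nth // size_tuple dimV.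
  move=> /(free_not0 (basis_free (vbasisP _))) => v0; by exists (vbasis {:V})`_0.
have [v [x0 [J [[vn x0A x0n x0v] [JD JA Jeq]]]]] := kernel_jets talt tlin Akernel V0.
have [e eb] : exists e : 6.-tuple V, basis_of {:V} e.
  by exists (tcast dimV (vbasis {:V})); case: _ / dimV; exact: vbasisP.
have [a aT ta] : exists2 a, a \in triples & T e x0 a != 0.
  apply: boolp.contrapT => h; case/eqP: x0n; apply: (tinj eb) => a aT.
  by apply/eqP; apply: boolp.contrapT => /negP ta; apply: h; exists a.
have [x3 [x4 [x5 tx]]] : exists x3 x4 x5, t x0 [:: x3; x4; x5] != 0.
  move: ta; move: a aT; apply: triples_ind => /= ta; by eexists; eexists; eexists; exact: ta.
have [f [fb f0 f345 fW]] := adapted_frame dimV (talt x0) vn x0v tx.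
rewrite -f0 in x0v Jeq; have isoF := isoA fb.
have [B [C [Bu Cu BC]]] := frame_dichotomy talt tlin isoF x0v f345 fW JD JA Jeq.
have nb := new_frame_basis Bu Cu fb; set f' := new_frame f B C in nb.
pose x y := x1 f x0 J y.
have tx0 : tame f (t x0) by exact: (tame_x0 talt isoF x0v f345 fW JA Jeq).
have tx1 y : tame f (t (x y)) by exact: (tame_x1 talt tlin isoF x0v f345 fW JD JA Jeq).
have xU c a' b : t x0 [:: wv f c; uv f a'; uv f b] = 0.
  exact: (x0_UU talt x0v fW).
pose X := [tuple x0; x (delta_mx 0 i0); x (delta_mx 0 i1); x (delta_mx 0 i2)].
have Xf : free X by exact: (x0x1_free talt tlin x0v f345 Jeq x0n).
have XA : all (mem A) X.
  by rewrite /= x0A !(x1A f JA).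
have Xin z : z \in (X : seq E) -> z = x0 \/ exists y, z = x y.
  by rewrite !inE => /or4P[] /eqP ->; [left|right; eexists..].
have tlinf s : linear (t^~ (map (nth 0 f') s) : E -> K^o) by exact: tlin.
have X0 (w : nat -> int) m : (- m < wt w [:: 3; 4; 5]%N) = false ->
    forall a, a \in triples -> - m < wt w a -> T f' X`_0 a = 0.
  move=> mw; apply: triples_ind => //=; rewrite ?mw // => _;
    by rewrite ?(tame_WWW (talt _)) ?(tame_WWU (talt _)) ?xU.
have tX0 z : z \in (X : seq E) -> tame f (t z).
  by move=> /Xin[->|[y ->]].
exists f'; split=> //; case: BC => BC; [left|right].
- apply: (destabilizing_basis tlinf (tinj nb) dA (isoA nb) Xf XA _ _ admissible13).
    by apply: X0; vm_compute.
  move=> z a' zX; move: a'; apply: triples_ind => //= _;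
    rewrite ?(tame_WWW (talt _)) ?(tame_WWU (talt _)) //; try (exact: tX0);
    by case: (Xin z zX) => [->|[y ->]]; rewrite ?xU ?BC.
- have h1 y b := proj1 (BC y b); have h2 y b := proj2 (BC y b).
  apply: (destabilizing_basis tlinf (tinj nb) dA (isoA nb) Xf XA _ _ admissible24).
    by apply: X0; vm_compute.
  move=> z a' zX; move: a'; apply: triples_ind => //= _;
    rewrite ?(tame_WWW (talt _)) ?(tame_WWU (talt _)) //; try (exact: tX0);
    by case: (Xin z zX) => [->|[y ->]]; rewrite ?xU ?h1 ?h2.
Qed.
End Unstable.

(** * The alternating form of a trivector *)

Section Extend.
Variables (K : fieldType) (V U : lmodType K) (k m : nat) (s : seq V).
Variable F : ('I_(k + m) -> V) -> U.

Definition extend (v : 'I_k -> V) : 'I_(k + m) -> V :=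
  fun i => match split i with inl j => v j | inr j => s`_j end.

Lemma extend_upd v i x : extend (upd v i x) = upd (extend v) (lshift m i) x.
Proof.
apply: boolp.funext => j; rewrite /extend /upd.
case: splitP => l jl.
  by have -> : (j == lshift m i) = (l == i) by rewrite -!val_eqE /= jl.
have -> // : (j == lshift m i) = false.
by rewrite -val_eqE /= jl gtn_eqF // ltn_addr.
Qed.

Lemma multilinear_extend : multilinear F -> multilinear (fun v => F (extend v)).
Proof. by move=> Fml v i a x y; rewrite !extend_upd Fml. Qed.

Lemma alternating_extend : alternating F -> alternating (fun v => F (extend v)).
Proof.
move=> Falt v i j ij vij; apply: (Falt _ (lshift m i) (lshift m j)).
  by rewrite (inj_eq (@lshift_inj _ _)).
have E l : extend v (lshift m l) = v l.
  rewrite /extend; case: splitP => l' /= ll'; first by congr v; exact/val_inj.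
  by have := ltn_ord l; rewrite ll' ltnNge leq_addr.
by rewrite !E.
Qed.

End Extend.

Section TrivectorForm.
Variables (K : numFieldType) (V : vectType K) (vol : 'Hom(Lambda 6 V, K^o)).

Lemma tau_alt3 x : alt3 (tau vol x).
Proof.
split=> [a u v p q|u v w|u v w]; rewrite /tau /symp.
- by have /= -> := @wl_linear _ _ 3 [:: 0; p; q] ord0 a u v; rewrite !linearP.
- by rewrite (@wl_swap _ _ 3 [::]) // !linearN.
- by rewrite (@wl_swap _ _ 3 [:: u]) // !linearN.
Qed.

Lemma symp_linearl y : linear (symp vol ^~ y : Lambda 3 V -> K^o).
Proof. by move=> a x x'; rewrite /symp wedgePl linearP. Qed.

(** Pairing with [v /\ p /\ q] factors through the product by [v]. *)
Lemma tau_Fiber v x p q : x \in Fiber v -> tau vol x [:: v; p; q] = 0.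
Proof.
rewrite memv_ker lfunE /= wl1E => /eqP vx.
pose F (u : 'I_4 -> V) : K^o := vol (wedgev (extend [:: p; q] u : 'I_(4 + 2) -> V)).
pose G (u : 'I_(4 + 2) -> V) : K^o := vol (wedgev u).
have Fml : multilinear F.
  apply: (@multilinear_extend _ _ _ 4 2 [:: p; q] G).
  by move=> u i a y z; rewrite /G wedgev_multilinear linearP.
have Falt : alternating F.
  apply: (@alternating_extend _ _ _ 4 2 [:: p; q] G).
  by move=> u i j ij uij; rewrite /G (wedgev_alternating ij uij) linear0.
pose h : {linear Lambda 3 V -> K^o} :=
  (@lift_alt K V (1 + 3) K^o F \o @wedge K 1 3 V (wl 1 [:: v])).
have tlin : linear (fun x => - tau vol x [:: v; p; q] : K^o).
  by move=> a y z; rewrite /tau symp_linearl opprD scalerN.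
pose h' : {linear Lambda 3 V -> K^o} := HB.pack (fun x => - tau vol x [:: v; p; q] : K^o)
  (GRing.isLinear.Build _ _ _ _ _ tlin).
suff : h' x = h x.
  by rewrite /h' /h /= vx linear0 => /eqP; rewrite oppr_eq0 => /eqP.
apply: Lambda_ext => {x vx} u; rewrite /h' /h /=.
have -> : wedgev u = wl 3 [:: u 0; u 1; u ord_max].
  by congr wedgev; apply: boolp.funext => -[[|[|[|i]]] lt] //=; congr u; exact/val_inj.
rewrite /tau symp_wl3 wedge_cons (lift_altE Fml Falt) /F.
have -> : wedgev (extend [:: p; q] (fun i : 'I_4 => [:: v; u 0; u 1; u ord_max]`_i) : 'I_(4 + 2) -> V)
   = wl 6 [:: v; u 0; u 1; u ord_max; p; q].
  congr wedgev; apply: boolp.funext => i; rewrite /extend.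
  by case: splitP => j ->; case: j => -[|[|[|[|j]]]].
rewrite (@wl_swap _ _ 6 [::] v) // (@wl_swap _ _ 6 [:: u 0] v) //.
by rewrite (@wl_swap _ _ 6 [:: u 0; u 1] v) //= opprK linearN.
Qed.

Variable f : 6.-tuple V.
Hypothesis fb : basis_of {:V} f.
Hypothesis vol0 : vol != 0.
Local Notation fN := (nth 0 f).

Lemma vol_basis_neq0 : vol (wl 6 f) != 0.
Proof.
apply: contra vol0 => /eqP v0; apply/eqP/lfunP => x; rewrite zero_lfunE.
apply: (wedgev_span (P := fun x => vol x = 0) fb) => {x} [S|a x y vx vy|].
- rewrite -[RHS]v0; congr (vol (wedgev _)); apply: boolp.funext => i.
  congr (_`_(nat_of_ord _)); apply: (@ksub_nth_uniq 6 6 S id) => // j.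
  have /eqP -> : val S == setT by rewrite eqEcard subsetT cardsT card_ord (eqP (valP S)).
  by rewrite inE.
- by rewrite linearP /= vx vy scaler0 addr0.
- exact: linear0.
Qed.

Lemma eps_diag : all (fun a => all (fun b => (eps (a ++ co_triple b) != 0) ==> (a == b)) triples) triples.
Proof. by vm_compute. Qed.

Lemma tau_coord (c : seq nat -> K) b : b \in triples ->
  tau vol (\sum_(a <- triples) c a *: wl 3 (map fN a)) (map fN (co_triple b)) =
  c b * ((eps (b ++ co_triple b))%:~R * vol (wl 6 f)).
Proof.
move=> bT; rewrite /tau symp_suml (bigD1_seq b) ?uniq_triples //= symp_triples ?mem_co_triple //.
rewrite big1_seq ?addr0 // => a /andP[ab aT]; rewrite symp_triples ?mem_co_triple //.
have /implyP := allP (allP eps_diag _ aT) _ bT; rewrite (negPf ab).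
by case: eqP => [->|_ /(_ isT)//]; rewrite mul0r mulr0.
Qed.

Lemma eps_co_tripler_neq0 a : a \in triples -> (eps (a ++ co_triple a))%:~R != 0 :> K.
Proof. by move=> aT; have := eps_co_triple_neq0 K (mem_co_triple aT); rewrite co_tripleK. Qed.

Lemma tau_coord_neq0 (c : seq nat -> K) b : b \in triples -> c b != 0 ->
  tau vol (\sum_(a <- triples) c a *: wl 3 (map fN a)) (map fN (co_triple b)) != 0.
Proof.
by move=> bT cb; rewrite tau_coord // !mulf_neq0 ?eps_co_tripler_neq0 ?vol_basis_neq0.
Qed.

Lemma tau_inj x : (forall a, a \in triples -> tau vol x (map fN a) = 0) -> x = 0.
Proof.
have [c ->] := Lambda3_triples fb x => h; rewrite big1_seq // => a /andP[_ aT].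
have [->|ca] := eqVneq (c a) 0; first by rewrite scale0r.
by have := tau_coord_neq0 aT ca; rewrite h ?mem_co_triple // eqxx.
Qed.

End TrivectorForm.

(** * Duality *)

Lemma ksub_seq_inj n : injective (@ksub_seq n).
Proof.
move=> S T ST; apply/val_inj/eqP; rewrite eqEcard (eqP (valP S)) (eqP (valP T)) leqnn andbT.
apply/subsetP => x /ksub_nthP[i ->].
have -> : ksub_nth S i = ksub_nth T i.
  by apply/val_inj; have := ksub_seqE S id 0%N i; rewrite ST -(ksub_seqE T id 0%N i).
exact: ksub_nth_in.
Qed.

Lemma sum_ksub (K : nmodType) n (G : seq nat -> K) : n = 6%N ->
  \sum_(S : ksub n 3) G (ksub_seq S) = \sum_(a <- triples) G a.
Proof.
move=> n6; rewrite -(big_map (@ksub_seq n) xpredT G); apply: perm_big.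
have us : uniq (map (@ksub_seq n) (index_enum {: ksub n 3})).
  by rewrite map_inj_uniq ?index_enum_uniq //; exact: ksub_seq_inj.
have sub : {subset map (@ksub_seq n) (index_enum {: ksub n 3}) <= triples}.
  by move=> a /mapP[S _ ->]; exact: ksub_seq_triples.
have sz : (size triples <= size (map (@ksub_seq n) (index_enum {: ksub n 3})))%N.
  rewrite size_map -[index_enum _]enumT -cardE card_sig.
  have := card_draws 'I_n 3; rewrite card_ord n6 cardsE => ->.
  by vm_compute.
by have [_ eqi] := uniq_min_size us sub sz; apply: uniq_perm; rewrite ?uniq_triples.
Qed.

(** The signs form a matrix that is, up to sign, its own inverse: this is why
    the symplectic form of the dual space undoes [delta] up to a constant. *)
Lemma eps_inverse_check : all (fun a => all (fun c =>
   sum_triples (fun b => eps (a ++ b) * eps (b ++ c)) == if a == c then -1 else 0) triples) triples.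
Proof. by vm_compute. Qed.

Lemma triples_incomparable_check : all (fun a : seq nat =>
  all (fun b => (a != b) ==> has (fun x => x \notin a) b) triples) triples.
Proof. by vm_compute. Qed.

Section Dual.
Variables (K : numFieldType) (V : vectType K).
Local Notation n := (\dim {:V}).
Local Notation V' := (dual V).
Hypothesis dimV : n = 6%N.

Lemma dvecE (i : 'I_n) (v : V) : dvec i v = coord (vbasis {:V}) i v.
Proof. by rewrite /dvec lfunE. Qed.

Lemma dvec_bvec (i j : 'I_n) : dvec i (bvec j) = (j == i)%:R.
Proof. by rewrite dvecE coord_bvec. Qed.

Lemma dual_ext (u u' : V') : (forall i, u (bvec i) = u' (bvec i)) -> u = u'.
Proof.
move=> h; apply/lfunP => v; rewrite (coord_vbasis (memvf v)) !linear_sum.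
by apply: eq_bigr => i _; rewrite !linearZ /= h.
Qed.

Lemma dual_expand (u : V') : u = \sum_i u (bvec i) *: dvec i.
Proof.
apply: dual_ext => j; rewrite sum_lfunE (bigD1 j) //= big1 ?addr0 => [|i ij].
  by rewrite scale_lfunE dvec_bvec eqxx /GRing.scale /= mulr1.
by rewrite scale_lfunE dvec_bvec eq_sym (negPf ij) scaler0.
Qed.

Lemma dim_dual : \dim {: V'} = 6%N.
Proof. by rewrite dimvf /dim /= -[LHS]/(dim V * 1)%N muln1 -dimvf dimV. Qed.

Let e : 6.-tuple V := tcast dimV (vbasis {:V}).
Let d : 6.-tuple V' := tcast dimV (mktuple (@dvec K V)).

Let eE (i : 'I_n) : e`_i = bvec i. Proof. by rewrite /e val_tcast. Qed.
Let dE (i : 'I_n) : d`_i = dvec i.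
Proof. by rewrite /d val_tcast -tnth_nth tnth_mktuple. Qed.

Let eb : basis_of {:V} e.
Proof. by rewrite /e; case: _ / dimV; exact: vbasisP. Qed.

Let db : basis_of {:V'} d.
Proof.
rewrite basisEdim size_tuple dim_dual leqnn andbT; apply/subvP => u _.
rewrite (dual_expand u); apply: memv_suml => i _; apply/memvZ/memv_span.
by rewrite -dE mem_nth // size_tuple -dimV ltn_ord.
Qed.

Variables (vol : 'Hom(Lambda 6 V, K^o)) (vol' : 'Hom(Lambda 6 V', K^o)).

Definition delta_const : K := - (vol (wl 6 e) * vol' (wl 6 d)).

Lemma Lbasis_wl (S : ksub n 3) : Lbasis S = wl 3 (map (nth 0 e) (ksub_seq S)).
Proof.
rewrite -wedgev_basis; congr wedgev; apply: boolp.funext => j.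
by rewrite -ksub_seqE eE.
Qed.

Lemma wedge_dvec_wl (S : ksub n 3) :
  wedgev (fun j => dvec (ksub_nth S j)) = wl 3 (map (nth 0 d) (ksub_seq S)).
Proof.
by congr wedgev; apply: boolp.funext => j; rewrite -ksub_seqE dE.
Qed.

Lemma symp_delta_basis (S T : ksub n 3) :
  symp vol' (delta vol (Lbasis S)) (wedgev (fun j => dvec (ksub_nth T j))) =
  delta_const * (S == T)%:R.
Proof.
rewrite deltaE symp_suml.
have ST := ksub_seq_triples S dimV; have TT := ksub_seq_triples T dimV.
pose G b : K := symp vol (wl 3 (map (nth 0 e) (ksub_seq S))) (wl 3 (map (nth 0 e) b)) *
  symp vol' (wl 3 (map (nth 0 d) b)) (wl 3 (map (nth 0 d) (ksub_seq T))).
transitivity (\sum_(U : ksub n 3) G (ksub_seq U)).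
  by apply: eq_bigr => U _; rewrite /G -!Lbasis_wl -!wedge_dvec_wl.
rewrite sum_ksub //.
transitivity (\sum_(b <- triples) - delta_const * (eps (ksub_seq S ++ b) * eps (b ++ ksub_seq T))%:~R).
  apply: eq_big_seq => b bT; rewrite /G !symp_triples // /delta_const intrM; ring.
rewrite -mulr_sumr -rmorph_sum.
have := allP (allP eps_inverse_check _ ST) _ TT; rewrite sum_triplesE => /eqP ->.
rewrite (inj_eq (@ksub_seq_inj _)); case: eqP => _; last by rewrite rmorph0 !mulr0.
by rewrite rmorphN1 mulrN mulNr opprK.
Qed.

Definition contraction (u : 'I_3 -> V') (v : 'I_3 -> V) : K^o := \det (\matrix_(i, j) u i (v j)).

Lemma contraction_multilinear u : multilinear (contraction u).
Proof.
move=> v j a x y; rewrite /contraction -![\det (\matrix_(_, _) _)]det_tr /GRing.scale /=.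
rewrite -[X in _ = _ + X]mul1r.
apply: (@determinant_multilinear _ _ _ _ _ j); apply/matrixP => l i; rewrite !mxE /upd.
- by rewrite eqxx linearP mul1r.
- by rewrite eq_sym (negPf (neq_lift _ _)).
- by rewrite eq_sym (negPf (neq_lift _ _)).
Qed.

Lemma contraction_alternating u : alternating (contraction u).
Proof.
move=> v i j ij vij; rewrite /contraction -det_tr.
by apply: (determinant_alternate ij) => l; rewrite !mxE vij.
Qed.

(** Both sides are linear in [x] and alternating in [u], and on dual bases the
    equality is [symp_delta_basis]. So, up to a constant, the form of
    [delta vol x] on the dual space is [x] itself, evaluated at functionals. *)
Theorem symp_delta (u : 'I_3 -> V') (x : Lambda 3 V) :
  symp vol' (delta vol x) (wedgev u) = delta_const * lift_alt (contraction u) x.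
Proof.
have lin1 : linear (fun x => symp vol' (delta vol x) (wedgev u) : K^o).
  by move=> a y z; rewrite linearP; exact: symp_linearl.
have lin2 : linear (fun x => delta_const * lift_alt (contraction u) x : K^o).
  by move=> a y z; rewrite linearP mulrDr; congr (_ + _); exact: mulrCA.
pose L1 : {linear Lambda 3 V -> K^o} := HB.pack (fun x => symp vol' (delta vol x) (wedgev u) : K^o)
  (GRing.isLinear.Build _ _ _ _ _ lin1).
pose L2 : {linear Lambda 3 V -> K^o} := HB.pack
  (fun x => delta_const * lift_alt (contraction u) x : K^o) (GRing.isLinear.Build _ _ _ _ _ lin2).
suff h S : L1 (Lbasis S) = L2 (Lbasis S).
  rewrite -[LHS]/(L1 x) -[RHS]/(L2 x) [x]Lambda_expand !linear_sum.
  by apply: eq_bigr => S _; rewrite [L1 _]linearZ [L2 _]linearZ h.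
rewrite /L1 /L2 /= {L1 L2 lin1 lin2}.
rewrite -{2}wedgev_basis (lift_altE (@contraction_multilinear u) (@contraction_alternating u)).
apply/eqP; rewrite -subr_eq0; apply/eqP.
pose Phi u : K^o := symp vol' (delta vol (Lbasis S)) (wedgev u) -
   delta_const * contraction u (fun j => bvec (ksub_nth S j)).
rewrite -/(Phi u); apply: (@alternating_span0 _ _ _ n (@dvec K V)).
- by move=> u'; exists (fun i => u' (bvec i)); exact: dual_expand.
- move=> {}u i a y z; rewrite /Phi wedgev_multilinear /symp linearP [vol' _]linearP /=.
  have -> : contraction (upd u i (a *: y + z)) (fun j => bvec (ksub_nth S j)) =
      a * contraction (upd u i y) (fun j => bvec (ksub_nth S j)) +
      contraction (upd u i z) (fun j => bvec (ksub_nth S j)).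
    rewrite -[X in _ = _ + X]mul1r.
    apply: (@determinant_multilinear _ _ _ _ _ i); apply/matrixP => l j; rewrite !mxE /upd.
    + by rewrite eqxx add_lfunE scale_lfunE mul1r.
    + by rewrite eq_sym (negPf (neq_lift _ _)).
    + by rewrite eq_sym (negPf (neq_lift _ _)).
  by rewrite mulrDr scalerBr opprD addrACA /GRing.scale /= [delta_const * (a * _)]mulrCA.
- move=> {}u i j ij uij; rewrite /Phi (wedgev_alternating ij uij) /symp !linear0 sub0r.
  rewrite (_ : contraction _ _ = 0) ?mulr0 ?oppr0 //.
  by apply: (determinant_alternate ij) => l; rewrite !mxE uij.
move=> T; rewrite /Phi symp_delta_basis.
rewrite (_ : contraction _ _ = (S == T)%:R) ?subrr //.
rewrite eq_sym -wedgev_bvec /contraction -det_tr ffunE; congr (\det _).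
by apply/matrixP => i j; rewrite !mxE dvecE.
Qed.

Lemma delta_const_neq0 : vol != 0 -> vol' != 0 -> delta_const != 0.
Proof.
by move=> v0 v0'; rewrite oppr_eq0 mulf_neq0 //; [exact: vol_basis_neq0 eb v0|exact: vol_basis_neq0 db v0'].
Qed.

Section DualBases.
Variables (f' : 6.-tuple V') (f : 6.-tuple V).
Hypothesis ff : forall i j, (i < 6)%N -> (j < 6)%N -> f'`_i f`_j = (i == j)%:R.

(** The form of [delta vol x] on [b] gives the coordinate of [x] on [b], where
    that of [x] gives the one on the complementary triple. Passing to the dual space
    thus reverses the weights. *)
Lemma tau_delta (c : seq nat -> K) b : b \in triples ->
  tau vol' (delta vol (\sum_(a <- triples) c a *: wl 3 (map (nth 0 f) a))) (map (nth 0 f') b) =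
  delta_const * c b.
Proof.
move=> bT; rewrite /tau /wl symp_delta; congr (_ * _).
have sz a : a \in triples -> size a = 3%N.
  by move=> aT; apply/eqP; apply: (allP (_ : all (fun s => size s == 3%N) triples)) aT; vm_compute.
have lt6 a i : a \in triples -> i \in a -> (i < 6)%N.
  by move=> aT; apply: (allP (allP (_ : all (fun s => all (fun i => i < 6)%N s) triples) _ aT)); vm_compute.
have un a : a \in triples -> uniq a.
  by move=> aT; apply: (allP (_ : all uniq triples)) aT; vm_compute.
rewrite linear_sum (bigD1_seq b) ?uniq_triples //= linearZ /=.
have ent a (i j : 'I_3) : a \in triples ->
    (map (nth 0 f') b)`_i (map (nth 0 f) a)`_j = (nth 0%N b i == nth 0%N a j)%:R.
  move=> aT; rewrite !(nth_map 0%N) ?sz //.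
  by rewrite ff //; [apply: (lt6 b)|apply: (lt6 a)]; rewrite ?mem_nth ?sz.
rewrite (lift_altE (@contraction_multilinear _) (@contraction_alternating _)).
rewrite (_ : contraction _ _ = 1); last first.
  rewrite -[RHS](det1 _ 3); congr (\det _); apply/matrixP => i j.
  by rewrite !mxE ent // nth_uniq ?sz ?un.
rewrite /GRing.scale /= mulr1 big1_seq ?addr0 // => a /andP[ab aT].
rewrite linearZ /= (lift_altE (@contraction_multilinear _) (@contraction_alternating _)).
rewrite (_ : contraction _ _ = 0) ?scaler0 //.
have /implyP/(_ ab)/hasP[x xb xa] := allP (allP triples_incomparable_check _ aT) _ bT.
have ix : (index x b < 3)%N by rewrite -(sz b bT) index_mem.
rewrite /contraction (expand_det_row _ (Ordinal ix)) big1 // => j _.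
rewrite !mxE ent //= nth_index //; case: eqP => [xE|]; last by rewrite mul0r.
by case/negP: xa; rewrite [X in X \in a]xE mem_nth ?sz.
Qed.

End DualBases.

Lemma dual_basis (f' : 6.-tuple V') : basis_of {:V'} f' ->
  exists2 f : 6.-tuple V, basis_of {:V} f &
    forall i j, (i < 6)%N -> (j < 6)%N -> f'`_i f`_j = (i == j)%:R.
Proof.
move=> fb'; pose M := \matrix_(i < 6, j < 6) f'`_i e`_j.
have Mu : M \in unitmx.
  rewrite -row_free_unit; apply/inj_row_free => x xM.
  have xf : \sum_i x 0 i *: f'`_i = 0.
    apply: dual_ext => k; rewrite zero_lfunE sum_lfunE.
    have k6 : (k < 6)%N by rewrite -dimV.
    transitivity ((x *m M) 0 (Ordinal k6)); last by rewrite xM mxE.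
    by rewrite mxE; apply: eq_bigr => i _; rewrite scale_lfunE mxE eE.
  by apply/rowP => i; have /freeP/(_ _ xf i) := basis_free fb'; rewrite mxE.
pose N := invmx M.
pose f := [tuple \sum_k N k j *: e`_k | j < 6].
have fE (j : 'I_6) : f`_j = \sum_k N k j *: e`_k by rewrite -tnth_nth tnth_mktuple.
have ff (i j : 'I_6) : f'`_i f`_j = (i == j)%:R.
  have /matrixP/(_ i j) := mulmxV Mu; rewrite !mxE => <-.
  rewrite fE linear_sum; apply: eq_bigr => k _; rewrite linearZ mxE mulrC //.
exists f => [|i j i6 j6]; last exact: (ff (Ordinal i6) (Ordinal j6)).
rewrite basisEfree dimV size_tuple leqnn subvf andbT andbT.
apply/freeP => c c0 i; have := congr1 (fun v => f'`_i v) c0; rewrite linear0 linear_sum => <-.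
rewrite (bigD1 i) //= linearZ /= ff eqxx /GRing.scale /= mulr1 big1 ?addr0 // => j ji.
by rewrite linearZ /= ff eq_sym (negPf ji) scaler0.
Qed.

End Dual.

Lemma exists_vol (K : fieldType) (V : vectType K) : \dim {:V} = 6%N ->
  exists vol : 'Hom(Lambda 6 V, K^o), vol != 0.
Proof.
move=> dimV; have cS : #|[set: 'I_(\dim {:V})]| == 6%N by rewrite cardsT card_ord dimV.
pose S : ksub (\dim {:V}) 6 := exist (fun A : {set 'I_(\dim {:V})} => #|A| == 6%N) _ cS.
have lin : linear (fun x : Lambda 6 V => x S : K^o) by move=> a x y; rewrite !ffunE.
pose h : {linear Lambda 6 V -> K^o} := HB.pack (fun x : Lambda 6 V => x S : K^o)
  (GRing.isLinear.Build _ _ _ _ _ lin).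
exists (linfun h); apply/eqP => /lfunP/(_ (Lbasis S)).
by rewrite lfunE zero_lfunE /= ffunE eqxx => /eqP; rewrite oner_eq0.
Qed.

(** * The two hypersurfaces *)

Lemma wt_co_triple w a : wt w (iota 0 6) = 0 -> a \in triples -> wt w (co_triple a) = - wt w a.
Proof.
move=> w0 aT; apply/eqP; rewrite -addr_eq0 -w0; apply/eqP.
by move: a aT; apply: triples_ind; rewrite /wt /co_triple /=; ring.
Qed.

Lemma wtN w a : wt (fun i => - w i) a = - wt w a.
Proof. by rewrite /wt; elim: a => [|i a /= ->]; rewrite /= ?oppr0 ?opprD. Qed.

Section Conclusion.
Variables (K : numClosedFieldType) (V : vectType K) (dimV : \dim {:V} = 6%N).
Variables (vol : 'Hom(Lambda 6 V, K^o)) (vol0 : vol != 0).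
Variables (A : {vspace Lambda 3 V}) (lagA : lagrangian vol A).

Lemma not_semistable (f : 6.-tuple V) (w : nat -> int) (mu : seq int) (b : 10.-tuple (Lambda 3 V)) :
    basis_of {:V} f -> wt w (iota 0 6) = 0 -> 0 < \sum_(j < 10) mu`_j -> basis_of A b ->
    (forall (j : 'I_10) (c : seq nat -> K), b`_j = \sum_(a <- triples) c a *: wl 3 (map (nth 0 f) a) ->
      forall a, a \in triples -> c a != 0 -> mu`_j <= wt w a) ->
  ~ semistable vol A.
Proof.
move=> fb w0 mu0 bA h.
have /boolp.choice[c cE] : forall j : 'I_10, exists c : seq nat -> K,
    b`_j = \sum_(a <- triples) c a *: wl 3 (map (nth 0 f) a).
  by move=> j; exact: Lambda3_triples.
by apply: (destabilized dimV fb w0 lagA bA cE (mu := fun j => mu`_j)) => // j; exact: h.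
Qed.

Lemma weights_ok : [/\ wt weights13 (iota 0 6) = 0, wt weights24 (iota 0 6) = 0,
  0 < \sum_(j < 10) levels13`_j & 0 < \sum_(j < 10) levels24`_j].
Proof. by split; rewrite ?big_ord_recl ?big_ord0; vm_compute. Qed.

Lemma symp_iso : {in A &, forall x y, symp vol x y = 0}.
Proof. by case: lagA. Qed.

Lemma Y_kernel (W : vectType K) (vW : 'Hom(Lambda 6 W, K^o)) (B : {vspace Lambda 3 W}) (v : W) :
    Y B = PSpace W -> v != 0 ->
  exists x, [/\ x \in B, x != 0 & forall p q, tau vW x [:: v; p; q] = 0].
Proof.
move=> YB vn; have : PSpace W <[v]>%VS by exists v.
rewrite -YB => -[v' [v'n vv' FB]].
have := memv_pick (Fiber v' :&: B); rewrite memv_cap => /andP[xF xB].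
exists (vpick (Fiber v' :&: B)); split; rewrite ?vpick0 // => p q.
have /vlineP[k ->] : v \in <[v']>%VS by rewrite -vv' memv_line.
have ga := tau_alt3 vW (vpick (Fiber v' :&: B)).
by rewrite -[_ *: v']addr0 (alt3_lin ga) tau_Fiber // (alt3_0 ga) mulr0 addr0.
Qed.

Theorem Y_neq_PSpace : semistable vol A -> Y A <> PSpace V.
Proof.
move=> ss YA; have [w10 w20 s1 s2] := weights_ok; have [dA _] := lagA.
have iso (f : 6.-tuple V) : basis_of {:V} f -> {in A &, forall x y,
    triple_pairing (fun s => tau vol x (map (nth 0 f) s)) (fun s => tau vol y (map (nth 0 f) s)) = 0}.
  by move=> fb x y xA yA; rewrite triple_pairingE // symp_iso // mulr0.
have [f [fb U]] := unstable_of_kernels dimV (tau_alt3 vol) (fun s => symp_linearl vol (wl 3 s)) dA iso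
  (fun f fb x => tau_inj fb vol0 (x := x)) (fun v => @Y_kernel V vol A v YA).
suff main w mu : wt w (iota 0 6) = 0 -> 0 < \sum_(j < 10) mu`_j ->
    unstable_wrt (tau vol) A f w mu -> False.
  by case: U => U; [exact: main w10 s1 U|exact: main w20 s2 U].
move=> w0 mu0 [b bA bv]; apply: (not_semistable fb w0 mu0 bA _ ss) => j c bE a aT ca.
have := bv j (co_triple a) (mem_co_triple aT); rewrite wt_co_triple // bE leNgt => h.
by apply/negP => lt; move: (tau_coord_neq0 fb vol0 aT ca); rewrite h ?eqxx // ltrN2.
Qed.

(** The argument is the same with the forms of the [delta vol x] on the dual
    space, for [x] in [A]; the flag found there is transferred to [V] by dual
    bases, with the opposite weights. *)
Theorem Y_delta_neq_PSpace : semistable vol A -> Y (delta vol @: A)%VS <> PSpace (dual V).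
Proof.
move=> ss YA; have [w10 w20 s1 s2] := weights_ok; have [dA _] := lagA.
have [vol' vol'0] := exists_vol (dim_dual dimV).
pose t (x : Lambda 3 V) s := tau vol' (delta vol x) s.
have kn : delta_const dimV vol vol' != 0 by exact: delta_const_neq0.
have tlin s : linear (t^~ s : Lambda 3 V -> K^o).
  by move=> a x y; rewrite /t linearP; exact: symp_linearl.
have tker u : u != 0 -> exists x, [/\ x \in A, x != 0 & forall p q, t x [:: u; p; q] = 0].
  move=> /(Y_kernel vol' YA)[_ [/memv_imgP[x xA ->] xn xu]]; exists x; split=> //.
  by apply: contraNneq xn => ->; rewrite linear0.
have tinj (f' : 6.-tuple (dual V)) : basis_of {:dual V} f' ->
    forall x, (forall a, a \in triples -> t x (map (nth 0 f') a) = 0) -> x = 0.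
  move=> fb' x; have [f fb ff] := dual_basis dimV fb'.
  have [c ->] := Lambda3_triples fb x => h; rewrite big1_seq // => a /andP[_ aT].
  have /eqP := h a aT; rewrite /t (tau_delta dimV vol vol' ff) // mulf_eq0 (negPf kn) /=.
  by move=> /eqP ->; rewrite scale0r.
have iso (f' : 6.-tuple (dual V)) : basis_of {:dual V} f' -> {in A &, forall x y,
    triple_pairing (fun s => t x (map (nth 0 f') s)) (fun s => t y (map (nth 0 f') s)) = 0}.
  move=> fb' x y xA yA; have [f fb ff] := dual_basis dimV fb'.
  have xy := symp_iso xA yA; move: xy.
  have [c ->] := Lambda3_triples fb x; have [d ->] := Lambda3_triples fb y => xy.
  apply: (mulfI (vol_basis_neq0 fb vol0)); rewrite mulr0 /triple_pairing.
  transitivity (delta_const dimV vol vol' ^+ 2 *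
     symp vol (\sum_(a <- triples) c a *: wl 3 (map (nth 0 f) a))
              (\sum_(a <- triples) d a *: wl 3 (map (nth 0 f) a))); last by rewrite xy mulr0.
  rewrite symp_suml !mulr_sumr; apply: eq_big_seq => a aT.
  rewrite /t !(tau_delta dimV vol vol' ff) ?mem_co_triple //.
  have -> : symp vol (wl 3 (map (nth 0 f) a)) (\sum_(b <- triples) d b *: wl 3 (map (nth 0 f) b)) =
      d (co_triple a) * ((eps (a ++ co_triple a))%:~R * vol (wl 6 f)).
    rewrite symp_sumr (bigD1_seq (co_triple a)) ?uniq_triples ?mem_co_triple //=.
    rewrite symp_triples ?mem_co_triple // big1_seq ?addr0 // => b /andP[ba bT]; rewrite symp_triples //.
    have := allP (allP eps_diag _ aT) _ (mem_co_triple bT); rewrite co_tripleK //.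
    case: eqP => [->|_ /= /eqP aE]; first by rewrite mul0r mulr0.
    by case/eqP: ba; rewrite aE co_tripleK.
  by move: (eps _)%:~R (vol _) (delta_const _ _ _) => k1 k2 k3; ring.
have [f' [fb' U]] := unstable_of_kernels (dim_dual dimV)
  (fun x => tau_alt3 vol' (delta vol x)) tlin dA iso tinj tker.
have [f fb ff] := dual_basis dimV fb'.
suff main w mu : wt w (iota 0 6) = 0 -> 0 < \sum_(j < 10) mu`_j ->
    unstable_wrt t A f' w mu -> False.
  by case: U => U; [exact: main w10 s1 U|exact: main w20 s2 U].
move=> w0 mu0 [b bA bv].
have w0' : wt (fun i => - w i) (iota 0 6) = 0 by rewrite wtN w0 oppr0.
apply: (not_semistable fb w0' mu0 bA _ ss) => j c bE a aT ca.
have := bv j a aT; rewrite wtN leNgt => h; apply/negP => lt; case/eqP: ca.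
have /eqP : t b`_j (map (nth 0 f') a) = 0 by apply: h; rewrite ltrNl.
by rewrite bE /t (tau_delta dimV vol vol' ff) // mulf_eq0 (negPf kn) => /eqP.
Qed.

End Conclusion.

Theorem corollary3p4p6 (R : realType) (V : vectType R[i])
    (dimV : \dim {:V} = 6%N)
    (vol : 'Hom(Lambda 6 V, R[i]^o)) (vol_neq0 : vol != 0)
    (A : {vspace Lambda 3 V}) (lagA : lagrangian vol A)
    (ssA : semistable vol A) :
  Y A <> PSpace V /\ Y (delta vol @: A)%VS <> PSpace (dual V).
Proof.
split; first exact: (Y_neq_PSpace dimV vol_neq0 lagA ssA).
exact: (Y_delta_neq_PSpace dimV vol_neq0 lagA ssA).
Qed.
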